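(* Let $K$ be a field of characteristic zero and let $R$ be a finitely generated $\mathbb{N}$-graded $K$-algebra with $R_0=K$. Write $D_R=D_{R|K}$. (1) If there exists a nonzerodivisor $f$ in the singular locus of $R$ that admits a sandwich Bernstein-Sato polynomial with no nonnegative integer roots, then $D_R$ is linearly simple with respect to any Bernstein filtration. (2) If $R$ is an affine semigroup ring and $D_R$ with respect to any Bernstein filtration is linearly simple, then every nonzero element of $R$ admits a nonzero sandwich Bernstein-Sato polynomial. (2$'$) More generally, if $D_R\otimes_K D_R^{\mathrm{op}}$ with respect to any Bernstein filtration is linearly simple (that is, $(D_R\otimes_K D_R^{\mathrm{op}},\mathcal{B}^\bullet_{\boxtimes})$ is linearly simple, where $\mathcal{B}^\bullet$ is a Bernstein filtration on $D_R$), then every nonzero element of $R$ admits a nonzero sandwich Bernstein-Sato polynomial.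
   Context: Differential operators: for a commutative $K$-algebra $R$, $D_{R|K}\subseteq \operatorname{End}_K(R)$ is the ring of $K$-linear differential operators: $D^0_{R|K}$ is the set of multiplication operators by elements of $R$ (identified with $R$), $D^{n+1}_{R|K}=\{\delta\in\operatorname{End}_K(R): [\delta,r]\in D^n_{R|K}\text{ for all } r\in R\}$, and $D_{R|K}=\bigcup_n D^n_{R|K}$, with composition as product. The order $\operatorname{ord}(\delta)$ is the least $n$ with $\delta\in D^n_{R|K}$. Singular locus: ''$f$ is in the singular locus of $R$'' means that $f$ lies in every prime $P$ of $R$ such that $R_P$ is not regular; equivalently, $R_f$ is regular. Affine semigroup ring: a finitely generated $K$-subalgebra of a polynomial ring over $K$ that is generated by monomials. Sandwich Bernstein-Sato polynomial: a sandwich Bernstein-Sato functional equation for $f\in R$ consists of finitely many $\alpha_i(s),\beta_i(s)\in D_{R|K}[s]$ and $b(s)\in K[s]$ with $\sum_i \alpha_i(n) f^{n+1}\beta_i(n)=b(n)f^n$ as operators in $D_{R|K}$ (products are compositions) for all $n\in\mathbb{N}=\{0,1,2,\dots\}$. The set of $b(s)$ occurring is an ideal of $K[s]$; the sandwich Bernstein-Sato polynomial of $f$ is its monic generator, or $0$ if the ideal is zero. Bernstein filtration: $\delta$ is homogeneous of degree $d$ if $\delta([R]_j)\subseteq [R]_{j+d}$ for all $j$. For an integer $w$ such that $R$ is generated as a $K$-algebra by elements of degree strictly less than $w$, the Bernstein filtration with slope $w$ on $D_{R|K}$ is $B^i=K\text{-span}\{\delta\text{ homogeneous}: \deg(\delta)+w\operatorname{ord}(\delta)\le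 i\}$. A Bernstein filtration is one of these for some such $w$. For a filtration $\mathcal{F}^\bullet$ of a $K$-algebra $A$, $\mathcal{F}^\bullet_{\boxtimes}$ is the filtration of $A\otimes_K A^{\mathrm{op}}$ with $F^i_{\boxtimes}=F^i\otimes_K F^i$. Linear simplicity: a filtered $K$-algebra $(A,\mathcal{F}^\bullet)$ is linearly simple if there is a constant $C$ such that for all $t$ and all $r\in F^t\smallsetminus\{0\}$, $1\in F^{Ct}\,r\,F^{Ct}$ (the $K$-span of the products $\alpha r\beta$ with $\alpha,\beta\in F^{Ct}$). *)

(* Defs.v *)
From HB Require Import structures.
From mathcomp Require Import all_boot all_order all_algebra generic_quotient.
From mathcomp Require Import ring_quotient ring.
From mathcomp Require Import boolp classical_sets.
From mathcomp Require mpoly.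

Set Implicit Arguments.
Unset Strict Implicit.
Unset Printing Implicit Defensive.

Import Order.TTheory GRing.Theory Num.Theory.
Local Open Scope classical_set_scope.
Local Open Scope quotient_scope.
Local Open Scope ring_scope.

Section Generation.
Variable K : fieldType.

Definition kspan (V : lmodType K) (S : set V) : set V :=
  [set v | exists n (c : 'I_n -> K) (x : 'I_n -> V),
     (forall i, S (x i)) /\ v = \sum_(i < n) c i *: x i].

Definition alg_gen (A : lalgType K) (S : set A) : set A :=
  smallest [set B : set A | subalg_closed [in B]] S.

Definition finitely_generated_alg (A : lalgType K) : Prop :=
  exists s : seq A, alg_gen [set` s] = [set: A].

End Generation.

Section AffineSemigroupRings.
Import mpoly.
Variable K : fieldType.

(* Affine semigroup rings are considered up to isomorphism of K-algebras. *)
Definition affine_semigroup_ring (A : lalgType K) : Prop :=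
  exists (n : nat) (s : seq 'X_{1..n}) (phi : {lrmorphism A -> {mpoly K[n]}}),
    injective phi /\
    phi @` [set: A] = alg_gen [set 'X_[m] | m in [set` s]].

End AffineSemigroupRings.

Section Grading.
Variables (K : fieldType) (R : comAlgType K).

Record is_grading (gr : nat -> set R) : Prop := IsGrading {
  grading_submod : forall j, submod_closed [in gr j];
  grading_mul : forall i j x y, gr i x -> gr j y -> gr (i + j)%N (x * y);
  grading_decomp : forall x, exists n (c : nat -> R),
    (forall j, gr j (c j)) /\ x = \sum_(j < n) c j;
  grading_direct : forall n (c : nat -> R), (forall j, gr j (c j)) ->
    \sum_(j < n) c j = 0 -> forall j, (j < n)%N -> c j = 0
}.

Definition gr_int (gr : nat -> set R) (d : int) : set R :=
  if d is Posz j then gr j else [set 0].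

End Grading.

Section Localization.
Variables (R : comNzRingType) (P : prime_idealr R).
Local Notation inP := (P : pred R).

Definition fraction_pair : Type := (R * {s : R | s \notin inP})%type.
HB.instance Definition _ := Choice.on fraction_pair.

Definition loc_equiv (x y : fraction_pair) : bool :=
  `[< exists2 u, u \notin inP & u * (x.1 * val y.2 - y.1 * val x.2) = 0 >].

Lemma notin_primeM u v : u \notin inP -> v \notin inP -> u * v \notin inP.
Proof. by move=> uP vP; rewrite prime_idealrM negb_or uP. Qed.

Lemma notin_prime1 : 1 \notin inP. Proof. by rewrite idealr1. Qed.

Lemma loc_equivP : equiv_class_of loc_equiv.
Proof.
split=> [x|x y|y x z].
- by apply/asboolP; exists 1; rewrite ?notin_prime1// subrr mulr0.
- apply/idP/idP => /asboolP[u uP e]; apply/asboolP; exists u => //.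
  + by rewrite -opprB mulrN e oppr0.
  + by rewrite -opprB mulrN e oppr0.
- move=> /asboolP[u uP e] /asboolP[v vP f]; apply/asboolP.
  exists (u * v * val y.2); first by rewrite !notin_primeM// (valP y.2).
  have -> : u * v * val y.2 * (x.1 * val z.2 - z.1 * val x.2) =
    v * val z.2 * (u * (x.1 * val y.2 - y.1 * val x.2)) +
    u * val x.2 * (v * (y.1 * val z.2 - z.1 * val y.2)) by ring.
  by rewrite e f !mulr0 addr0.
Qed.

Canonical loc_equivR := EquivRelPack loc_equivP.
Canonical loc_encModRel := defaultEncModRel loc_equiv.

Definition localization := {eq_quot loc_equiv}.
HB.instance Definition _ : EqQuotient _ loc_equiv localization :=
  EqQuotient.on localization.
HB.instance Definition _ := Choice.on localization.

Definition loc_den1 : {s : R | s \notin inP} := exist _ 1 notin_prime1.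
Definition loc_denM (s t : {s : R | s \notin inP}) : {s : R | s \notin inP} :=
  exist _ (val s * val t) (notin_primeM (valP s) (valP t)).

Definition loc_add0 (x y : fraction_pair) : fraction_pair :=
  (x.1 * val y.2 + y.1 * val x.2, loc_denM x.2 y.2).
Definition loc_mul0 (x y : fraction_pair) : fraction_pair :=
  (x.1 * y.1, loc_denM x.2 y.2).
Definition loc_opp0 (x : fraction_pair) : fraction_pair := (- x.1, x.2).

Definition loc_zero : localization := \pi_localization (0, loc_den1).
Definition loc_one : localization := \pi_localization (1, loc_den1).
Definition loc_add := lift_op2 localization loc_add0.
Definition loc_mul := lift_op2 localization loc_mul0.
Definition loc_opp := lift_op1 localization loc_opp0.

Lemma loc_piP (x y : fraction_pair) :
  reflect (exists2 u, u \notin inP & u * (x.1 * val y.2 - y.1 * val x.2) = 0)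
          (x == y %[mod localization]).
Proof. by rewrite eqmodE; exact: asboolP. Qed.

Lemma loc_reprE (x : fraction_pair) : exists2 u, u \notin inP &
  u * (x.1 * val (repr (\pi_localization x)).2 -
       (repr (\pi_localization x)).1 * val x.2) = 0.
Proof. by apply/loc_piP; rewrite reprK. Qed.

Lemma loc_addE x y :
  loc_add (\pi_localization x) (\pi_localization y) = \pi_localization (loc_add0 x y).
Proof.
have [u uP e] := loc_reprE x; have [v vP f] := loc_reprE y.
unlock loc_add; apply/esym/eqP/loc_piP; exists (u * v); rewrite ?notin_primeM//=.
move: (repr _) (repr _) e f => y' x' e f.
have lin : u * v * ((x.1 * val y.2 + y.1 * val x.2) * (val x'.2 * val y'.2) -
    (x'.1 * val y'.2 + y'.1 * val x'.2) * (val x.2 * val y.2)) =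
  v * val y.2 * val y'.2 * (u * (x.1 * val x'.2 - x'.1 * val x.2)) +
  u * val x.2 * val x'.2 * (v * (y.1 * val y'.2 - y'.1 * val y.2)) by ring.
by apply: etrans lin _; rewrite e f !mulr0 addr0.
Qed.

Lemma loc_mulE x y :
  loc_mul (\pi_localization x) (\pi_localization y) = \pi_localization (loc_mul0 x y).
Proof.
have [u uP e] := loc_reprE x; have [v vP f] := loc_reprE y.
unlock loc_mul; apply/esym/eqP/loc_piP; exists (u * v); rewrite ?notin_primeM//=.
move: (repr _) (repr _) e f => y' x' e f.
have lin : u * v * (x.1 * y.1 * (val x'.2 * val y'.2) -
    x'.1 * y'.1 * (val x.2 * val y.2)) =
  v * y.1 * val y'.2 * (u * (x.1 * val x'.2 - x'.1 * val x.2)) +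
  u * x'.1 * val x.2 * (v * (y.1 * val y'.2 - y'.1 * val y.2)) by ring.
by apply: etrans lin _; rewrite e f !mulr0 addr0.
Qed.

Lemma loc_oppE x : loc_opp (\pi_localization x) = \pi_localization (loc_opp0 x).
Proof.
have [u uP e] := loc_reprE x.
unlock loc_opp; apply/esym/eqP/loc_piP; exists u => //=; move: (repr _) e => x' e.
have lin : u * (- x.1 * val x'.2 - - x'.1 * val x.2) =
  - (u * (x.1 * val x'.2 - x'.1 * val x.2)) by ring.
by apply: etrans lin _; rewrite e oppr0.
Qed.

Lemma loc_pi_eq (x y : fraction_pair) :
  x.1 * val y.2 = y.1 * val x.2 -> \pi_localization x = \pi_localization y.
Proof.
move=> e; apply/eqP/loc_piP; exists 1; first exact: notin_prime1.
by rewrite e subrr mulr0.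
Qed.

Lemma loc_addA : associative loc_add.
Proof.
elim/quotW => x; elim/quotW => y; elim/quotW => z.
by rewrite !loc_addE; apply: loc_pi_eq => /=; ring.
Qed.
Lemma loc_addC : commutative loc_add.
Proof.
elim/quotW => x; elim/quotW => y.
by rewrite !loc_addE; apply: loc_pi_eq => /=; ring.
Qed.
Lemma loc_add0r : left_id loc_zero loc_add.
Proof.
by elim/quotW => x; rewrite !loc_addE; apply: loc_pi_eq => /=; ring.
Qed.
Lemma loc_addNr : left_inverse loc_zero loc_opp loc_add.
Proof.
by elim/quotW => x; rewrite loc_oppE loc_addE; apply: loc_pi_eq => /=; ring.
Qed.
HB.instance Definition _ :=
  GRing.isZmodule.Build localization loc_addA loc_addC loc_add0r loc_addNr.

Lemma loc_mulA : associative loc_mul.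
Proof.
elim/quotW => x; elim/quotW => y; elim/quotW => z.
by rewrite !loc_mulE; apply: loc_pi_eq => /=; ring.
Qed.
Lemma loc_mulC : commutative loc_mul.
Proof.
elim/quotW => x; elim/quotW => y.
by rewrite !loc_mulE; apply: loc_pi_eq => /=; ring.
Qed.
Lemma loc_mul1r : left_id loc_one loc_mul.
Proof.
by elim/quotW => x; rewrite !loc_mulE; apply: loc_pi_eq => /=; ring.
Qed.
Lemma loc_mulDl : left_distributive loc_mul loc_add.
Proof.
elim/quotW => x; elim/quotW => y; elim/quotW => z.
by rewrite !(loc_mulE, loc_addE); apply: loc_pi_eq => /=; ring.
Qed.
Lemma loc_1neq0 : loc_one != loc_zero.
Proof.
apply/loc_piP => -[u uP] /=; rewrite mul0r mulr1 subr0 mulr1 => u0.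
by move: uP; rewrite u0 idealr0.
Qed.
HB.instance Definition _ := GRing.Zmodule_isComNzRing.Build localization
  loc_mulA loc_mulC loc_mul1r loc_mulDl loc_1neq0.

End Localization.

(* [idealr_closed] describes proper ideals. *)
Section RegularLocalRings.
Variable L : comNzRingType.

Definition ideal_spanned_by (I : {pred L}) (s : seq L) : Prop :=
  forall x, x \in I <->
    exists c : 'I_(size s) -> L, x = \sum_(i < size s) c i * s`_i.

(* the unit ideal is principal, so that proper ideals suffice *)
Definition noetherian : Prop :=
  forall I : {pred L}, idealr_closed I -> exists s, ideal_spanned_by I s.

Definition maximal_ideal (m : {pred L}) : Prop :=
  idealr_closed m /\
  forall I : {pred L}, idealr_closed I -> {subset m <= I} -> I =i m.

Definition prime_chain (n : nat) : Prop :=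
  exists p : nat -> {pred L},
    (forall i, (i <= n)%N -> idealr_closed (p i) /\ prime_idealr_closed (p i)) /\
    (forall i, (i < n)%N ->
       {subset p i <= p i.+1} /\ ~ {subset p i.+1 <= p i}).

Definition krull_dim (d : nat) : Prop :=
  prime_chain d /\ forall n, prime_chain n -> (n <= d)%N.

(* The unique maximal ideal is generated by dim L elements. *)
Definition regular_local_ring : Prop :=
  noetherian /\
  exists m : {pred L},
    [/\ maximal_ideal m,
        forall m' : {pred L}, maximal_ideal m' -> m' =i m &
        exists s : seq L, ideal_spanned_by m s /\ krull_dim (size s)].

End RegularLocalRings.

Definition in_singular_locus (R : comNzRingType) (f : R) : Prop :=
  forall P : prime_idealr R,
    ~ regular_local_ring (localization P) -> f \in (P : pred R).

Section ConverseAlgebra.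
Variable K : fieldType.

HB.instance Definition _ (V : lmodType K) := GRing.Lmodule.copy V^c V.

Lemma converse_scalerAl (A : algType K) (a : K) (u v : A^c) :
  a *: (u * v) = (a *: u : A^c) * v :> A^c.
Proof. exact: (@scalerAr K A a v u). Qed.
HB.instance Definition _ (A : algType K) :=
  GRing.Lmodule_isLalgebra.Build K A^c (@converse_scalerAl A).

Lemma converse_scalerAr (A : algType K) (a : K) (u v : A^c) :
  a *: (u * v) = u * (a *: v : A^c) :> A^c.
Proof. exact: (@scalerAl K A a v u). Qed.
HB.instance Definition _ (A : algType K) :=
  GRing.Lalgebra_isAlgebra.Build K A^c (@converse_scalerAr A).

End ConverseAlgebra.

(* The pairs (a, b) in a list stand for the summands of a sum of pure tensors.
   Two lists are identified when no bilinear map separates the corresponding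
   sums, i.e. by the kernel of the universal bilinear map. *)
Section TensorProduct.
Variables (K : fieldType) (A B : algType K).

Definition bilin (V : lmodType K) (phi : A -> B -> V) : Prop :=
  (forall a, linear (phi a)) /\ (forall b, linear (phi^~ b)).

Definition tensor_ev (V : lmodType K) (phi : A -> B -> V) (s : seq (A * B)) : V :=
  \sum_(p <- s) phi p.1 p.2.

Definition tensor_equiv (s t : seq (A * B)) : bool :=
  `[< forall (V : lmodType K) (phi : A -> B -> V), bilin phi ->
        tensor_ev phi s = tensor_ev phi t >].

Lemma tensor_equivP : equiv_class_of tensor_equiv.
Proof.
split=> [s|s t|t s u].
- by apply/asboolP.
- by apply/idP/idP => /asboolP e; apply/asboolP => V phi /e.
- move=> /asboolP e /asboolP f; apply/asboolP => V phi b.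
  by rewrite (e V phi b) (f V phi b).
Qed.

Canonical tensor_equivR := EquivRelPack tensor_equivP.
Canonical tensor_encModRel := defaultEncModRel tensor_equiv.

Definition tensor := {eq_quot tensor_equiv}.
HB.instance Definition _ : EqQuotient _ tensor_equiv tensor :=
  EqQuotient.on tensor.
HB.instance Definition _ := Choice.on tensor.

Definition tensor_mulseq (s t : seq (A * B)) : seq (A * B) :=
  [seq (p.1 * q.1, p.2 * q.2) | p <- s, q <- t].
Definition tensor_scaleseq (k : K) (s : seq (A * B)) : seq (A * B) :=
  [seq (k *: p.1, p.2) | p <- s].

Definition tmul (a : A) (b : B) : tensor := \pi_tensor [:: (a, b)].
Definition tensor_zero : tensor := \pi_tensor [::].
Definition tensor_one : tensor := tmul 1 1.
Definition tensor_add := lift_op2 tensor cat.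
Definition tensor_scale (k : K) := lift_op1 tensor (tensor_scaleseq k).
Definition tensor_opp (x : tensor) : tensor := tensor_scale (-1) x.
Definition tensor_mul := lift_op2 tensor tensor_mulseq.

Lemma tensor_piP (s t : seq (A * B)) :
  \pi_tensor s = \pi_tensor t <->
  (forall (V : lmodType K) (phi : A -> B -> V), bilin phi ->
     tensor_ev phi s = tensor_ev phi t).
Proof.
split=> [/eqP|] h; last by apply/eqP; rewrite eqmodE; apply/asboolP.
by move: h; rewrite eqmodE => /asboolP.
Qed.

Lemma tensor_ev_repr (V : lmodType K) (phi : A -> B -> V) s : bilin phi ->
  tensor_ev phi (repr (\pi_tensor s)) = tensor_ev phi s.
Proof. by move=> b; move: V phi b; apply/tensor_piP; rewrite reprK. Qed.

Section Bilin.
Variables (V : lmodType K) (phi : A -> B -> V).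
Hypothesis phiB : bilin phi.

Lemma bilinZl k a b : phi (k *: a) b = k *: phi a b.
Proof.
have h0 : phi 0 b = 0.
  by have := phiB.2 b (-1) 0 0; rewrite scaler0 addr0 scaleN1r addNr.
by have := phiB.2 b k a 0; rewrite addr0 h0 addr0.
Qed.
Lemma bilinZr k a b : phi a (k *: b) = k *: phi a b.
Proof.
have h0 : phi a 0 = 0.
  by have := phiB.1 a (-1) 0 0; rewrite scaler0 addr0 scaleN1r addNr.
by have := phiB.1 a k b 0; rewrite addr0 h0 addr0.
Qed.

Lemma tensor_ev_cat s t :
  tensor_ev phi (s ++ t) = tensor_ev phi s + tensor_ev phi t.
Proof. exact: big_cat. Qed.

Lemma tensor_ev_scale k s :
  tensor_ev phi (tensor_scaleseq k s) = k *: tensor_ev phi s.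
Proof.
rewrite /tensor_ev big_map scaler_sumr; apply: eq_bigr => p _ /=.
exact: bilinZl.
Qed.

Lemma tensor_ev_mul s t : tensor_ev phi (tensor_mulseq s t) =
  tensor_ev (fun a b => tensor_ev (fun a' b' => phi (a * a') (b * b')) t) s.
Proof. by rewrite /tensor_ev big_allpairs_dep. Qed.

Lemma tensor_ev_mulC s t : tensor_ev phi (tensor_mulseq s t) =
  tensor_ev (fun a' b' => tensor_ev (fun a b => phi (a * a') (b * b')) s) t.
Proof. by rewrite tensor_ev_mul /tensor_ev exchange_big. Qed.

Lemma bilin_mulr t :
  bilin (fun a b => tensor_ev (fun a' b' => phi (a * a') (b * b')) t).
Proof.
split=> x k u v; rewrite /tensor_ev scaler_sumr -big_split;
  apply: eq_bigr => p _ /=.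
- by rewrite mulrDl -scalerAl (phiB.1).
- by rewrite mulrDl -scalerAl (phiB.2).
Qed.

Lemma bilin_mull s :
  bilin (fun a' b' => tensor_ev (fun a b => phi (a * a') (b * b')) s).
Proof.
split=> x k u v; rewrite /tensor_ev scaler_sumr -big_split;
  apply: eq_bigr => p _ /=.
- by rewrite mulrDr -scalerAr (phiB.1).
- by rewrite mulrDr -scalerAr (phiB.2).
Qed.

End Bilin.

Lemma tensor_addE s t :
  tensor_add (\pi_tensor s) (\pi_tensor t) = \pi_tensor (s ++ t).
Proof.
unlock tensor_add; apply/tensor_piP => V phi b.
by rewrite !tensor_ev_cat !tensor_ev_repr.
Qed.

Lemma tensor_scaleE k s :
  tensor_scale k (\pi_tensor s) = \pi_tensor (tensor_scaleseq k s).
Proof.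
unlock tensor_scale; apply/tensor_piP => V phi b.
by rewrite !tensor_ev_scale// tensor_ev_repr.
Qed.

Lemma tensor_mulE s t :
  tensor_mul (\pi_tensor s) (\pi_tensor t) = \pi_tensor (tensor_mulseq s t).
Proof.
unlock tensor_mul; apply/tensor_piP => V phi b.
rewrite tensor_ev_mul (tensor_ev_repr _ (bilin_mulr b _)) -tensor_ev_mul.
by rewrite !tensor_ev_mulC (tensor_ev_repr _ (bilin_mull b _)).
Qed.

Lemma tensor_addA : associative tensor_add.
Proof.
by elim/quotW => s; elim/quotW => t; elim/quotW => u; rewrite !tensor_addE catA.
Qed.
Lemma tensor_addC : commutative tensor_add.
Proof.
elim/quotW => s; elim/quotW => t; rewrite !tensor_addE.
by apply/tensor_piP => V phi b; rewrite !tensor_ev_cat addrC.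
Qed.
Lemma tensor_add0 : left_id tensor_zero tensor_add.
Proof. by elim/quotW => s; rewrite tensor_addE. Qed.
Lemma tensor_addN : left_inverse tensor_zero tensor_opp tensor_add.
Proof.
elim/quotW => s; rewrite /tensor_opp tensor_scaleE tensor_addE.
apply/tensor_piP => V phi b.
by rewrite tensor_ev_cat tensor_ev_scale// scaleN1r addNr /tensor_ev big_nil.
Qed.
HB.instance Definition _ :=
  GRing.isZmodule.Build tensor tensor_addA tensor_addC tensor_add0 tensor_addN.

Lemma tensor_mulA : associative tensor_mul.
Proof.
elim/quotW => s; elim/quotW => t; elim/quotW => u; rewrite !tensor_mulE.
apply/tensor_piP => V phi b; rewrite !tensor_ev_mul /tensor_ev.
apply: eq_bigr => p _; rewrite big_allpairs_dep; apply: eq_bigr => q _ /=.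
by apply: eq_bigr => r _ /=; rewrite !mulrA.
Qed.
Lemma tensor_mul1 : left_id tensor_one tensor_mul.
Proof.
elim/quotW => s; rewrite tensor_mulE; apply/tensor_piP => V phi b.
rewrite tensor_ev_mul /tensor_ev big_seq1 /=.
by apply: eq_bigr => p _; rewrite !mul1r.
Qed.
Lemma tensor_1mul : right_id tensor_one tensor_mul.
Proof.
elim/quotW => s; rewrite tensor_mulE; apply/tensor_piP => V phi b.
rewrite tensor_ev_mulC /tensor_ev big_seq1 /=.
by apply: eq_bigr => p _; rewrite !mulr1.
Qed.
Lemma tensor_mulDl : left_distributive tensor_mul tensor_add.
Proof.
elim/quotW => s; elim/quotW => t; elim/quotW => u.
rewrite !(tensor_addE, tensor_mulE); apply/tensor_piP => V phi b.
by rewrite tensor_ev_cat !tensor_ev_mul tensor_ev_cat.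
Qed.
Lemma tensor_mulDr : right_distributive tensor_mul tensor_add.
Proof.
elim/quotW => s; elim/quotW => t; elim/quotW => u.
rewrite !(tensor_addE, tensor_mulE); apply/tensor_piP => V phi b.
by rewrite tensor_ev_cat !tensor_ev_mulC tensor_ev_cat.
Qed.
HB.instance Definition _ := GRing.Zmodule_isPzRing.Build tensor
  tensor_mulA tensor_mul1 tensor_1mul tensor_mulDl tensor_mulDr.

Lemma tensor_scaleA j k x :
  tensor_scale j (tensor_scale k x) = tensor_scale (j * k) x.
Proof.
elim/quotW: x => s; rewrite !tensor_scaleE; apply/tensor_piP => V phi b.
by rewrite !tensor_ev_scale// scalerA.
Qed.
Lemma tensor_scale1 : left_id 1 tensor_scale.
Proof.
elim/quotW => s; rewrite tensor_scaleE; apply/tensor_piP => V phi b.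
by rewrite tensor_ev_scale// scale1r.
Qed.
Lemma tensor_scaleDr : right_distributive tensor_scale +%R.
Proof.
move=> k; elim/quotW => s; elim/quotW => t.
rewrite -[_ + _]/(tensor_add _ _) -[RHS]/(tensor_add _ _).
rewrite !(tensor_addE, tensor_scaleE); apply/tensor_piP => V phi b.
by rewrite tensor_ev_cat !tensor_ev_scale// tensor_ev_cat scalerDr.
Qed.
Lemma tensor_scaleDl x : {morph tensor_scale^~ x : j k / j + k}.
Proof.
move=> j k; elim/quotW: x => s; rewrite -[RHS]/(tensor_add _ _).
rewrite !(tensor_addE, tensor_scaleE); apply/tensor_piP => V phi b.
by rewrite tensor_ev_cat !tensor_ev_scale// scalerDl.
Qed.
HB.instance Definition _ := GRing.Zmodule_isLmodule.Build K tensor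
  tensor_scaleA tensor_scale1 tensor_scaleDr tensor_scaleDl.

Lemma tensor_scaleAl (k : K) (x y : tensor) : k *: (x * y) = (k *: x) * y.
Proof.
elim/quotW: x => s; elim/quotW: y => t.
rewrite -[LHS]/(tensor_scale k (tensor_mul _ _)).
rewrite -[RHS]/(tensor_mul (tensor_scale k _) _).
rewrite !(tensor_mulE, tensor_scaleE); apply/tensor_piP => V phi b.
rewrite tensor_ev_scale// !tensor_ev_mul tensor_ev_scale//.
exact: bilin_mulr.
Qed.
Lemma tensor_scaleAr (k : K) (x y : tensor) : k *: (x * y) = x * (k *: y).
Proof.
elim/quotW: x => s; elim/quotW: y => t.
rewrite -[LHS]/(tensor_scale k (tensor_mul _ _)).
rewrite -[RHS]/(tensor_mul _ (tensor_scale k _)).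
rewrite !(tensor_mulE, tensor_scaleE); apply/tensor_piP => V phi b.
rewrite tensor_ev_scale// !tensor_ev_mulC tensor_ev_scale//.
exact: bilin_mull.
Qed.

Lemma tmul_bilin : bilin tmul.
Proof.
split=> x k u v; rewrite -[RHS]/(tensor_add (tensor_scale k _) _) /tmul;
  rewrite tensor_scaleE tensor_addE; apply/tensor_piP => V phi b;
  rewrite /tensor_ev /= !(big_cons, big_nil) /= !addr0 bilinZl//.
- by rewrite b.1.
- by rewrite b.2.
Qed.

Lemma tmulM a b a' b' : tmul a b * tmul a' b' = tmul (a * a') (b * b').
Proof. exact: tensor_mulE. Qed.

End TensorProduct.

(* A separate name for A (x) A^op, which is easily seen to be nonzero, as
   MathComp's algebras are. *)
Section Enveloping.
Variables (K : fieldType) (A : algType K).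

Definition enveloping : Type := tensor A A^c.
HB.instance Definition _ := GRing.PzRing.on enveloping.
HB.instance Definition _ := GRing.Lmodule.on enveloping.

Lemma enveloping_1neq0 : 1 != 0 :> enveloping.
Proof.
apply/eqP => /(tensor_piP [:: (1, 1)] [::]).1/(_ A (fun a b => a * (b : A))).
rewrite /tensor_ev big_seq1 big_nil /= mulr1 => h.
suff /h/eqP : bilin (fun (a : A) (b : A^c) => a * (b : A)).
  by rewrite oner_eq0.
split=> x k u v; first by rewrite mulrDr scalerAr.
by rewrite mulrDl scalerAl.
Qed.
HB.instance Definition _ :=
  GRing.PzSemiRing_isNonZero.Build enveloping enveloping_1neq0.
HB.instance Definition _ := GRing.Lmodule_isLalgebra.Build K enveloping
  (@tensor_scaleAl K A A^c).
HB.instance Definition _ := GRing.Lalgebra_isAlgebra.Build K enveloping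
  (@tensor_scaleAr K A A^c).

Definition box_filtration (F : nat -> set A) (i : nat) : set enveloping :=
  kspan [set x | exists a b, [/\ F i a, F i b & x = tmul a (b : A^c)]].

End Enveloping.

Definition linearly_simple (K : fieldType) (A : algType K) (F : nat -> set A) :
    Prop :=
  exists C : nat, forall (t : nat) (r : A), F t r -> r != 0 ->
    kspan [set x | exists a b,
             [/\ F (C * t)%N a, F (C * t)%N b & x = a * r * b]] 1.

Section Endomorphisms.
Variables (K : fieldType) (R : comAlgType K).

Definition endo : Type := {linear R -> R}.
HB.instance Definition _ := gen_eqMixin endo.
HB.instance Definition _ := gen_choiceMixin endo.

Lemma endoP (d e : endo) :
  (forall x, (d : {linear R -> R}) x = (e : {linear R -> R}) x) -> d = e.
Proof.
case: d e => d [[[d0 dD]] [dZ]] [e [[[e0 eD]] [eZ]]] /= de.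
have {}de : d = e by apply/funext.
subst e; rewrite (Prop_irrelevance d0 e0) (Prop_irrelevance dD eD).
by rewrite (Prop_irrelevance dZ eZ).
Qed.

Definition endo_apply (d : endo) : R -> R := (d : {linear R -> R}).
Definition endo_zero : endo := \0 : {linear R -> R}.
Definition endo_add (d e : endo) : endo :=
  (d : {linear R -> R}) \+ (e : {linear R -> R}) : {linear R -> R}.
Definition endo_opp (d : endo) : endo :=
  \- (d : {linear R -> R}) : {linear R -> R}.
Definition endo_one : endo := idfun : {linear R -> R}.
Definition endo_mul (d e : endo) : endo :=
  (d : {linear R -> R}) \o (e : {linear R -> R}) : {linear R -> R}.
Definition endo_scale (k : K) (d : endo) : endo :=
  k \*: (d : {linear R -> R}) : {linear R -> R}.

Lemma endo_addA : associative endo_add.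
Proof. by move=> d e f; apply: endoP => x /=; rewrite addrA. Qed.
Lemma endo_addC : commutative endo_add.
Proof. by move=> d e; apply: endoP => x /=; rewrite addrC. Qed.
Lemma endo_add0 : left_id endo_zero endo_add.
Proof. by move=> d; apply: endoP => x /=; rewrite add0r. Qed.
Lemma endo_addN : left_inverse endo_zero endo_opp endo_add.
Proof. by move=> d; apply: endoP => x /=; rewrite addNr. Qed.
HB.instance Definition _ :=
  GRing.isZmodule.Build endo endo_addA endo_addC endo_add0 endo_addN.

Lemma endo_mulA : associative endo_mul.
Proof. by move=> d e f; apply: endoP. Qed.
Lemma endo_mul1 : left_id endo_one endo_mul.
Proof. by move=> d; apply: endoP. Qed.
Lemma endo_1mul : right_id endo_one endo_mul.
Proof. by move=> d; apply: endoP. Qed.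
Lemma endo_mulDl : left_distributive endo_mul endo_add.
Proof. by move=> d e f; apply: endoP. Qed.
Lemma endo_mulDr : right_distributive endo_mul endo_add.
Proof. by move=> d e f; apply: endoP => x /=; rewrite linearD. Qed.
Lemma endo_1neq0 : endo_one != endo_zero.
Proof.
by apply/eqP => /(congr1 (endo_apply^~ 1)) /eqP; rewrite /= oner_eq0.
Qed.
HB.instance Definition _ := GRing.Zmodule_isNzRing.Build endo
  endo_mulA endo_mul1 endo_1mul endo_mulDl endo_mulDr endo_1neq0.

Lemma endo_scaleA j k d : endo_scale j (endo_scale k d) = endo_scale (j * k) d.
Proof. by apply: endoP => x /=; rewrite scalerA. Qed.
Lemma endo_scale1 : left_id 1 endo_scale.
Proof. by move=> d; apply: endoP => x /=; rewrite scale1r. Qed.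
Lemma endo_scaleDr : right_distributive endo_scale +%R.
Proof. by move=> k d e; apply: endoP => x /=; rewrite scalerDr. Qed.
Lemma endo_scaleDl d : {morph endo_scale^~ d : j k / j + k}.
Proof. by move=> j k; apply: endoP => x /=; rewrite scalerDl. Qed.
HB.instance Definition _ := GRing.Zmodule_isLmodule.Build K endo
  endo_scaleA endo_scale1 endo_scaleDr endo_scaleDl.

Lemma endo_scaleAl (k : K) (d e : endo) : k *: (d * e) = (k *: d) * e.
Proof. by apply: endoP. Qed.
Lemma endo_scaleAr (k : K) (d e : endo) : k *: (d * e) = d * (k *: e).
Proof. by apply: endoP => x /=; rewrite linearZ. Qed.
HB.instance Definition _ := GRing.Lmodule_isLalgebra.Build K endo endo_scaleAl.
HB.instance Definition _ := GRing.Lalgebra_isAlgebra.Build K endo endo_scaleAr.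

Definition mulop (r : R) : endo := r \*o idfun : {linear R -> R}.

Lemma mulopM r s : mulop (r * s) = mulop r * mulop s.
Proof. by apply: endoP => x /=; rewrite mulrA. Qed.
Lemma mulop_linear : linear mulop.
Proof. by move=> k r s; apply: endoP => x /=; rewrite mulrDl scalerAl. Qed.
Lemma mulop1 : mulop 1 = 1.
Proof. by apply: endoP => x /=; rewrite mul1r. Qed.
Lemma mulop0 : mulop 0 = 0.
Proof. by apply: endoP => x /=; rewrite mul0r. Qed.

End Endomorphisms.

Section DifferentialOperators.
Variables (K : fieldType) (R : comAlgType K).

(* D^n_{R|K} *)
Fixpoint diff_le (n : nat) (d : endo R) : Prop :=
  if n is n'.+1 then forall r : R, diff_le n' (d * mulop r - mulop r * d)
  else exists r : R, d = mulop r.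

Lemma diff_le_linear n k d e : diff_le n d -> diff_le n e -> diff_le n (k *: d + e).
Proof.
elim: n d e => [|n IHn] d e /=.
  by move=> [r ->] [s ->]; exists (k *: r + s); rewrite mulop_linear.
move=> hd he r; have := IHn _ _ (hd r) (he r); congr diff_le.
by rewrite mulrDl mulrDr scalerBr scalerAl scalerAr opprD addrACA.
Qed.

Lemma diff_le0 n : diff_le n 0.
Proof.
elim: n => [|n IHn] /=; first by exists 0; rewrite mulop0.
by move=> r; rewrite mul0r mulr0 subrr.
Qed.

Lemma diff_leS n d : diff_le n d -> diff_le n.+1 d.
Proof.
elim: n d => [|n IHn] d /=.
  by move=> [r ->] s; exists 0; rewrite -!mulopM mulrC subrr mulop0.
by move=> h r; apply: IHn.
Qed.

Lemma diff_leW m n d : (m <= n)%N -> diff_le m d -> diff_le n d.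
Proof.
move=> /subnK <-; elim: (n - m)%N => // j IHj h.
by rewrite addSn; apply: diff_leS; apply: IHj.
Qed.

Lemma diff_leD n d e : diff_le n d -> diff_le n e -> diff_le n (d + e).
Proof. by move=> hd he; rewrite -[d]scale1r; apply: diff_le_linear. Qed.

Lemma diff_leM m n d e : diff_le m d -> diff_le n e -> diff_le (m + n) (d * e).
Proof.
move: {2}(m + n)%N (leqnn (m + n)) => k; elim: k m n d e => [|k IHk] m n d e.
  rewrite leqn0 addn_eq0 => /andP[/eqP-> /eqP->] [r ->] [s ->].
  by exists (r * s); rewrite mulopM.
move=> mnk hd he; have [mn0|mn0] := eqVneq (m + n)%N 0%N.
  move/eqP: mn0 hd he; rewrite addn_eq0 => /andP[/eqP-> /eqP->] [r ->] [s ->].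
  by exists (r * s); rewrite mulopM.
have eqS : (m + n)%N = (m + n).-1.+1 by rewrite prednK ?lt0n.
rewrite eqS => r; have -> : d * e * mulop r - mulop r * (d * e) =
    d * (e * mulop r - mulop r * e) + (d * mulop r - mulop r * d) * e.
  by rewrite mulrBr mulrBl !mulrA addrA subrK.
apply: diff_leD.
- case: n he mnk mn0 eqS => [[s ->] _ _ _|n he mnk _ _].
    by rewrite -!mulopM mulrC subrr mulr0; apply: diff_le0.
  by rewrite addnS; apply: IHk; [rewrite -ltnS -addnS|exact: hd|exact: he].
- case: m hd mnk mn0 eqS => [[s ->] _ _ _|m hd mnk _ _].
    by rewrite -!mulopM mulrC subrr mul0r; apply: diff_le0.
  by rewrite addSn; apply: IHk; [rewrite -ltnS -addSn|exact: hd|exact: he].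
Qed.

Definition is_diffop (d : endo R) : bool := `[< exists n, diff_le n d >].

Lemma is_diffop_subalg : GRing.subsemialg_closed is_diffop.
Proof.
apply: GRing.subalg_closed_semi; split.
- by apply/asboolP; exists 0%N, 1; rewrite mulop1.
- move=> k d e /asboolP[m hd] /asboolP[n he]; apply/asboolP; exists (maxn m n).
  by apply: diff_le_linear; [apply: diff_leW hd|apply: diff_leW he];
     rewrite (leq_maxl, leq_maxr).
- move=> d e /asboolP[m hd] /asboolP[n he]; apply/asboolP; exists (m + n)%N.
  exact: diff_leM.
Qed.

Record diffop : Type := Diffop {
  diffop_val : endo R;
  diffop_valP : is_diffop diffop_val
}.
HB.instance Definition _ := [isSub for diffop_val].
HB.instance Definition _ := [Choice of diffop by <:].
HB.instance Definition _ := GRing.SubChoice_isSubAlgebra.Build K (endo R)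
  is_diffop diffop is_diffop_subalg.

Lemma mulop_is_diffop r : is_diffop (mulop r).
Proof. by apply/asboolP; exists 0%N, r. Qed.
Definition dmul (r : R) : diffop := Diffop (mulop_is_diffop r).

Definition has_order (d : diffop) (n : nat) : Prop :=
  diff_le n (val d) /\ forall m, (m < n)%N -> ~ diff_le m (val d).

Definition homogeneous (gr : nat -> set R) (d : diffop) (e : int) : Prop :=
  forall (j : nat) (x : R), gr j x -> gr_int gr (j%:Z + e) (endo_apply (val d) x).

Definition bernstein_slope (gr : nat -> set R) (w : int) : Prop :=
  alg_gen [set x | exists2 j : nat, j%:Z < w & gr j x] = [set: R].

(* The zero operator is homogeneous of every degree, which does not affect
   the span.  Indices in nat suffice, as the span is 0 in negative degrees. *)
Definition bernstein_filtration (gr : nat -> set R) (w : int) (i : nat) :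
    set diffop :=
  kspan [set d | exists (e : int) (n : nat),
           [/\ homogeneous gr d e, has_order d n & e + w * n%:Z <= i%:Z]].

Definition sandwich_equation (f : R) (b : {poly K}) : Prop :=
  exists s : seq ({poly diffop} * {poly diffop}), forall n : nat,
    \sum_(p <- s) p.1.[n%:R] * dmul (f ^+ n.+1) * p.2.[n%:R] =
    b.[n%:R] *: dmul (f ^+ n).

Definition sandwich_bs_poly (f : R) (b : {poly K}) : Prop :=
  (b \is monic \/ b = 0) /\
  forall c : {poly K}, sandwich_equation f c <-> exists q, c = q * b.

End DifferentialOperators.

Definition nonzerodivisor (R : comNzRingType) (f : R) : Prop :=
  forall x : R, f * x = 0 -> x = 0.

(* Main.v *)
(* Let B be a Bernstein filtration of D = D_R; it is exhaustive and of polynomial growth.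
   Commutators with the generators of R lower the order, so from a nonzero element of B^t one
   reaches a nonzero multiplication operator by acting with an element of D (x) D^op of linear
   degree.

   (1) Regularity of R_f, the sandwich equation, which gives 1 in D f^N D, and the
   connectedness of R force R to be a domain.  The open set f <> 0 is covered by finitely many
   charts: elements t_1, ..., t_n over which R is algebraic, with derivations dual to them up to
   a factor h.  A nonzero g of degree s has a multiple that is a polynomial of degree O(s) in the
   t_i, a coefficient of a characteristic polynomial, and differentiating it leaves h^M with
   M = O(s).  The powers h^M of all charts generate a power f^N with N = O(s), which the sandwich
   equation turns into 1.

   (2') If D (x) D^op is linearly simple, then each bimodule quotient D f^j D / D f^(j+1) D, if
   not 0 in a quantitative sense, has growth at least that of D (Bernstein's inequality).
   Consecutive powers f^n, ..., f^(n+k-1), up to a common factor, lie in a filtration step of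
   dimension less than k dim B^t for suitable t, so infinitely often some f^m is obtained from
   f^(m+1) by an element of a fixed finite-dimensional space; these equations are interpolated
   by a polynomial one.

   (2) For monomial algebras the Euler derivations diagonalize multiplication operators, so that
   a coefficient of a tensor can be reduced to a monomial, and linear simplicity passes from D
   to D (x) D^op. *)

Require Import Defs.
From HB Require Import structures.
From mathcomp Require Import all_boot all_order all_algebra.
From mathcomp Require Import boolp classical_sets.
From mathcomp Require Import fingroup perm generic_quotient ring_quotient zify ring.

Set Implicit Arguments.
Unset Strict Implicit.
Unset Printing Implicit Defensive.

Import Order.TTheory GRing.Theory Num.Theory.
Local Open Scope quotient_scope.
Local Open Scope classical_set_scope.
Local Open Scope ring_scope.

(** The bimodule quotients of (2') are never formed: independence is taken modulo a subspace, a
    finite level of D f^(j+1) D. If such a quotient had fewer than dim B^t dimensions at the right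
    scale, counting would give a nonzero element of B^t (x) B^t annihilating a piece of it, and
    linear simplicity turns that element into 1. This is why the hypothesis concerns D (x) D^op:
    annihilators of bimodules live there. Growth enters only through scales t at which dim B^(ct) is
    at most a constant times dim B^t. In the interpolation f^n is moved past operators, so n enters
    through binomial coefficients, and solvability at infinitely many n becomes solvability over
    K(s). In (1) coordinates come from derivations over a domain. Hence regular local rings are
    first shown to be domains: modulo the bottom prime p of a chain as long as the number of
    parameters there is a chart, its derivations place p in all powers of the maximal ideal, and
    Krull's theorem kills p. Derivations also replace dimension theory, as they detect algebraic
    independence in characteristic zero. *)

Local Notation "d @@ x" := (endo_apply d x) (at level 40, left associativity).

(** * Linear algebra in possibly infinite-dimensional spaces *)

Section Subspaces.
Variables (K : fieldType) (V : lmodType K).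
Implicit Types (W S : set V).

Definition subspace W := W 0 /\ forall (k : K) x y, W x -> W y -> W (k *: x + y).

Lemma subspace0 W : subspace W -> W 0. Proof. by case. Qed.

Lemma subspaceD W x y : subspace W -> W x -> W y -> W (x + y).
Proof. by move=> [_ h] wx wy; rewrite -[x]scale1r; apply: h. Qed.

Lemma subspaceZ W k x : subspace W -> W x -> W (k *: x).
Proof. by move=> [w0 h] wx; rewrite -[k *: x]addr0; apply: h. Qed.

Lemma subspaceN W x : subspace W -> W x -> W (- x).
Proof. by move=> h wx; rewrite -scaleN1r; apply: subspaceZ. Qed.

Lemma subspaceB W x y : subspace W -> W x -> W y -> W (x - y).
Proof. by move=> h wx wy; apply: subspaceD => //; apply: subspaceN. Qed.

Lemma subspace_sum W I (r : seq I) (P : pred I) (F : I -> V) : subspace W ->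
  (forall i, P i -> W (F i)) -> W (\sum_(i <- r | P i) F i).
Proof.
by move=> h hF; apply: big_ind => //; [exact: subspace0|move=> *; exact: subspaceD].
Qed.

Lemma subspace_sum_in W (I : eqType) (r : seq I) (F : I -> V) : subspace W ->
  (forall i, i \in r -> W (F i)) -> W (\sum_(i <- r) F i).
Proof. by move=> h hF; rewrite big_seq; apply: subspace_sum. Qed.

Lemma subspace_set0 : subspace [set 0].
Proof. by split=> // k x y /= -> ->; rewrite scaler0 addr0. Qed.

Lemma kspan_subspace S : subspace (kspan S).
Proof.
split=> [|k x y [n [c [u [uS ->]]]] [m [d [v [vS ->]]]]].
  exists 0%N, (fun _ => 0), (fun _ => 0); split; first by case.
  by rewrite big_ord0.
exists (n + m)%N.
exists (fun i => match split i with inl j => k * c j | inr j => d j end).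
exists (fun i => match split i with inl j => u j | inr j => v j end).
split=> [i|]; first by case: (split i).
rewrite big_split_ord /= scaler_sumr; congr (_ + _); apply: eq_bigr => i _.
  by rewrite (unsplitK (inl i)) scalerA.
by rewrite (unsplitK (inr i)).
Qed.

Lemma kspan_le S W : subspace W -> S `<=` W -> kspan S `<=` W.
Proof.
move=> hW SW x [n [c [u [uS ->]]]]; apply: subspace_sum => // i _.
by apply: subspaceZ => //; apply: SW.
Qed.

Lemma sub_kspan S : S `<=` kspan S.
Proof.
move=> x Sx; exists 1%N, (fun _ => 1), (fun _ => x); split=> //.
by rewrite big_ord1 scale1r.
Qed.

Lemma kspan_mono S S' : S `<=` S' -> kspan S `<=` kspan S'.
Proof.
move=> SS'; apply: kspan_le; first exact: kspan_subspace.
by move=> x /SS'; exact: sub_kspan.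
Qed.

Lemma submod_closed_subspace S : submod_closed [in S] -> subspace S.
Proof.
move=> [s0 h]; split; first by move: s0; rewrite in_setE.
by move=> k x y Sx Sy; have := h k x y; rewrite !in_setE; apply.
Qed.

(** Independence in the quotient by [W], without the quotient. With [W] a level of a sub-bimodule it
    measures the growth of a bimodule quotient. *)
Definition free_mod W n (v : 'I_n -> V) :=
  forall c : 'I_n -> K, W (\sum_i c i *: v i) -> forall i, c i = 0.

Lemma steinitz W m n (u : 'I_m -> V) (v : 'I_n -> V) : subspace W -> free_mod W v ->
  (forall i, exists c : 'I_m -> K, W (v i - \sum_j c j *: u j)) -> (n <= m)%N.
Proof.
move=> hW fv /choice[M hM]; rewrite leqNgt; apply/negP => mn.
pose A := \matrix_(i < n, j < m) M i j.
have /rowV0Pn[c /sub_kermxP cA c0] : kermx A != 0.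
  by rewrite -mxrank_eq0 mxrank_ker subn_eq0 -ltnNge (leq_ltn_trans (rank_leq_col A)).
have : W (\sum_i c 0 i *: v i).
  have -> : \sum_i c 0 i *: v i = \sum_i c 0 i *: (v i - \sum_j M i j *: u j).
    under [RHS]eq_bigr do rewrite scalerBr.
    rewrite sumrB (_ : \sum_i _ *: \sum_j _ = 0) ?subr0//.
    under eq_bigr do rewrite scaler_sumr.
    rewrite exchange_big /= big1// => j _.
    under eq_bigr do rewrite scalerA.
    rewrite -scaler_suml.
    have := congr1 (fun B : 'rV_m => B 0 j) cA; rewrite !mxE.
    by under eq_bigr do rewrite mxE; move=> ->; rewrite scale0r.
  by apply: subspace_sum => // i _; apply: subspaceZ.
move=> /fv c_0; case/eqP: c0; apply/rowP => i; rewrite mxE; exact: c_0.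
Qed.

(** The bound [N] stands in for finite dimensionality: any vector of [S] not in the span of a
    longest free family could be added to it, at index [ord0]. *)
Lemma max_free W S N : subspace W ->
  (forall k (v : 'I_k -> V), (forall i, S (v i)) -> free_mod W v -> (k <= N)%N) ->
  exists k (v : 'I_k -> V), [/\ forall i, S (v i), free_mod W v &
    forall x, S x -> exists c : 'I_k -> K, W (x - \sum_j c j *: v j)].
Proof.
move=> hW hN; pose P k := `[< exists v : 'I_k -> V, (forall i, S (v i)) /\ free_mod W v >].
have exP : exists k, P k.
  by exists 0%N; apply/asboolP; exists (fun _ => 0); split=> [[]|c _ []].
have bP k : P k -> (k <= N)%N by move=> /asboolP[v [Sv fv]]; exact: hN fv.
case: (ex_maxnP exP bP) => k /asboolP[v [Sv fv]] kmax.
exists k, v; split=> // x Sx; apply: contrapT => nx.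
suff /kmax : P k.+1 by rewrite ltnn.
apply/asboolP; exists (fun i => if unlift ord0 i is Some j then v j else x); split.
  by move=> i; case: unliftP.
move=> c; rewrite big_ord_recl unlift_none.
under eq_bigr do rewrite liftK.
have [c0|c0] := eqVneq (c ord0) 0.
  rewrite c0 scale0r add0r => /fv cl i.
  by case: (unliftP ord0 i) => [j ->|->].
move=> /(subspaceZ (c ord0)^-1 hW); rewrite scalerDr scalerA mulVf// scale1r.
move=> h; case: nx; exists (fun j => - ((c ord0)^-1 * c (lift ord0 j))).
have -> : - (\sum_j - ((c ord0)^-1 * c (lift ord0 j)) *: v j) =
    (c ord0)^-1 *: \sum_i c (lift ord0 i) *: v i; last by [].
rewrite -sumrN scaler_sumr; apply: eq_bigr => j _.
by rewrite scaleNr opprK scalerA.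
Qed.

End Subspaces.

Lemma nontrivial_relation (K : fieldType) (I J : finType) (M : I -> J -> K) :
  (#|J| < #|I|)%N ->
  exists2 c : I -> K, (exists i, c i != 0) & forall j, \sum_i c i * M i j = 0.
Proof.
move=> JI; pose A := \matrix_(i < #|I|, j < #|J|) M (enum_val i) (enum_val j).
have /rowV0Pn[c /sub_kermxP cA c0] : kermx A != 0.
  by rewrite -mxrank_eq0 mxrank_ker subn_eq0 -ltnNge (leq_ltn_trans (rank_leq_col A)).
have [i ci] : exists i, c 0 i != 0.
  apply: contrapT => h; case/eqP: c0; apply/rowP => i; rewrite mxE.
  by apply/eqP/negPn/negP => ci; apply: h; exists i.
exists (fun i => c 0 (enum_rank i)); first by exists (enum_val i); rewrite enum_valK.
move=> j; have := congr1 (fun B : 'rV_#|J| => B 0 (enum_rank j)) cA.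
rewrite !mxE; apply: etrans.
rewrite (reindex (@enum_val I I)) /=; last first.
  by exists enum_rank => x _; rewrite (enum_rankK, enum_valK).
by apply: eq_bigr => k _; rewrite enum_valK mxE enum_rankK.
Qed.

(** If the ratio exceeded [2 * c2 ^ e] from some point on, iterating along [c2 ^ i * t0.+1] would
    beat the polynomial bound, which allows only a factor [c2 ^ e] per step; the surplus [2 ^ i] is
    unbounded. *)
Lemma poly_growth_doubling (D : nat -> nat) (c e c2 : nat) : (0 < c2)%N ->
  (forall t, (0 < D t)%N) -> (forall t, (D t <= (c * t.+1) ^ e)%N) ->
  exists C3, forall t0, exists2 t, (t0 <= t)%N & (D (c2 * t) <= C3 * D t)%N.
Proof.
move=> c2_gt0 D0 De; exists (2 * c2 ^ e)%N => t0; apply: contrapT => h.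
have {}h t : (t0.+1 <= t)%N -> (2 * c2 ^ e * D t < D (c2 * t))%N.
  move=> tt; rewrite ltnNge; apply/negP => le; apply: h; exists t => //.
  exact: ltnW.
have lb i : ((2 * c2 ^ e) ^ i <= D (c2 ^ i * t0.+1))%N.
  elim: i => [|i IHi]; first by rewrite expn0 D0.
  rewrite expnS [X in D X](_ : _ = c2 * (c2 ^ i * t0.+1))%N; last first.
    by rewrite expnS mulnA.
  apply: leq_trans (ltnW (h _ _)); first by rewrite leq_mul2l IHi orbT.
  by rewrite leq_pmull// expn_gt0 c2_gt0.
have ub i : (2 ^ i <= (c * t0.+2) ^ e)%N.
  have ci : (0 < c2 ^ (i * e))%N by rewrite expn_gt0 c2_gt0.
  rewrite -(leq_pmul2l ci); apply: (@leq_trans ((2 * c2 ^ e) ^ i)%N).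
    by rewrite expnMn -expnM mulnC [(i * e)%N]mulnC.
  apply: leq_trans (lb i) _; apply: leq_trans (De _) _.
  rewrite expnM -expnMn.
  have le : (c * (c2 ^ i * t0.+1).+1 <= c2 ^ i * (c * t0.+2))%N.
    have : (0 < c2 ^ i)%N by rewrite expn_gt0 c2_gt0.
    by move: (c2 ^ i)%N => a a0; nia.
  by case: (e) => // e'; rewrite leq_exp2r.
have := leq_trans (ltn_expl ((c * t0.+2) ^ e)%N (isT : (1 < 2)%N)) (ub _).
by rewrite ltnn.
Qed.

(** * Graded algebras *)

Lemma big_ord_widen_zero (V : nmodType) (F : nat -> V) n N : (n <= N)%N ->
  (forall j, (n <= j)%N -> F j = 0) -> \sum_(j < n) F j = \sum_(j < N) F j.
Proof.
move=> nN F0; rewrite (big_ord_widen _ F nN) [RHS](bigID (fun i : 'I_N => (i < n)%N)) /=.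
rewrite [X in _ + X]big1 ?addr0// => i; rewrite -leqNgt; exact: F0.
Qed.

Section Generation.
Variables (K : fieldType) (A : lalgType K).
Implicit Type Q : set A.

Definition subalgebra Q :=
  [/\ Q 1, subspace Q & forall u v, Q u -> Q v -> Q (u * v)].

Lemma subalgebraP Q : subalg_closed [in Q] <-> subalgebra Q.
Proof.
split=> [[h1 hl hm]|[h1 [h0 hl] hm]].
  have l1 : forall k u v, Q u -> Q v -> Q (k *: u + v).
    by move=> k u v; have := hl k u v; rewrite !in_setE.
  have q1 : Q 1 by move: h1; rewrite in_setE.
  split=> //.
    by split=> //; have := l1 (-1) 1 1 q1 q1; rewrite scaleN1r addNr.
  by move=> u v; have := hm u v; rewrite !in_setE.
split; first by rewrite in_setE.
- by move=> k u v; rewrite !in_setE; apply: hl.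
- by move=> u v; rewrite !in_setE; apply: hm.
Qed.

Lemma alg_gen_subalgebra S : subalgebra (alg_gen S : set A).
Proof.
split=> [B [/subalgebraP[h1 _ _] _]//||u v hu hv B [hB SB]].
  split=> [B [/subalgebraP[_ [h0 _] _] _]//|k u v hu hv B [hB SB]].
  have /subalgebraP[_ [_ hl] _] := hB.
  by apply: hl; [apply: hu|apply: hv].
by have /subalgebraP[_ _ hm] := hB; apply: hm; [apply: hu|apply: hv].
Qed.

Lemma sub_alg_gen (S : set A) : S `<=` alg_gen S.
Proof. by move=> x Sx B [_]; apply. Qed.

Lemma alg_gen_le (S : set A) Q : subalgebra Q -> S `<=` Q -> alg_gen S `<=` Q.
Proof. by move=> hQ SQ x; apply; split=> //; apply/subalgebraP. Qed.

(** Each of the finitely many known generators is a polynomial in finitely many elements of [S];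
    together these form the family. *)
Lemma alg_gen_finite (S : set A) (s : seq A) :
  alg_gen [set` s] = [set: A] -> alg_gen S = [set: A] ->
  exists n (u : 'I_n -> A), (forall i, S (u i)) /\ alg_gen (range u) = [set: A].
Proof.
move=> hs hS.
pose Q : set A := [set x | exists l : seq A, [set` l] `<=` S /\ alg_gen [set` l] x].
have mon (l l' : seq A) : {subset l <= l'} -> alg_gen [set` l] `<=` alg_gen [set` l'].
  move=> ll'; apply: alg_gen_le; first exact: alg_gen_subalgebra.
  by move=> x /= /ll' h; apply: sub_alg_gen.
have cat (l l' : seq A) : [set` l] `<=` S -> [set` l'] `<=` S -> [set` l ++ l'] `<=` S.
  by move=> h h' x /=; rewrite mem_cat => /orP[/h|/h'].
have Qsub : subalgebra Q.
  split.
  - by exists [::]; split=> //; have [] := alg_gen_subalgebra [set` [::]].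
  - split; first by exists [::]; split=> //; have [_ []] := alg_gen_subalgebra [set` [::]].
    move=> k x y [l [lS lx]] [l' [lS' ly]]; exists (l ++ l'); split; first exact: cat.
    have [_ [_ h] _] := alg_gen_subalgebra [set` l ++ l']; apply: h.
      by apply: mon lx => z zl; rewrite mem_cat zl.
    by apply: mon ly => z zl; rewrite mem_cat zl orbT.
  - move=> x y [l [lS lx]] [l' [lS' ly]]; exists (l ++ l'); split; first exact: cat.
    have [_ _ h] := alg_gen_subalgebra [set` l ++ l']; apply: h.
      by apply: mon lx => z zl; rewrite mem_cat zl.
    by apply: mon ly => z zl; rewrite mem_cat zl orbT.
have QT x : Q x.
  have : alg_gen S x by rewrite hS.
  apply: alg_gen_le => // z Sz; exists [:: z]; split.
    by move=> y /=; rewrite inE => /eqP->.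
  by apply: sub_alg_gen; rewrite /= inE.
have [l [lS sl]] : exists l : seq A, [set` l] `<=` S /\ [set` s] `<=` alg_gen [set` l].
  elim: (s) => [|z s' [l [lS sl]]]; first by exists [::].
  have [l' [lS' lz]] := QT z; exists (l' ++ l); split; first exact: cat.
  move=> y /=; rewrite inE => /orP[/eqP->|ys].
    by apply: mon lz => u ul; rewrite mem_cat ul.
  by apply: mon (sl _ ys) => u ul; rewrite mem_cat ul orbT.
exists (size l), (fun i => l`_i); split=> [i|]; first by apply: lS; apply: mem_nth.
apply/seteqP; split=> // x _.
have : alg_gen [set` s] x by rewrite hs.
apply: alg_gen_le; first exact: alg_gen_subalgebra.
move=> y /sl; apply: alg_gen_le; first exact: alg_gen_subalgebra.
move=> z /= zl; apply: sub_alg_gen.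
have zs : (index z l < size l)%N by rewrite index_mem.
by exists (Ordinal zs) => //=; rewrite nth_index.
Qed.

End Generation.

Section GradedComponents.
Variables (K : fieldType) (R : comAlgType K) (gr : nat -> set R).
Hypothesis grR : is_grading gr.

Lemma gr_subspace j : subspace (gr j).
Proof. exact/submod_closed_subspace/grading_submod. Qed.

Lemma gdec_ex (x : R) : exists p : nat * (nat -> R), [/\ forall j, gr j (p.2 j),
  forall j, (p.1 <= j)%N -> p.2 j = 0 & x = \sum_(j < p.1) p.2 j].
Proof.
have [n [c [gc ->]]] := grading_decomp grR x.
exists (n, fun j => if (j < n)%N then c j else 0); split=> /=.
- by move=> j; case: ifP => // _; apply: subspace0 (gr_subspace j).
- by move=> j; rewrite leqNgt => /negbTE->.
- by apply: eq_bigr => i _; rewrite ltn_ord.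
Qed.

Definition gsz x := (projT1 (cid (gdec_ex x))).1.
Definition gpr j x := (projT1 (cid (gdec_ex x))).2 j.

Lemma gpr_gr j x : gr j (gpr j x).
Proof. by rewrite /gpr; case: cid => p /= [h _ _]; apply: h. Qed.

Lemma gpr_gsz x j : (gsz x <= j)%N -> gpr j x = 0.
Proof. by rewrite /gpr /gsz; case: cid => p /= [_ h _]; apply: h. Qed.

Lemma gpr_sum N x : (forall j, (N <= j)%N -> gpr j x = 0) -> x = \sum_(j < N) gpr j x.
Proof.
move=> h; have {1}-> : x = \sum_(j < gsz x) gpr j x.
  by rewrite /gpr /gsz; case: cid => p /= [_ _ e].
rewrite (@big_ord_widen_zero _ (gpr^~ x) _ (maxn N (gsz x))) ?leq_maxr//; last exact: gpr_gsz.
by rewrite -(@big_ord_widen_zero _ (gpr^~ x) N) ?leq_maxl.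
Qed.

Lemma gpr_gsum x : x = \sum_(j < gsz x) gpr j x.
Proof. by apply: gpr_sum => j; apply: gpr_gsz. Qed.

Lemma gpr_uniq n (c : nat -> R) : (forall j, gr j (c j)) ->
  (forall j, (n <= j)%N -> c j = 0) -> forall j, gpr j (\sum_(j < n) c j) = c j.
Proof.
move=> gc c0 j; set x := \sum_(_ < _) _; pose N := maxn n (maxn j.+1 (gsz x)).
apply/eqP; rewrite -subr_eq0; apply/eqP.
pose b k := gpr k x - c k; rewrite -/(b j); move: j @b @N => j b N.
apply: (@grading_direct _ _ _ grR N b).
- by move=> k; apply: subspaceB (gr_subspace k) (gpr_gr _ _) (gc _).
- rewrite sumrB -(@big_ord_widen_zero _ c n) ?leq_maxl//.
  rewrite -(@big_ord_widen_zero _ (gpr^~ x) (gsz x)) ?leq_max ?leqnn ?orbT//.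
    by rewrite -gpr_gsum subrr.
  by move=> i; apply: gpr_gsz.
- by rewrite !leq_max leqnn orbT.
Qed.

Lemma gpr_linear j : linear (gpr j).
Proof.
move=> k x y; pose N := maxn (gsz x) (gsz y).
have h i : (N <= i)%N -> gpr i x = 0 /\ gpr i y = 0.
  by rewrite geq_max => /andP[a b]; rewrite !gpr_gsz.
rewrite {1}(gpr_sum (fun i Ni => (h i Ni).1)) {1}(gpr_sum (fun i Ni => (h i Ni).2)).
rewrite scaler_sumr -big_split /= (gpr_uniq (c := fun j => k *: gpr j x + gpr j y))//.
  by move=> i; apply: (gr_subspace i).2; apply: gpr_gr.
by move=> i /h[-> ->]; rewrite scaler0 addr0.
Qed.
HB.instance Definition _ j := GRing.isLinear.Build K R R *:%R (gpr j) (gpr_linear j).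

Lemma gpr_hom i j x : gr i x -> gpr j x = if j == i then x else 0.
Proof.
move=> gx; pose c k := if k == i then x else 0.
have {1}-> : x = \sum_(k < i.+1) c k.
  by rewrite big_ord_recr /= /c eqxx big1 ?add0r// => k _; rewrite ltn_eqF.
rewrite gpr_uniq// => k; rewrite /c.
  by case: eqP => [->//|_]; apply: subspace0 (gr_subspace k).
by case: eqP => [->|//]; rewrite ltnn.
Qed.

Lemma gpr_ext x y : (forall j, gpr j x = gpr j y) -> x = y.
Proof.
move=> h; rewrite [x]gpr_gsum [y](@gpr_sum (gsz x)) => [|j]; first exact: eq_bigr.
by rewrite -h; apply: gpr_gsz.
Qed.

Lemma graded_ind (Q : set R) : subspace Q -> (forall j x, gr j x -> Q x) -> forall x, Q x.
Proof.
move=> hQ hg x; rewrite [x]gpr_gsum; apply: subspace_sum => // i _.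
exact: hg (gpr_gr _ _).
Qed.

Definition gr_le s : set R := [set x | forall j, (s < j)%N -> gpr j x = 0].

Lemma gr_le_subspace s : subspace (gr_le s).
Proof.
split=> [j _|k x y hx hy j sj]; first by rewrite linear0.
by rewrite gpr_linear hx// hy// scaler0 addr0.
Qed.

Lemma gr_le_sum s x : gr_le s x -> x = \sum_(j < s.+1) gpr j x.
Proof. by move=> h; apply: gpr_sum. Qed.

Lemma gr_gr_le i s x : (i <= s)%N -> gr i x -> gr_le s x.
Proof.
move=> le gx j sj; rewrite (gpr_hom _ gx) gtn_eqF//; exact: leq_ltn_trans le sj.
Qed.

Lemma gr_le_mono s t x : (s <= t)%N -> gr_le s x -> gr_le t x.
Proof. by move=> st h j tj; apply: h; apply: leq_ltn_trans tj. Qed.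

Lemma gr_leM s t x y : gr_le s x -> gr_le t y -> gr_le (s + t) (x * y).
Proof.
move=> /gr_le_sum-> /gr_le_sum->; rewrite mulr_suml.
apply: subspace_sum (gr_le_subspace _) _ => i _; rewrite mulr_sumr.
apply: subspace_sum (gr_le_subspace _) _ => j _.
apply: (@gr_gr_le (i + j)); first by rewrite leq_add// -ltnS.
by apply: grading_mul => //; apply: gpr_gr.
Qed.

Lemma gr_le_ex x : exists s, gr_le s x.
Proof. by exists (gsz x) => j sj; apply: gpr_gsz; apply: ltnW. Qed.

Hypothesis gr0 : gr 0%N = range (fun k : K => k%:A).

Lemma gr0_scalar k : gr 0%N k%:A. Proof. by rewrite gr0; exists k. Qed.

Lemma gr_le0 x : gr_le 0 x -> exists k : K, x = k%:A.
Proof.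
by move=> /gr_le_sum; rewrite big_ord1 => ->; have := gpr_gr 0 x; rewrite gr0 => -[k _ <-]; exists k.
Qed.

Lemma gr_le_scalar s k : gr_le s k%:A.
Proof. exact: gr_gr_le (leq0n _) (gr0_scalar k). Qed.

Lemma gr_le1 s : gr_le s 1.
Proof. by rewrite -[1]scale1r; exact: gr_le_scalar. Qed.

Lemma gr_leX s x n : gr_le s x -> gr_le (n * s) (x ^+ n).
Proof.
move=> h; elim: n => [|n IHn]; first by rewrite expr0; exact: gr_le1.
by rewrite exprS mulSn; apply: gr_leM.
Qed.

End GradedComponents.

(* The bounds [1 <= dg i <= w] encode generation in degrees less than the slope [w.+1];
   degree 0 is excluded because the scalars are there for free. *)
Record graded_generators (K : fieldType) (R : comAlgType K) (gr : nat -> set R)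
    (w m : nat) (x : 'I_m -> R) (dg : 'I_m -> nat) : Prop := GradedGenerators {
  ggen_deg : forall i, (0 < dg i <= w)%N;
  ggen_gr : forall i, gr (dg i) (x i);
  ggen_gen : alg_gen (range x) = [set: R]
}.

Lemma graded_generators_ex (K : fieldType) (R : comAlgType K) (gr : nat -> set R) (w : nat) :
  finitely_generated_alg R -> gr 0%N = range (fun k : K => k%:A) ->
  bernstein_slope gr w.+1 ->
  exists m (x : 'I_m -> R) (dg : 'I_m -> nat), graded_generators gr w x dg.
Proof.
move=> [s hs] gr0 hw.
pose S : set R := [set x | exists2 j, (0 < j <= w)%N & gr j x].
have hS : alg_gen S = [set: R].
  apply/seteqP; split=> // x _.
  have : alg_gen [set x : R | exists2 j : nat, j%:Z < w.+1%:Z & gr j x] x by rewrite hw.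
  apply: alg_gen_le; first exact: alg_gen_subalgebra.
  move=> y [[|j] jw gy].
    have [h1 [h0 hl] _] := @alg_gen_subalgebra _ R S.
    by move: gy; rewrite gr0 => -[k _ <-]; rewrite -[k%:A]addr0; apply: hl.
  by apply: sub_alg_gen; exists j.+1.
have [m [x [Sx xg]]] := alg_gen_finite hs hS.
have /choice[dg hdg] : forall i, exists j, (0 < j <= w)%N /\ gr j (x i).
  by move=> i; have [j jw gx] := Sx i; exists j.
by exists m, x, dg; split=> // i; have [] := hdg i.
Qed.

(** * Differential operators on a graded algebra *)

Section Operators.
Variables (K : fieldType) (R : comAlgType K).
Implicit Types (d e : endo R) (r x y : R).

Definition linear_endo (f : R -> R) (hf : linear f) : endo R :=
  HB.pack_for {linear R -> R} f (GRing.isLinear.Build K R R *:%R f hf).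

Lemma linear_endoE f (hf : linear f) x : linear_endo hf @@ x = f x.
Proof. by []. Qed.

Lemma endo_apply_linear d : linear (endo_apply d).
Proof. exact: (@linearP _ _ _ _ (d : {linear R -> R})). Qed.
HB.instance Definition _ d :=
  GRing.isLinear.Build K R R *:%R (endo_apply d) (endo_apply_linear d).

Lemma endo_ext d e : (forall x, d @@ x = e @@ x) -> d = e.
Proof. by move=> h; apply: endoP; exact: h. Qed.

Lemma endo_eq x d e : d = e -> d @@ x = e @@ x. Proof. by move->. Qed.

Lemma endo_sumE I (r : seq I) (P : pred I) (F : I -> endo R) x :
  (\sum_(i <- r | P i) F i) @@ x = \sum_(i <- r | P i) F i @@ x.
Proof. by elim/big_rec2: _ => // i y d _ <-. Qed.

Definition comm_op d r : endo R := d * mulop r - mulop r * d.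

Lemma comm_opE d r x : comm_op d r @@ x = d @@ (r * x) - r * (d @@ x).
Proof. by []. Qed.

Lemma comm_op_linear d : linear (comm_op d).
Proof.
move=> k r s; apply: endo_ext => x.
rewrite -[RHS]/(k *: (comm_op d r @@ x) + comm_op d s @@ x).
rewrite !comm_opE mulrDl linearD -scalerAl linearZ mulrDl -scalerAl scalerBr.
by rewrite opprD addrACA.
Qed.

Lemma comm_op0 d : comm_op d 0 = 0.
Proof. by apply: endo_ext => x; rewrite comm_opE !mul0r linear0 subrr. Qed.

Lemma comm_op_eq0_mulop d : (forall r, comm_op d r = 0) -> d = mulop (d @@ 1).
Proof.
move=> h; apply: endo_ext => r; have := endo_eq 1 (h r).
rewrite comm_opE mulr1 => /eqP; rewrite subr_eq0 => /eqP->.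
by rewrite -[RHS]/(d @@ 1 * r) mulrC.
Qed.

Lemma diff_le_subspace n : subspace (@diff_le K R n).
Proof. by split=> [|k d e]; [exact: diff_le0|exact: diff_le_linear]. Qed.

Lemma diff_le_mulop n r : diff_le n (mulop r).
Proof. by apply: (@diff_leW _ _ 0) => //; exists r. Qed.

Section Generators.
Variables (m : nat) (x : 'I_m -> R).
Hypothesis xgen : alg_gen (range x) = [set: R].

Lemma gen_ind (Q : set R) : subalgebra Q -> (forall i, Q (x i)) -> forall r, Q r.
Proof.
move=> hQ hx r; have : alg_gen (range x) r by rewrite xgen.
by apply: alg_gen_le => // _ [i _ <-].
Qed.

Lemma comm_op_gen d : (forall i, comm_op d (x i) = 0) -> d = mulop (d @@ 1).
Proof.
move=> h; apply: comm_op_eq0_mulop; apply: gen_ind => //; split.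
- by apply: endo_ext => y; rewrite comm_opE !mul1r subrr.
- split; first by apply: endo_ext => y; rewrite comm_opE !mul0r linear0 subrr.
  by move=> k r s hr hs; rewrite comm_op_linear hr hs scaler0 addr0.
- move=> r s hr hs; apply: endo_ext => y; rewrite comm_opE -mulrA.
  have := endo_eq (s * y) hr; rewrite comm_opE => /eqP.
  rewrite subr_eq0 => /eqP->.
  have := endo_eq y hs; rewrite comm_opE => /eqP.
  by rewrite subr_eq0 => /eqP->; rewrite -mulrA subrr.
Qed.

Definition monom (a : 'I_m -> nat) : R := \prod_i x i ^+ a i.

Lemma monom_shift a i : monom (fun j => (j == i) + a j)%N = x i * monom a.
Proof.
rewrite /monom (bigD1 i)//= [in RHS](bigD1 i)//= eqxx add1n exprS -!mulrA.
by congr (_ * (_ * _)); apply: eq_bigr => j /negbTE->.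
Qed.

Lemma monom0 : monom (fun _ => 0%N) = 1.
Proof. by rewrite /monom big1// => i _; rewrite expr0. Qed.

Lemma monomM a b : monom (fun i => a i + b i)%N = monom a * monom b.
Proof. by rewrite /monom -big_split; apply: eq_bigr => i _; rewrite exprD. Qed.

Lemma monom_span r : kspan (range monom) r.
Proof.
have ks := @kspan_subspace _ R (range monom).
apply: gen_ind; last first.
  move=> i; rewrite -[x i]mulr1 -monom0 -monom_shift.
  by apply: sub_kspan; exists (fun j => (j == i) + 0)%N.
split=> //; first by apply: sub_kspan; exists (fun _ => 0%N); rewrite ?monom0.
move=> _ _ [n [c [u [hu ->]]]] [n' [c' [u' [hu' ->]]]].
rewrite mulr_suml; apply: subspace_sum => // i _.
rewrite mulr_sumr; apply: subspace_sum => // j _.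
rewrite -scalerAl -scalerAr; apply: subspaceZ => //; apply: subspaceZ => //.
have [a _ <-] := hu i; have [b _ <-] := hu' j; rewrite -monomM.
by apply: sub_kspan; exists (fun i => a i + b i)%N.
Qed.

(** A commutator with a generator lowers the order by one and raises one exponent by one, so order
    at most [n] requires only exponents at most [n]. The dimension bound for the Bernstein
    filtration rests on this. *)
Lemma diff_le_monom_eq0 n d : diff_le n d ->
  (forall a, (forall i, a i <= n)%N -> d @@ monom a = 0) -> d = 0.
Proof.
elim: n d => [|n IHn] d.
  move=> [r ->] /(_ (fun _ => 0%N) (fun _ => isT)); rewrite monom0.
  by rewrite -[_ @@ _]/(r * 1) mulr1 => ->; rewrite mulop0.
move=> hd ha; rewrite [d]comm_op_gen => [|i].
  by rewrite -monom0 ha// mulop0.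
apply: IHn (hd (x i)) _ => a an; rewrite comm_opE -monom_shift !ha ?mulr0 ?subrr//.
  by move=> j; apply: leqW.
by move=> j; rewrite (@leq_add _ _ 1)// leq_b1.
Qed.

End Generators.
End Operators.

Section HomogeneousComponents.
Variables (K : fieldType) (R : comAlgType K) (gr : nat -> set R).
Hypothesis grR : is_grading gr.
Implicit Types (d : endo R) (e : int).
Local Notation pr := (gpr grR).

Definition gpr_shift e j (y : R) : R := if j%:Z + e is Posz k then pr k y else 0.

Lemma gpr_shift_linear e j : linear (gpr_shift e j).
Proof.
move=> k x y; rewrite /gpr_shift; case: (_ + _) => n; first exact: linearP.
by rewrite scaler0 addr0.
Qed.
HB.instance Definition _ e j :=
  GRing.isLinear.Build K R R *:%R (gpr_shift e j) (gpr_shift_linear e j).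

Definition hcomp_fun e d (x : R) := \sum_(j < gsz grR x) gpr_shift e j (d @@ pr j x).

Lemma hcomp_funE N e d x : (forall j, (N <= j)%N -> pr j x = 0) ->
  hcomp_fun e d x = \sum_(j < N) gpr_shift e j (d @@ pr j x).
Proof.
move=> h; pose F j := gpr_shift e j (d @@ pr j x).
rewrite /hcomp_fun (@big_ord_widen_zero _ F _ (maxn N (gsz grR x))) ?leq_maxr//.
  rewrite -(@big_ord_widen_zero _ F N) ?leq_maxl// => j Nj.
  by rewrite /F h// !linear0.
by move=> j xj; rewrite /F gpr_gsz// !linear0.
Qed.

Lemma hcomp_fun_linear e d : linear (hcomp_fun e d).
Proof.
move=> k x y; pose N := maxn (gsz grR x) (gsz grR y).
have h j : (N <= j)%N -> pr j x = 0 /\ pr j y = 0.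
  by rewrite geq_max => /andP[a b]; rewrite !gpr_gsz.
rewrite !(@hcomp_funE N) => [|j /h[_ ->]//|j /h[->]//|j /h[hx hy]]; last first.
  by rewrite gpr_linear hx hy scaler0 addr0.
rewrite scaler_sumr -big_split; apply: eq_bigr => j _ /=.
by rewrite gpr_linear linearP gpr_shift_linear.
Qed.

Definition hcomp e d : endo R := linear_endo (hcomp_fun_linear e d).

Lemma hcomp_hom e d j x : gr j x -> hcomp e d @@ x = gpr_shift e j (d @@ x).
Proof.
move=> gx; rewrite /hcomp linear_endoE (@hcomp_funE j.+1) => [|k jk]; last first.
  by rewrite (gpr_hom _ _ gx) gtn_eqF.
rewrite big_ord_recr /= (gpr_hom _ _ gx) eqxx big1 ?add0r// => k _.
by rewrite (gpr_hom _ _ gx) ltn_eqF// !linear0.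
Qed.

Lemma endo_hom_ext d d' : (forall j x, gr j x -> d @@ x = d' @@ x) -> d = d'.
Proof.
move=> h; apply: endo_ext => x; apply/eqP; rewrite -subr_eq0; apply/eqP.
move: x; apply: (graded_ind grR (Q := fun x => d @@ x - d' @@ x = 0)).
  split=> /= [|k x y]; first by rewrite !linear0 addr0.
  by rewrite !endo_apply_linear opprD addrACA -scalerBr => -> ->; rewrite scaler0 addr0.
by move=> j x /h-> /=; rewrite subrr.
Qed.

Lemma hcomp_grint e d j x : gr j x -> gr_int gr (j%:Z + e) (hcomp e d @@ x).
Proof.
move=> gx; rewrite (hcomp_hom _ _ gx) /gpr_shift; case: (_ + _) => //= n.
exact: gpr_gr.
Qed.

Lemma hcomp_mulop e r : hcomp e (mulop r) = mulop (gpr_shift e 0 r).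
Proof.
apply: endo_hom_ext => j x gx; rewrite (hcomp_hom _ _ gx).
rewrite -[mulop r @@ x]/(r * x) -[RHS]/(gpr_shift e 0 r * x).
move: r; apply: (graded_ind grR (Q := fun r => gpr_shift e j (r * x) = gpr_shift e 0 r * x)).
  split=> /= [|k r s hr hs]; first by rewrite mul0r !linear0 mul0r.
  by rewrite mulrDl -scalerAl !gpr_shift_linear hr hs mulrDl -scalerAl.
move=> i r gri; have gi := grading_mul grR gri gx.
rewrite /gpr_shift add0r; case: e => [e|e].
  rewrite -PoszD (gpr_hom _ _ gi) (gpr_hom _ _ gri) addnC eqn_add2r.
  by case: eqP => //; rewrite mul0r.
case E : (j%:Z + _) => [k|k]; last by rewrite mul0r.
rewrite mul0r (gpr_hom _ _ gi) ifF//; apply/negP => /eqP ki.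
by move: E; rewrite ki NegzE; lia.
Qed.

(** The shift of the index by [k] lets inductions on the order run on homogeneous components. *)
Lemma hcomp_comm e d k r : gr k r -> comm_op (hcomp e d) r = hcomp (e + k%:Z) (comm_op d r).
Proof.
move=> gk; apply: endo_hom_ext => j x gx; rewrite (hcomp_hom _ _ gx) !comm_opE.
rewrite linearB (hcomp_hom _ _ gx) (hcomp_hom _ _ (grading_mul grR gk gx)).
congr (_ - _).
  by rewrite /gpr_shift (_ : _ + e = j%:Z + (e + k%:Z))//; lia.
have := endo_eq r (hcomp_mulop (j%:Z + e) (d @@ x)).
rewrite (hcomp_hom _ _ gk) -[mulop _ @@ r]/(d @@ x * r).
rewrite -[RHS]/(gpr_shift (j%:Z + e) 0 (d @@ x) * r) /gpr_shift add0r => h.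

rewrite [LHS]mulrC [in RHS]mulrC -h.
by rewrite (_ : k%:Z + _ = j%:Z + (e + k%:Z))//; lia.
Qed.

Lemma diff_le_hcomp n e d : diff_le n d -> diff_le n (hcomp e d).
Proof.
elim: n e d => [|n IHn] e d.
  by move=> [r ->]; rewrite hcomp_mulop; exists (gpr_shift e 0 r).
move=> hd; apply: (graded_ind grR (Q := fun r => diff_le n (comm_op (hcomp e d) r))).
  split=> /= [|k r s]; last by rewrite comm_op_linear; apply: diff_le_linear.
  by rewrite comm_op0; apply: diff_le0.
by move=> k r gk; rewrite (hcomp_comm _ _ gk); apply: IHn; apply: hd.
Qed.

Variables (w m : nat) (x : 'I_m -> R) (dg : 'I_m -> nat).
Hypotheses (xg : graded_generators gr w x dg)
  (gr0 : gr 0%N = range (fun k : K => k%:A)).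

(** For large [|e|] the components of all commutators with generators vanish, by induction on the
    order; the component of [d] is then multiplication by its value at 1, a component of [d @@ 1],
    which vanishes too. *)
Lemma hcomp_bounded n d : diff_le n d ->
  exists N : nat, forall e, (N < `|e|)%N -> hcomp e d = 0.
Proof.
have hmul r : exists N : nat, forall e, (N < `|e|)%N -> gpr_shift e 0 r = 0.
  exists (gsz grR r) => e; rewrite /gpr_shift add0r; case: e => // e /ltnW.
  exact: gpr_gsz.
elim: n d => [|n IHn] d.
  move=> [r ->]; have [N hN] := hmul r; exists N => e /hN.
  by rewrite hcomp_mulop => ->; rewrite mulop0.
move=> hd; have /choice[N hN] i := IHn _ (hd (x i)).
have [N1 hN1] := hmul (d @@ 1).
(* [w] absorbs the shift of the index by the degree of a generator, and [N1] handles [d @@ 1]. *)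
exists (N1 + w + \sum_i N i)%N => e he.
rewrite [hcomp e d](comm_op_gen (ggen_gen xg)) => [|i]; last first.
  rewrite (hcomp_comm _ _ (ggen_gr xg i)); apply: hN.
  have /andP[_ dw] := ggen_deg xg i.
  have : (N i <= \sum_i N i)%N by rewrite (bigD1 i)//= leq_addr.
  by move: he dw; move: (N i) (\sum_i N i)%N (dg i) => a b c; lia.
have e0 : gpr_shift e 0 (d @@ 1) = 0 by apply: hN1; lia.
have g1 : gr 0%N 1 by rewrite -[1]scale1r; apply: gr0_scalar.
suff -> : hcomp e d @@ 1 = 0 by rewrite mulop0.
by rewrite (hcomp_hom _ _ g1) e0.
Qed.

Lemma hcomp_sum N d : (forall e, (N < `|e|)%N -> hcomp e d = 0) ->
  d = \sum_(i < (N + N).+1) hcomp (i%:Z - N%:Z) d.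
Proof.
move=> hN; apply: endo_hom_ext => j y gy; rewrite endo_sumE.
apply: (@gpr_ext _ _ _ grR) => k; rewrite linear_sum /=.
have E i : pr k (hcomp (i%:Z - N%:Z) d @@ y) =
    if (i + j == k + N)%N then pr k (d @@ y) else 0.
  rewrite (hcomp_hom _ _ gy) /gpr_shift; case E : (_ + _) => [l|l].
    rewrite (gpr_hom _ k (gpr_gr grR l _)); have -> : (k == l) = (i + j == k + N)%N by lia.
    by case: eqP => // ?; have -> : l = k by lia.
  by rewrite linear0; case: eqP => // ?; lia.
under eq_bigr do rewrite E.
rewrite -big_mkcond /=; have [le|gt] := leqP j (k + N); last first.
  rewrite big_pred0 => [|i]; last by apply/negP => /eqP; lia.
  have := hN (k%:Z - j%:Z); rewrite [(N < _)%N](_ : _ = true); last by lia.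
  move=> /(_ isT) /(@endo_eq _ _ y _ _); rewrite (hcomp_hom _ _ gy) /gpr_shift.
  by rewrite addrC subrK.
have [le2|gt2] := leqP (k + N - j) (N + N); last first.
  rewrite big_pred0 => [|i]; last by apply/negP => /eqP; have := ltn_ord i; lia.
  have := hN (k%:Z - j%:Z); rewrite [(N < _)%N](_ : _ = true); last by lia.
  move=> /(_ isT) /(@endo_eq _ _ y _ _); rewrite (hcomp_hom _ _ gy) /gpr_shift.
  by rewrite addrC subrK.
have lt : (k + N - j < (N + N).+1)%N by [].
rewrite (big_pred1 (Ordinal lt))// => i /=; apply/eqP/eqP => [h|->/=]; last by lia.
by apply: val_inj => /=; lia.
Qed.

End HomogeneousComponents.

(** * The Bernstein filtration *)

Section DiffopBasics.
Variables (K : fieldType) (R : comAlgType K).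
Implicit Types (d e : diffop R) (r s x : R).

Definition dapp d x : R := val d @@ x.

Lemma dapp_linear d : linear (dapp d). Proof. exact: endo_apply_linear. Qed.
HB.instance Definition _ d := GRing.isLinear.Build K R R *:%R (dapp d) (dapp_linear d).

Lemma dappD d e x : dapp (d + e) x = dapp d x + dapp e x. Proof. by []. Qed.
Lemma dappB d e x : dapp (d - e) x = dapp d x - dapp e x. Proof. by []. Qed.
Lemma dappZ k d x : dapp (k *: d) x = k *: dapp d x. Proof. by []. Qed.
Lemma dappM d e x : dapp (d * e) x = dapp d (dapp e x). Proof. by []. Qed.
Lemma dapp_dmul r x : dapp (dmul r) x = r * x. Proof. by []. Qed.
Lemma dapp0 x : dapp 0 x = 0. Proof. by []. Qed.
Lemma dapp_sum I (t : seq I) (P : pred I) (F : I -> diffop R) x :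
  dapp (\sum_(i <- t | P i) F i) x = \sum_(i <- t | P i) dapp (F i) x.
Proof. by elim/big_rec2: _ => // i y d _ <-. Qed.

Lemma diffop_ext d e : (forall x, dapp d x = dapp e x) -> d = e.
Proof. by move=> h; apply: val_inj; apply: endo_ext; exact: h. Qed.

Lemma dmul_linear : linear (@dmul K R).
Proof.
move=> k r s; apply: diffop_ext => x.
by rewrite dappD dappZ !dapp_dmul mulrDl -scalerAl.
Qed.
HB.instance Definition _ :=
  GRing.isLinear.Build K R (diffop R) *:%R (@dmul K R) dmul_linear.

Lemma dmulM r s : dmul (r * s) = dmul r * dmul s.
Proof. by apply: diffop_ext => x; rewrite dappM !dapp_dmul mulrA. Qed.

Lemma dmul1 : dmul 1 = 1 :> diffop R.
Proof. by apply: diffop_ext => x; rewrite dapp_dmul mul1r. Qed.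

Lemma dmulX r n : dmul (r ^+ n) = dmul r ^+ n.
Proof. by elim: n => [|n IHn]; rewrite ?expr0 ?dmul1// !exprS dmulM IHn. Qed.

Lemma dmul_eq0 r : dmul r = 0 -> r = 0.
Proof. by move=> /(congr1 (fun d => dapp d 1)); rewrite dapp_dmul mulr1 dapp0. Qed.

Lemma diffop_ex d : exists n, diff_le n (val d).
Proof. by case: d => d dP; exact/asboolP. Qed.

End DiffopBasics.

Lemma kspan_finP (K : fieldType) (V : lmodType K) (I : finType) (F : I -> V) x :
  kspan (range F) x -> exists c : I -> K, x = \sum_i c i *: F i.
Proof.
apply: (@kspan_le _ _ _ [set x | exists c : I -> K, x = \sum_i c i *: F i]).
  split=> /= [|k _ _ [c ->] [d ->]].
    by exists (fun _ => 0); rewrite big1// => i _; rewrite scale0r.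
  exists (fun i => k * c i + d i); rewrite scaler_sumr -big_split.
  by apply: eq_bigr => i _; rewrite scalerDl scalerA.
move=> _ [i _ <-]; exists (fun j => (j == i)%:R).
rewrite (bigD1 i)//= eqxx scale1r big1 ?addr0// => j /negbTE->.
by rewrite scale0r.
Qed.

Section BernsteinFiltration.
Variables (K : fieldType) (R : comAlgType K) (gr : nat -> set R).
Hypotheses (grR : is_grading gr) (gr0 : gr 0%N = range (fun k : K => k%:A)).
Variables (w m : nat) (x : 'I_m -> R) (dg : 'I_m -> nat).
Hypothesis xg : graded_generators gr w x dg.
Implicit Types (d : diffop R) (r y : R).

(** Order at most [n] replaces order exactly [n], since the former is preserved by products; a
    smaller order has smaller weight, so the span is the same. *)
Definition bern_hom i : set (diffop R) := [set d | exists (e : int) (n : nat),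
  [/\ homogeneous gr d e, diff_le n (val d) & e + w.+1%:Z * n%:Z <= i%:Z]].

Definition bern i : set (diffop R) := kspan (bern_hom i).

Lemma bernE : bernstein_filtration gr w.+1 = bern.
Proof.
apply/funext => i; apply/seteqP; split; apply: kspan_mono => d [e [n [he hn le]]].
  by exists e, n; split; [exact: he|exact: hn.1|exact: le].
have [n' [dn' min']] : exists n', has_order d n'.
  have ex : exists n, `[< diff_le n (val d) >] by exists n; apply/asboolP.
  case: (ex_minnP ex) => n' /asboolP dn' min'; exists n'; split=> // k kn /asboolP/min'.
  by rewrite leqNgt kn.
exists e, n'; split=> //; apply: le_trans le; rewrite lerD2l.
rewrite ler_pM2l// lez_nat leqNgt; apply/negP => /min'; exact.
Qed.

Lemma bern_subspace i : subspace (bern i). Proof. exact: kspan_subspace. Qed.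

Lemma bern_mono i j d : (i <= j)%N -> bern i d -> bern j d.
Proof.
move=> ij; apply: kspan_mono => {}d [e [n [he hn le]]]; exists e, n; split=> //.
exact: le_trans le _.
Qed.

Lemma homogeneous_dmul j r : gr j r -> homogeneous gr (dmul r) j.
Proof.
move=> gr_r k y gy; rewrite -PoszD -[endo_apply _ _]/(r * y) mulrC /=.
exact: grading_mul.
Qed.

Lemma bern_dmul s r : gr_le grR s r -> bern s (dmul r).
Proof.
move=> /gr_le_sum->; rewrite linear_sum; apply: subspace_sum (bern_subspace _) _ => i _.
apply: sub_kspan; exists (i : nat)%:Z, 0%N; split.
- by apply: homogeneous_dmul; apply: gpr_gr.
- exact: diff_le_mulop.
- by rewrite mulr0 addr0 lez_nat -ltnS.
Qed.

Lemma bern1 s : bern s 1.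
Proof. by rewrite -dmul1; apply: bern_dmul; apply: gr_le1. Qed.

Lemma homogeneousM d d' e e' : homogeneous gr d e -> homogeneous gr d' e' ->
  homogeneous gr (d * d') (e + e').
Proof.
move=> h h' j y gy; rewrite -[endo_apply _ _]/(val d @@ (val d' @@ y)).
rewrite [e + e']addrC addrA; have := h' j y gy; case: (_ + e') => [k /h//|k /= ->].
rewrite linear0; case: (_ + e) => //= l; exact: subspace0 (gr_subspace grR l).
Qed.

Lemma bernM i j d d' : bern i d -> bern j d' -> bern (i + j) (d * d').
Proof.
move=> [n [c [u [hu ->]]]] [n' [c' [u' [hu' ->]]]].
rewrite mulr_suml; apply: subspace_sum (bern_subspace _) _ => k _.
rewrite mulr_sumr; apply: subspace_sum (bern_subspace _) _ => l _.
rewrite -scalerAl -scalerAr; do 2 apply: subspaceZ (bern_subspace _) _.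
apply: sub_kspan; have [e [o [he ho le]]] := hu k; have [e' [o' [he' ho' le']]] := hu' l.
exists (e + e'), (o + o')%N; split; [exact: homogeneousM|exact: diff_leM|].
by rewrite !PoszD mulrDr addrACA lerD.
Qed.

Lemma bern_exhaustive d : exists c, bern c d.
Proof.
have [n dn] := diffop_ex d.
have [N hN] := hcomp_bounded grR xg gr0 dn.
have dop i : is_diffop (hcomp grR (i%:Z - N%:Z) (val d)).
  by apply/asboolP; exists n; apply: diff_le_hcomp.
have -> : d = \sum_(i < (N + N).+1) Diffop (dop i).
  by apply: diffop_ext => y; rewrite dapp_sum /dapp {1}(hcomp_sum hN) endo_sumE.
exists (N + w.+1 * n)%N; apply: subspace_sum (bern_subspace _) _ => i _.
apply: sub_kspan; exists (i%:Z - N%:Z), n; split.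
- by move=> j y gy; apply: hcomp_grint.
- exact: diff_le_hcomp.
- by rewrite PoszD PoszM lerD2r; have := ltn_ord i; lia.
Qed.

(** A commutator with a generator lowers the order by one and raises the degree by at most [w], and
    an operator of negative degree kills 1. So the degree of a nonzero operator is bounded below in
    terms of its order. *)
Lemma homogeneous_order d e n : homogeneous gr d e -> diff_le n (val d) ->
  e + w%:Z * n%:Z < 0 -> d = 0.
Proof.
have g1 : gr 0%N 1 by rewrite -[1]scale1r; apply: gr0_scalar.
have one d' e' : homogeneous gr d' e' -> e' < 0 -> val d' @@ 1 = 0.
  by move=> /(_ 0%N 1 g1); rewrite add0r; case: e'.
move=> he hn lt; apply: val_inj; rewrite -[val 0]/(0 : endo R).
have gd (d' : endo R) : diff_le n d' -> exists d'' : diffop R, val d'' = d'.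
  move=> h; have h' : is_diffop d' by apply/asboolP; exists n.
  by exists (Diffop h').
elim: n d e he hn lt {gd} => [|n IHn] d e he hn lt.
  move: hn (one _ _ he); rewrite mulr0 addr0 in lt.
  move=> [r E] /(_ lt); rewrite E -[_ @@ 1]/(r * 1) mulr1.
  by move=> r0; rewrite r0 mulop0.
rewrite [val d](comm_op_gen (ggen_gen xg)) => [|i].
  by rewrite (one _ _ he) ?mulop0//; move: lt; nia.
have /andP[_ dw] := ggen_deg xg i.
have dop : is_diffop (comm_op (val d) (x i)) by apply/asboolP; exists n; apply: hn.
apply: (IHn (Diffop dop) (e + (dg i)%:Z)); [|exact: hn|by move: lt; nia].
move=> j y gy; rewrite -[endo_apply _ _]/(val d @@ (x i * y) - x i * (val d @@ y)).
have hx := ggen_gr xg i.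
have h1 := he _ _ (grading_mul grR hx gy); have h2 := he _ _ gy.
have E : (dg i + j)%N%:Z + e = j%:Z + (e + (dg i)%:Z) by lia.
rewrite E in h1; move: h1; case E1 : (_ + (_ + _)) => [k|k] /= h1.
  apply: subspaceB (gr_subspace grR k) h1 _; move: h2.
  case E2 : (_ + _) => [l|l] /= => [hl|->]; last first.
    by rewrite mulr0; apply: subspace0 (gr_subspace grR k).
  have kl : k = (dg i + l)%N by lia.
  by rewrite kl; exact: (grading_mul grR hx hl).
rewrite h1 sub0r; move: h2; case E2 : (_ + _) => [l|l] /=; first by lia.
by move=> ->; rewrite mulr0 oppr0.
Qed.

(** A nonzero homogeneous operator has [e + w * n >= 0], while step [t] demands [e + w.+1 * n <= t];
    the difference is [n <= t]. This is where the slope exceeding the generator degrees matters. *)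
Lemma bern_order t d : bern t d -> diff_le t (val d).
Proof.
have sub : subspace [set d : diffop R | diff_le t (val d)].
  by split=> [|k d' d'']; [exact: diff_le0|exact: diff_le_linear].
apply: (kspan_le sub) => {}d [e [n [he hn le]]] /=.
have [lt|ge] := ltP (e + w%:Z * n%:Z) 0.
  by rewrite (homogeneous_order he hn lt); apply: diff_le0.
by apply: diff_leW hn; move: le ge; nia.
Qed.

Lemma bern_app s t d y : bern t d -> gr_le grR s y -> gr_le grR (s + t) (dapp d y).
Proof.
move=> dt /gr_le_sum->; rewrite linear_sum.
apply: subspace_sum (gr_le_subspace _ _) _ => i _ /=.
have sub : subspace [set d : diffop R | gr_le grR (s + t) (dapp d (gpr grR i y))].
  split=> [|k d' d'' h h'] /=; first by rewrite dapp0; apply: subspace0 (gr_le_subspace _ _).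
  by rewrite dappD dappZ; apply: (gr_le_subspace _ _).2.
move: d dt; apply: (kspan_le sub) => d [e [n [he hn le]]] /=.
have := he _ _ (gpr_gr grR i y); case E : (_ + _) => [k|k] /=; last first.
  by rewrite /dapp => ->; apply: subspace0 (gr_le_subspace _ _).
by apply: gr_gr_le; have := ltn_ord i; move: le; nia.
Qed.

Lemma bern_app1 t d : bern t d -> gr_le grR t (dapp d 1).
Proof. by move=> dt; apply: (@bern_app 0 _ d 1 dt); apply: gr_le1. Qed.

Definition wt (a : 'I_m -> nat) := (\sum_i dg i * a i)%N.

Lemma monom_gr a : gr (wt a) (monom x a).
Proof.
have g1 : gr 0%N 1 by rewrite -[1]scale1r; apply: gr0_scalar.
have grX i n : gr (dg i * n)%N (x i ^+ n).
  elim: n => [|n IHn]; first by rewrite muln0 expr0.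
  by rewrite exprS mulnS; apply: grading_mul => //; exact: ggen_gr xg i.
rewrite /monom /wt; elim/big_rec2: _ => // i y z _ gy; exact: grading_mul.
Qed.

Lemma gr_le_monom s y : gr_le grR s y -> kspan [set monom x a | a in [set a | (wt a <= s)%N]] y.
Proof.
move=> /gr_le_sum->; move: y; set S := [set _ | _ in _].
suff h : kspan (range (monom x)) `<=` [set y | kspan S (\sum_(j < s.+1) gpr grR j y)].
  by move=> y; apply: h; apply: monom_span (ggen_gen xg) _.
apply: kspan_le.
  split=> [|k y z hy hz] /=.
    by rewrite big1 => [|i _]; [exact: subspace0 (kspan_subspace _)|exact: linear0].
  under eq_bigr do rewrite gpr_linear.
  by rewrite big_split -scaler_sumr; apply: (kspan_subspace _).2.
move=> _ [a _ <-] /=; under eq_bigr do rewrite (gpr_hom grR _ (monom_gr a)).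
rewrite -big_mkcond /=; have [le|lt] := leqP (wt a) s.
  rewrite (big_pred1 (Ordinal (le : (wt a < s.+1)%N))); last by [].
  by apply: sub_kspan; exists a.
rewrite big_pred0; first exact: subspace0 (kspan_subspace _).
by move=> i; rewrite ltn_eqF// (leq_trans (ltn_ord i)).
Qed.

Lemma wt_ge a i : (a i <= wt a)%N.
Proof.
rewrite /wt (bigD1 i)//= (leq_trans _ (leq_addr _ _))// leq_pmull//.
by case/andP: (ggen_deg xg i).
Qed.

Definition boxf n (a : {ffun 'I_m -> 'I_n}) (i : 'I_m) : nat := a i.

Lemma gr_le_box s y : gr_le grR s y -> exists c : {ffun 'I_m -> 'I_s.+1} -> K,
  y = \sum_a c a *: monom x (boxf a).
Proof.
move=> /gr_le_monom h; apply: kspan_finP; move: h; apply: kspan_mono => _ [a /= le <-].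
exists [ffun i => inord (a i)] => //; apply: eq_bigr => i _.
by rewrite /boxf ffunE inordK// ltnS (leq_trans (wt_ge a i)).
Qed.

Lemma wt_box t (a : 'I_m -> nat) : (forall i, (a i <= t)%N) -> (wt a <= m * w * t)%N.
Proof.
move=> at_; rewrite /wt -mulnA -[X in (_ <= X * _)%N]card_ord -sum_nat_const leq_sum// => i _.
by rewrite leq_mul//; case/andP: (ggen_deg xg i).
Qed.

(** Step [t] embeds in the maps from monomials with exponents at most [t] to elements of degree at
    most [N], which are again combinations of boundedly many monomials. The two index sets give the
    exponent [m + m]. *)
Lemma bern_dim t k (v : 'I_k -> diffop R) : (forall i, bern t (v i)) ->
  free_mod [set 0] v -> (k <= ((m * w).+2 * t.+1) ^ (m + m))%N.
Proof.
(* A monomial with exponents at most [t] has degree at most [m * w * t], and step [t] raises degrees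
   by at most [t]. *)
move=> bv fv; pose N := (m * w * t + t)%N.
have /choice[c hc] : forall p : 'I_k * {ffun 'I_m -> 'I_t.+1},
    exists c : {ffun 'I_m -> 'I_N.+1} -> K,
    dapp (v p.1) (monom x (boxf p.2)) = \sum_a c a *: monom x (boxf a).
  move=> [i a] /=; apply: gr_le_box; apply: bern_app => //.
  apply: gr_gr_le _ (monom_gr _); apply: wt_box => j; rewrite -ltnS; exact: ltn_ord.
rewrite leqNgt; apply/negP => lt.
pose J := ({ffun 'I_m -> 'I_t.+1} * {ffun 'I_m -> 'I_N.+1})%type.
have cardJ : (#|{: J}| < #|'I_k|)%N.
  rewrite card_prod !card_ffun !card_ord; apply: leq_ltn_trans lt.
  rewrite expnD leq_mul//.
    by case: (m) => // m'; rewrite leq_exp2r// leq_pmull.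
  by case: (m) @N {c hc J} => // m' N; rewrite leq_exp2r// /N; nia.
have [e [i ei] he] := nontrivial_relation (fun i (j : J) => c (i, j.1) j.2) cardJ.
suff : [set 0] (\sum_i e i *: v i) by move=> /fv/(_ i) e0; rewrite e0 eqxx in ei.
have bs : bern t (\sum_i e i *: v i).
  by apply: subspace_sum (bern_subspace _) _ => j _; apply: subspaceZ (bern_subspace _) _.
rewrite /=; set d := \sum_i _ in bs *; apply: val_inj; rewrite -[val 0]/(0 : endo R).
apply: (diff_le_monom_eq0 (ggen_gen xg) (bern_order bs)) => a at_.
pose a' : {ffun 'I_m -> 'I_t.+1} := [ffun i => inord (a i)].
have -> : monom x a = monom x (boxf a').
  by apply: eq_bigr => j _; rewrite /boxf ffunE inordK// ltnS.
rewrite -[_ @@ _]/(dapp d (monom x (boxf a'))) dapp_sum.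
under eq_bigr do rewrite dappZ (hc (_, a')) scaler_sumr.
rewrite exchange_big big1// => b _; under eq_bigr do rewrite scalerA.
by rewrite -scaler_suml (he (a', b)) scale0r.
Qed.

End BernsteinFiltration.

(** A slope [z <= 0] leaves no elements to generate [R], so [R = K], every operator has order 0, and
    the slope has no influence. *)
Lemma bern_slope_le0 (K : fieldType) (R : comAlgType K) (gr : nat -> set R) (z : int) :
  z <= 0 -> bernstein_slope gr z ->
  bernstein_slope gr 1 /\ bernstein_filtration gr z = bernstein_filtration gr 1.
Proof.
move=> z0 hz; have sc (r : R) : exists k : K, r = k%:A.
  have : alg_gen [set x : R | exists2 j : nat, j%:Z < z & gr j x] r by rewrite hz.
  apply: (@alg_gen_le _ _ _ [set r : R | exists k : K, r = k%:A]).
    split=> /=; first by exists 1; rewrite scale1r.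
    - split=> [|k _ _ [a ->] [b ->]]; first by exists 0; rewrite scale0r.
      by exists (k * a + b); rewrite scalerDl scalerA.
    - by move=> _ _ [a ->] [b ->]; exists (a * b); rewrite -scalerAl mul1r scalerA.
  by move=> y [j jz _]; lia.
have ord0 (d : diffop R) n : has_order d n -> n = 0%N.
  move=> [_ h]; case: n h => // n /(_ 0%N isT)[].
  exists (dapp d 1); apply: comm_op_eq0_mulop => r; have [k ->] := sc r.
  by apply: endo_ext => y; rewrite comm_opE -!scalerAl !mul1r linearZ subrr.
split.
  apply/seteqP; split=> // r _ B [/subalgebraP[B1 Bs _] _].
  by have [k ->] := sc r; apply: subspaceZ.
apply/funext => i; apply/seteqP; split; apply: kspan_mono => d [e [n [he hn le]]];
  exists e, n; split=> //; move: le; rewrite (ord0 _ _ hn) !mulr0//.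
Qed.

(** * The enveloping algebra and its action *)

Section TensorLift.
Variables (K : fieldType) (A B : algType K) (V : lmodType K) (phi : A -> B -> V).
Hypothesis phiB : bilin phi.

Definition tensor_lift (r : tensor A B) : V := tensor_ev phi (repr r).

Lemma tensor_lift_pi (s : seq (A * B)) :
  tensor_lift (\pi_(tensor A B) s) = tensor_ev phi s.
Proof. exact: tensor_ev_repr. Qed.

Lemma tensor_lift_tmul a b : tensor_lift (tmul a b) = phi a b.
Proof. by rewrite tensor_lift_pi /tensor_ev big_seq1. Qed.

Lemma tensor_lift_linear : linear tensor_lift.
Proof.
move=> k r s; elim/quotW: r => r; elim/quotW: s => s.
rewrite -[_ + _]/(tensor_add (tensor_scale k _) _) tensor_scaleE tensor_addE.
by rewrite !tensor_lift_pi tensor_ev_cat tensor_ev_scale.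
Qed.

End TensorLift.

Section EnvelopingAction.
Variables (K : fieldType) (A : algType K).
Implicit Types (r s : enveloping A) (v a b : A).

Definition sandwich v (a : A) (b : A^c) : A := a * v * (b : A).

Lemma sandwich_bilin v : bilin (sandwich v).
Proof.
split=> c k a b; rewrite /sandwich; first by rewrite mulrDr scalerAr.
by rewrite !mulrDl -!scalerAl.
Qed.

Definition act r v : A := tensor_lift (sandwich v) r.

Definition otimes (a b : A) : enveloping A := tmul a (b : A^c).

Lemma act_otimes a b v : act (otimes a b) v = a * v * b.
Proof. by rewrite /act tensor_lift_tmul//; apply: sandwich_bilin. Qed.

Lemma act_linear_l k r s v : act (k *: r + s) v = k *: act r v + act s v.
Proof. exact: (tensor_lift_linear (sandwich_bilin v)). Qed.

Lemma act_linear r : linear (act r).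
Proof.
move=> k u v; rewrite /act /tensor_lift /tensor_ev scaler_sumr -big_split; apply: eq_bigr => p _.
by rewrite /sandwich mulrDr -scalerAr mulrDl -scalerAl.
Qed.
HB.instance Definition _ r := GRing.isLinear.Build K A A *:%R (act r) (act_linear r).

Lemma act0l v : act 0 v = 0.
Proof. by have := act_linear_l (-1) 0 0 v; rewrite scaler0 addr0 scaleN1r addNr. Qed.

Lemma actDl r s v : act (r + s) v = act r v + act s v.
Proof. by rewrite -[r]scale1r act_linear_l !scale1r. Qed.

Lemma actZl k r v : act (k *: r) v = k *: act r v.
Proof. by rewrite -[k *: r]addr0 act_linear_l act0l addr0. Qed.

Lemma actBl r s v : act (r - s) v = act r v - act s v.
Proof. by rewrite actDl -scaleN1r actZl scaleN1r. Qed.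

Lemma act_suml I (t : seq I) (P : pred I) (F : I -> enveloping A) v :
  act (\sum_(i <- t | P i) F i) v = \sum_(i <- t | P i) act (F i) v.
Proof.
by elim/big_rec2: _ => [|i y d _ <-]; [exact: act0l|rewrite actDl].
Qed.

Lemma otimes_linear_l b : linear (otimes^~ b). Proof. exact: (tmul_bilin A A^c).2. Qed.
Lemma otimes_linear_r a : linear (otimes a). Proof. exact: (tmul_bilin A A^c).1. Qed.
HB.instance Definition _ a :=
  GRing.isLinear.Build K A (enveloping A) *:%R (otimes a) (otimes_linear_r a).

Lemma otimes0l b : otimes 0 b = 0.
Proof. by have := otimes_linear_l b (-1) 0 0; rewrite scaler0 addr0 scaleN1r addNr. Qed.

Lemma otimesZl k a b : otimes (k *: a) b = k *: otimes a b.
Proof. by rewrite -[k *: a]addr0 otimes_linear_l otimes0l addr0. Qed.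

Lemma otimesM a b a' b' : otimes a b * otimes a' b' = otimes (a * a') (b' * b).
Proof. exact: tmulM. Qed.

Lemma otimes_span r : kspan [set otimes p.1 p.2 | p in [set: A * A]] r.
Proof.
elim/quotW: r; elim=> [|[a b] r IHr].
  exact: subspace0 (kspan_subspace _).
have -> : \pi_(tensor A A^c) ((a, b) :: r) = (otimes a b + \pi_(tensor A A^c) r : enveloping A).
  by rewrite -[RHS]/(tensor_add (tmul a (b : A^c)) _) /tmul tensor_addE.
apply: subspaceD (kspan_subspace _) _ IHr.
by apply: sub_kspan; exists (a, b).
Qed.

Lemma env_ind (Q : set (enveloping A)) : subspace Q -> (forall a b, Q (otimes a b)) ->
  forall r, Q r.
Proof. by move=> hQ h r; apply: (kspan_le hQ _ (otimes_span r)) => _ [p _ <-]. Qed.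

Lemma actM r s v : act (r * s) v = act r (act s v).
Proof.
move: r; apply: (@env_ind [set r | act (r * s) v = act r (act s v)]).
  split=> [|k r r' hr hr'] /=; first by rewrite mul0r !act0l.
  by rewrite mulrDl -scalerAl !act_linear_l hr hr'.
move=> a b /=; move: s; apply: (@env_ind [set s | _ = act _ (act s v)]).
  split=> [|k r r' hr hr'] /=; first by rewrite mulr0 !act0l linear0.
  by rewrite mulrDr -scalerAr !act_linear_l hr hr' linearP.
by move=> a' b' /=; rewrite otimesM !act_otimes !mulrA.
Qed.

Lemma act1 v : act 1 v = v.
Proof. by rewrite -[1]/(otimes 1 1) act_otimes mul1r mulr1. Qed.

End EnvelopingAction.

Section BoxFiltration.
Variables (K : fieldType) (A : algType K) (F : nat -> set A).
Hypotheses (Fsub : forall i, subspace (F i))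
  (Fmono : forall i j a, (i <= j)%N -> F i a -> F j a)
  (F1 : F 0%N 1)
  (FM : forall i j a b, F i a -> F j b -> F (i + j)%N (a * b)).

Let box := box_filtration F.

Lemma box_subspace i : subspace (box i). Proof. exact: kspan_subspace. Qed.

Lemma box_otimes i a b : F i a -> F i b -> box i (otimes a b).
Proof. by move=> Fa Fb; apply: sub_kspan; exists a, b. Qed.

Lemma box_mono i j r : (i <= j)%N -> box i r -> box j r.
Proof.
move=> ij; apply: kspan_mono => _ [a [b [Fa Fb ->]]].
by exists a, b; split=> //; [exact: Fmono Fa|exact: Fmono Fb].
Qed.

Lemma box1 i : box i 1.
Proof. by apply: box_mono (leq0n i) _; apply: box_otimes. Qed.

Lemma boxM i j r s : box i r -> box j s -> box (i + j) (r * s).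
Proof.
move=> [n [c [u [hu ->]]]] [n' [c' [u' [hu' ->]]]].
rewrite mulr_suml; apply: subspace_sum (box_subspace _) _ => k _.
rewrite mulr_sumr; apply: subspace_sum (box_subspace _) _ => l _.
rewrite -scalerAl -scalerAr; do 2 apply: subspaceZ (box_subspace _) _.
have [a [b [Fa Fb ->]]] := hu k; have [a' [b' [Fa' Fb' ->]]] := hu' l.
by rewrite otimesM; apply: box_otimes; [exact: FM|rewrite addnC; exact: FM].
Qed.

Lemma act_box i t r v : box i r -> F t v -> F (i + t + i) (act r v).
Proof.
move=> [n [c [u [hu ->]]]] Fv; rewrite act_suml.
apply: subspace_sum (Fsub _) _ => k _; rewrite actZl; apply: subspaceZ (Fsub _) _.
have [a [b [Fa Fb ->]]] := hu k; rewrite act_otimes.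
by apply: FM => //; apply: FM.
Qed.

(** The span of two-sided products becomes a single tensor, so that successive reductions compose by
    multiplication. *)
Lemma linearly_simpleP : linearly_simple F <->
  exists C, forall t r, F t r -> r != 0 -> exists2 e, box (C * t) e & act e r = 1.
Proof.
split=> -[C h]; exists C => t r Fr r0.
  have [n [c [u [hu ->]]]] := h t r Fr r0.
  have /choice[e he] i : exists e, box (C * t) e /\ act e r = u i.
    have [a [b [Fa Fb ->]]] := hu i; exists (otimes a b).
    by rewrite act_otimes; split=> //; apply: box_otimes.
  exists (\sum_i c i *: e i).
    by apply: subspace_sum (box_subspace _) _ => i _; apply: subspaceZ (box_subspace _) (he i).1.
  by rewrite act_suml; apply: eq_bigr => i _; rewrite actZl (he i).2.
have [e [n [c [u [hu ->]]]] <-] := h t r Fr r0.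
rewrite act_suml; apply: subspace_sum (kspan_subspace _) _ => i _; rewrite actZl.
apply: subspaceZ (kspan_subspace _) _; have [a [b [Fa Fb ->]]] := hu i.
by apply: sub_kspan; exists a, b; rewrite act_otimes.
Qed.

(** Level [i] of the two-sided ideal generated by [v]. *)
Definition orb i v : set A := [set act r v | r in box i].

Lemma orb_subspace i v : subspace (orb i v).
Proof.
split=> [|k _ _ [r hr <-] [s hs <-]].
  by exists 0; [exact: subspace0 (box_subspace i)|rewrite act0l].
by exists (k *: r + s); [apply: (box_subspace i).2|rewrite act_linear_l].
Qed.

Lemma orb_mono i j v : (i <= j)%N -> orb i v `<=` orb j v.
Proof. by move=> ij _ [r hr <-]; exists r => //; apply: box_mono hr. Qed.

Lemma orb_act i j r v u : box i r -> orb j v u -> orb (i + j) v (act r u).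
Proof. by move=> hr [s hs <-]; exists (r * s); rewrite ?actM//; apply: boxM. Qed.

Lemma orb_trans i j v u : orb i v u -> orb j u `<=` orb (j + i) v.
Proof. by move=> h _ [r hr <-]; apply: orb_act. Qed.

End BoxFiltration.

(** * Reduction of operators to functions by commutators *)

Section CommutatorReduction.
Variables (K : fieldType) (R : comAlgType K) (gr : nat -> set R).
Hypotheses (grR : is_grading gr) (gr0 : gr 0%N = range (fun k : K => k%:A)).
Variables (w m : nat) (x : 'I_m -> R) (dg : 'I_m -> nat).
Hypothesis xg : graded_generators gr w x dg.

Let D := diffop R.
Let B : nat -> set D := bern gr w.
Let box := box_filtration B.

Definition adm (r : R) : enveloping D := otimes 1 (dmul r) - otimes (dmul r) 1.

Lemma act_adm r (d : D) : act (adm r) d = d * dmul r - dmul r * d.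
Proof. by rewrite actBl !act_otimes !mul1r !mulr1. Qed.

Lemma box_adm s r : gr_le grR s r -> box s (adm r).
Proof.
move=> hr; apply: subspaceB; first exact: box_subspace.
  by apply: box_otimes; [exact: bern1|exact: bern_dmul hr].
by apply: box_otimes; [exact: bern_dmul hr|exact: bern1].
Qed.

(** Either a commutator with some generator is nonzero on some member, and applying it to all
    members lowers every order bound, or all members are multiplications already. One tensor must
    serve the whole family, because in (2) it acts on all coefficients of an element of D (x) D^op
    at once. *)
Lemma commutator_reduction t k (a : 'I_k -> D) : (forall i, B t (a i)) ->
  (exists i, a i != 0) ->
  exists2 e, box (w * t) e & exists2 g : 'I_k -> R, (exists i, g i != 0) &
    forall i, act e (a i) = dmul (g i).
Proof.
move=> Ba; have {Ba} oa i : diff_le t (val (a i)) by exact: (bern_order grR gr0 xg (Ba i)).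
elim: t a oa => [|t IHt] a oa [i0 ai0].
  exists 1; first by apply: box1 => //; [exact: bern_mono|exact: bern1].
  have /choice[g hg] i := oa i; exists g => [|i]; last by rewrite act1; apply: val_inj; rewrite hg.
  exists i0; apply: contra_neq ai0 => g0; apply: val_inj.
  by rewrite hg g0 mulop0.
have [[i [j aij]]|h] := pselect (exists i j, act (adm (x j)) (a i) != 0); last first.
  exists 1; first by apply: box1 => //; [exact: bern_mono|exact: bern1].
  have ag i : a i = dmul (dapp (a i) 1).
    apply: val_inj; apply: (comm_op_gen (ggen_gen xg)) => j.
    have : act (adm (x j)) (a i) = 0.
      by apply/eqP/negPn/negP => aij; apply: h; exists i, j.
    by rewrite act_adm => /(congr1 val).
  exists (fun i => dapp (a i) 1) => [|i]; last by rewrite act1.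
  by exists i0; apply: contra_neq ai0 => g0; rewrite ag g0 linear0.
have [| |e he [g hg eg]] := IHt (fun i => act (adm (x j)) (a i)).
- by move=> i'; rewrite act_adm; exact: (oa i').
- by exists i.
exists (e * adm (x j)); last by exists g => // i'; rewrite actM.
rewrite mulnS addnC; apply: boxM => //; first by move=> *; apply: bernM.
apply: box_adm; apply: gr_gr_le (ggen_gr xg j); first by case/andP: (ggen_deg xg j).
Qed.

End CommutatorReduction.

(** * Zorn's lemma and linear functionals *)

(** Zorn's lemma is applied to the property that the union of [X] and [W0] satisfies [P]; the empty
    chain is then harmless, because [P W0] holds. *)
Lemma zorn_above (T : Type) (P : set (set T)) (W0 : set T) : P W0 ->
  (forall F : set (set T), F !=set0 -> F `<=` P -> total_on F subset ->
    P (\bigcup_(X in F) X)) ->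
  exists W, [/\ P W, W0 `<=` W & forall W', P W' -> W `<=` W' -> W' = W].
Proof.
move=> PW0 hP; have [|A [PA maxA]] := @Zorn_bigcup T [set X | P (X `|` W0)].
  move=> F FP Ftot; rewrite /=; have [[X0 FX0]|/forallNP F0] := pselect (exists X, F X); last first.
    by rewrite (_ : _ `|` _ = W0)//; apply/seteqP; split=> [x [[X /F0]|]//|x]; right.
  rewrite (_ : _ `|` _ = \bigcup_(Y in [set X `|` W0 | X in F]) Y).
    apply: hP.
    - by exists (X0 `|` W0); exists X0.
    - by move=> _ [X FX <-]; apply: FP.
    - move=> _ _ [X FX <-] [Y FY <-].
      by case: (Ftot X Y FX FY) => h; [left|right]; apply: setSU.
  apply/seteqP; split=> [x [[X FX Xx]|W0x]|x [_ [X FX <-] [Xx|W0x]]].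
  - by exists (X `|` W0); [exists X|left].
  - by exists (X0 `|` W0); [exists X0|right].
  - by left; exists X.
  - by right.
exists (A `|` W0); split=> // W' PW' AW'.
apply/seteqP; split=> // x W'x; apply: contrapT => nx.
apply: (maxA W'); last first.
  rewrite /= (_ : W' `|` W0 = W')//; apply/seteqP; split=> [y [//|W0y]|y]; last by left.
  by apply: AW'; right.
split=> [y Ay|h]; first by apply: AW'; left.
by apply: nx; left; apply: h.
Qed.

Section DualFunctional.
Variables (K : fieldType) (V : lmodType K).

(** A subspace maximal among those that contain the other vectors and avoid [v i] has codimension
    one; the functional reads off the coefficient of [v i] modulo it. *)
Lemma dual_functional n (v : 'I_n -> V) (i : 'I_n) : free_mod [set 0] v ->
  exists l : V -> K, (forall k x y, l (k *: x + y) = k * l x + l y) /\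
    forall j, l (v j) = (j == i)%:R.
Proof.
move=> fv; pose W0 := kspan [set v j | j in [set j | j != i]].
have sW0 : subspace W0 by exact: kspan_subspace.
have nW0 : ~ W0 (v i).
  move=> [k [c [u [hu e]]]].
  have [d [di hd]] : exists d : 'I_n -> K, d i = 0 /\ v i = \sum_j d j *: v j.
    rewrite e; suff : [set x | exists d : 'I_n -> K, d i = 0 /\ x = \sum_j d j *: v j]
      (\sum_(l < k) c l *: u l) by [].
    apply: subspace_sum => [|l _].
      split=> [|b _ _ [d [d0 ->]] [d' [d0' ->]]].
        by exists (fun _ => 0); split=> //; rewrite big1// => j _; rewrite scale0r.
      exists (fun j => b * d j + d' j); rewrite d0 d0' mulr0 addr0; split=> //.
      by rewrite scaler_sumr -big_split; apply: eq_bigr => j _; rewrite scalerDl scalerA.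
    have [j ji <-] := hu l; exists (fun j' => c l * (j' == j)%:R).
    rewrite (negbTE (_ : i != j)) ?mulr0; last by rewrite eq_sym.
    split=> //; rewrite (bigD1 j)//= eqxx mulr1 big1 ?addr0// => j' /negbTE->.
    by rewrite mulr0 scale0r.
  have : [set 0] (\sum_j (d j - (j == i)%:R) *: v j).
    rewrite /=; under eq_bigr do rewrite scalerBl.
    rewrite sumrB -hd (bigD1 i)//= eqxx scale1r big1 ?addr0 ?subrr// => j /negbTE->.
    by rewrite scale0r.
  by move=> /fv/(_ i); rewrite di eqxx sub0r => /eqP; rewrite oppr_eq0 oner_eq0.
have [|F F0 FP Ftot|W [[sW nW] W0W Wmax]] :=
    @zorn_above V [set W | subspace W /\ ~ W (v i)] W0.
- by [].
- split; last by move=> [X FX Xv]; have [_] := FP X FX; apply.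
  have [X0 FX0] := F0; split.
    by exists X0 => //; have [[]] := FP _ FX0.
  move=> k x y [X FX Xx] [Y FY Yy].
  case: (Ftot X Y FX FY) => h.
    by exists Y => //; have [[_ hY] _] := FP Y FY; apply: hY => //; apply: h.
  by exists X => //; have [[_ hX] _] := FP X FX; apply: hX => //; apply: h.
have dec x : exists k, W (x - k *: v i).
  apply: contrapT => /forallNP nx.
  pose W' := [set y | exists k, W (y - k *: x)].
  suff W'E : W' = W.
    apply: (nx 0); rewrite scale0r subr0 -W'E.
    by exists 1; rewrite scale1r subrr; apply: subspace0.
  apply: Wmax; last by move=> y Wy; exists 0; rewrite scale0r subr0.
  split.
    split=> [|b y z [k hk] [k' hk']]; first by exists 0; rewrite scale0r subr0; apply: subspace0.
    exists (b * k + k'); rewrite scalerDl opprD addrACA -scalerA -scalerBr.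
    exact: sW.2.
  move=> [k hk]; have [k0|k0] := eqVneq k 0; first by rewrite k0 scale0r subr0 in hk.
  apply: (nx k^-1); rewrite -opprB; apply: subspaceN => //.
  by have := subspaceZ k^-1 sW hk; rewrite scalerBr scalerA mulVf// scale1r.
have uniq x k k' : W (x - k *: v i) -> W (x - k' *: v i) -> k = k'.
  move=> h h'; apply: contrapT => /eqP kk'; apply: nW.
  have := subspaceB sW h' h; rewrite opprB addrC addrA subrK -scalerBl => h2.
  have := subspaceZ (k - k')^-1 sW h2.
  by rewrite scalerA mulVf ?scale1r// subr_eq0.
exists (fun x => projT1 (cid (dec x))); split=> [k x y|j].
  case: cid => a /= ha; case: cid => b /= hb; case: cid => c /= hc.
  apply: (uniq _ _ _ ha); have := sW.2 k _ _ hb hc.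
  by rewrite scalerBr addrACA -opprD scalerA -scalerDl.
case: cid => a /= ha; apply: (uniq _ _ _ ha); case: eqP => [->|/eqP ji].
  by rewrite scale1r subrr; apply: subspace0.
by rewrite scale0r subr0; apply: W0W; apply: sub_kspan; exists j.
Qed.

End DualFunctional.

(** The product of two dual functionals is bilinear, hence defines a functional on the tensor
    product, and it isolates the coefficient at [(i, j)]. *)
Lemma otimes_free (K : fieldType) (A : algType K) n (v : 'I_n -> A)
    (c : 'I_n * 'I_n -> K) : free_mod [set 0] v ->
  \sum_p c p *: otimes (v p.1) (v p.2) = 0 -> forall p, c p = 0.
Proof.
move=> fv e [i j].
have [l [ll lv]] := dual_functional i fv; have [l' [ll' lv']] := dual_functional j fv.
pose phi (a : A) (b : A^c) : K^o := l a * l' b.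
have phiB : bilin phi.
  split=> x k u y; rewrite /phi.
    by rewrite [l' _]ll' mulrDr mulrCA.
  by rewrite ll mulrDl -mulrA.
pose L := GRing.isLinear.Build K (tensor A A^c) K^o *:%R _ (tensor_lift_linear phiB).
pose F : {linear tensor A A^c -> K^o} := HB.pack (tensor_lift phi) L.
have FE k (a b : A) : F (k *: otimes a b) = k * (l a * l' b).
  by rewrite linearZ -[F (otimes a b)]/(tensor_lift phi (tmul a (b : A^c))) tensor_lift_tmul.
have : \sum_p c p * (l (v p.1) * l' (v p.2)) = 0 :> K.
  rewrite -[RHS](linear0 F) -e linear_sum; apply: eq_bigr => p _; exact/esym/FE.
rewrite (bigD1 (i, j))//= big1 => [|[i' j'] ne].
  by rewrite addr0 !lv !lv' !eqxx !mulr1.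
rewrite lv lv'; move: ne; rewrite xpair_eqE negb_and.
by move=> /orP[/negbTE->|/negbTE->]; rewrite ?mul0r !mulr0.
Qed.

(** * Moving a power past an operator *)

Section CommutationFormula.
Variable A : nzRingType.

Definition adl (a b : A) := a * b - b * a.

Lemma expr_comm (a b : A) N : a ^+ N * b =
  \sum_(k < N.+1) (iter k (adl a) b * a ^+ (N - k)) *+ 'C(N, k).
Proof.
elim: N => [|N IHN].
  by rewrite big_ord1 !expr0 mul1r mulr1.
rewrite exprS -mulrA IHN mulr_sumr.
pose F k := iter k (adl a) b * a ^+ (N.+1 - k).
transitivity (\sum_(k < N.+1) F k.+1 *+ 'C(N, k) + \sum_(k < N.+1) F k *+ 'C(N, k)).
  rewrite -big_split; apply: eq_bigr => k _ /=; rewrite mulrnAr -mulrnDl.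
  congr (_ *+ _); rewrite /F subSS subSn -1?ltnS// exprS !mulrA -mulrDl.
  by congr (_ * _); rewrite /= /adl subrK.
rewrite [RHS]big_ord_recl [X in _ + X]big_ord_recl /= !bin0 addrCA; congr (_ + _).
rewrite [RHS](eq_bigr (fun k : 'I_N.+1 => F k.+1 *+ 'C(N, k) + F k.+1 *+ 'C(N, k.+1))); last first.
  by move=> k _; rewrite binS mulrnDr addrC.
rewrite big_split /=; congr (_ + _).
by rewrite big_ord_recr /= bin_small// mulr0n addr0.
Qed.

(** Nilpotency fixes the range of [k], so [N] enters only through binomial coefficients and the
    right factor [a ^+ (N - s)]. The dimension count and the interpolation both depend on this
    form. *)
Lemma expr_comm_nilp (a b : A) s N : iter s.+1 (adl a) b = 0 -> (s <= N)%N ->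
  a ^+ N * b = (\sum_(k < s.+1) (iter k (adl a) b * a ^+ (s - k)) *+ 'C(N, k)) * a ^+ (N - s).
Proof.
move=> z sN; rewrite expr_comm mulr_suml.
have z' k : (s.+1 <= k)%N -> iter k (adl a) b = 0.
  by move=> /subnK <-; rewrite iterD z; elim: (k - _)%N => //= l ->; rewrite /adl mulr0 mul0r subrr.
rewrite -(@big_ord_widen_zero _ (fun k => (iter k (adl a) b * a ^+ (N - k)) *+ 'C(N, k)) s.+1)//.
  apply: eq_bigr => k _; rewrite mulrnAl -mulrA -exprD; congr (_ * _ ^+ _ *+ _).
  by have := ltn_ord k; lia.
by move=> k /z'->; rewrite mul0r mul0rn.
Qed.

End CommutationFormula.

(** * Interpolation over the field of fractions *)

Section FractionDenominators.
Variable R : idomainType.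
Local Notation "x %:F" := (@FracField.tofrac R x).

Lemma frac_denominator (x : {fraction R}) : exists n d : R, d != 0 /\ x * d%:F = n%:F.
Proof.
elim/quotW: x => r; exists (frac r).1, (frac r).2; split; first exact: denom_ratioP.
unlock FracField.tofrac; rewrite -[LHS]FracField.pi_mul; apply/eqmodP.
rewrite /= FracField.equivfE /FracField.mulf.
rewrite !numden_Ratio ?oner_neq0 ?mulf_neq0 ?denom_ratioP ?oner_neq0//.
by rewrite !mulr1 mulrC.
Qed.

Lemma frac_common_denominator (T : finType) (x : T -> {fraction R}) :
  exists2 d : R, d != 0 & exists y : T -> R, forall t, x t * d%:F = (y t)%:F.
Proof.
have /choice[n /choice[d nd]] t := frac_denominator (x t).
exists (\prod_t d t); first by apply/prodf_neq0 => t _; have [] := nd t.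
exists (fun t => n t * \prod_(s | s != t) d s) => t.
by rewrite (bigD1 t)//= !rmorphM mulrA (nd t).2.
Qed.

End FractionDenominators.

Section NaturalPoints.
Variable K : fieldType.
Hypothesis charK0 : [pchar K] =i pred0.

Lemma natr_neq0 n : (0 < n)%N -> n%:R != 0 :> K.
Proof. by rewrite ((pcharf0P K).1 charK0) -lt0n. Qed.

Lemma natr_inj0 : injective (fun n : nat => n%:R : K).
Proof.
have h m n : (m <= n)%N -> m%:R = n%:R :> K -> m = n.
  move=> mn /eqP; rewrite eq_sym -subr_eq0 -natrB// ((pcharf0P K).1 charK0) subn_eq0.
  by move=> nm; apply/eqP; rewrite eqn_leq mn.
move=> m n e; case: (leqP m n) => [mn|/ltnW nm]; first exact: h.
by apply/esym; apply: h.
Qed.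

Lemma poly_natr_nonroot (p : {poly K}) : p != 0 ->
  exists N, forall n, (N <= n)%N -> p.[n%:R] != 0.
Proof.
move: {2}(size p) (leqnn (size p)) => s; elim: s p => [|s IHs] p ps p0.
  by rewrite leqn0 size_poly_eq0 (negbTE p0) in ps.
have [[n0 /factor_theorem[q pq]]|h] := pselect (exists n : nat, root p n%:R); last first.
  by exists 0%N => n _; apply/negP => pn; apply: h; exists n.
have q0 : q != 0 by apply: contra_neq p0 => q0; rewrite pq q0 mul0r.
have [|N hN] := IHs q _ q0.
  by move: ps; rewrite pq size_Mmonic ?monicXsubC// size_XsubC addnC.
exists (maxn N n0.+1) => n; rewrite geq_max => /andP[Nn n0n].
rewrite pq hornerM mulf_neq0 ?hN// hornerXsubC subr_eq0.
by apply/eqP => /natr_inj0 e; rewrite e ltnn in n0n.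
Qed.

(** Were the system unsolvable over the fraction field, a column [y] of the cokernel, cleared of
    denominators, would give [G y = 0] and [b y != 0]. But the polynomial [b y] vanishes at every
    point where the system is solvable, and it has only finitely many natural roots. *)
Lemma generic_solution (P Q : finType) (G : P -> Q -> {poly K}) (b : Q -> K) :
  (forall N, exists2 n, (N <= n)%N &
     exists c : P -> K, forall q, \sum_p c p * (G p q).[n%:R] = b q) ->
  exists2 d : {poly K}, d != 0 &
    exists C : P -> {poly K}, forall q, \sum_p C p * G p q = (b q)%:P * d.
Proof.
pose F := {fraction {poly K}}; pose toF : {rmorphism {poly K} -> F} := @FracField.tofrac {poly K}.
move=> hn; pose A : 'M[F]_(#|P|, #|Q|) := \matrix_(i, j) toF (G (enum_val i) (enum_val j)).
pose v : 'rV[F]_#|Q| := \row_j toF (b (enum_val j))%:P.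
have reQ (V : nmodType) (f : Q -> V) : \sum_(j < #|Q|) f (enum_val j) = \sum_q f q.
  rewrite [RHS](reindex (@enum_val Q Q)) //=.
  by exists enum_rank => x _; rewrite (enum_rankK, enum_valK).
have reP (V : nmodType) (f : P -> V) : \sum_(j < #|P|) f (enum_val j) = \sum_q f q.
  rewrite [RHS](reindex (@enum_val P P)) //=.
  by exists enum_rank => x _; rewrite (enum_rankK, enum_valK).
have toFI : injective toF by move=> p q /eqP; rewrite (tofrac_eq p q) => /eqP.
have [/submxP[D vD]|nv] := boolP (v <= A)%MS.
  have [d d0 [y hy]] := frac_common_denominator (fun p : P => D 0 (enum_rank p)).
  have {}hy p : D 0 (enum_rank p) * toF d = toF (y p) := hy p.
  exists d => //; exists y => q; apply: toFI.
  have := congr1 (fun B : 'rV_#|Q| => B 0 (enum_rank q) * toF d) vD.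
  rewrite !mxE enum_rankK => e; rewrite rmorphM e mulr_suml rmorph_sum /= -reP.
  apply: eq_bigr => i _; rewrite mxE enum_rankK rmorphM -hy enum_valK.
  by rewrite mulrAC.
have [j vj] : exists j, (v *m cokermx A) 0 j != 0.
  apply: contrapT => h; move/negP: nv; apply; rewrite submxE; apply/eqP/rowP => j.
  by rewrite [RHS]mxE; apply/eqP/negPn/negP => vj; apply: h; exists j.
have [d d0 [y hy]] := frac_common_denominator (fun q : Q => cokermx A (enum_rank q) j).
have {}hy q : cokermx A (enum_rank q) j * toF d = toF (y q) := hy q.
have Ay p : \sum_q G p q * y q = 0.
  apply: toFI; rewrite rmorph0 rmorph_sum /= -reQ.
  have := congr1 (fun B : 'M_(#|P|, #|Q|) => B (enum_rank p) j * toF d) (mulmx_coker A).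
  rewrite !mxE mul0r mulr_suml; apply: etrans; apply: eq_bigr => i _.
  by rewrite mxE enum_rankK rmorphM -hy enum_valK mulrA.
have by0 : \sum_q (b q)%:P * y q != 0.
  rewrite -(inj_eq toFI) rmorph0; have : (v *m cokermx A) 0 j * toF d != 0.
    have dF : FracField.tofrac d != 0 by rewrite tofrac_eq0.
    by apply: mulf_neq0; [exact: vj|exact: dF].
  congr (_ != _); rewrite mxE mulr_suml rmorph_sum /= -reQ; apply: eq_bigr => i _.
  by rewrite mxE rmorphM -hy enum_valK mulrA.
have [N hN] := poly_natr_nonroot by0; have [n Nn [c hc]] := hn N.
have /eqP[] := hN n Nn; rewrite horner_sum.
under eq_bigr do rewrite hornerM hornerC -hc mulr_suml.
rewrite exchange_big big1// => p _; under eq_bigr do rewrite -mulrA -hornerM.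
by rewrite -mulr_sumr -horner_sum Ay horner0 mulr0.
Qed.

Definition binomial_poly k : {poly K} := (k`!%:R)^-1 *: \prod_(l < k) ('X - l%:R%:P).

Lemma binomial_polyE k n : (binomial_poly k).[n%:R] = 'C(n, k)%:R.
Proof.
rewrite /binomial_poly hornerZ horner_prod.
have -> : \prod_(l < k) ('X - l%:R%:P).[n%:R] = (n ^_ k)%:R :> K.
  elim: k => [|k IHk]; first by rewrite big_ord0 ffactn0.
  rewrite big_ord_recr /= IHk ffactnSr natrM hornerXsubC.
  have [le|lt] := leqP k n; first by rewrite natrB.
  by rewrite ffact_small// !mul0r.
by rewrite -bin_ffact natrM mulrC mulfK// natr_neq0// fact_gt0.
Qed.

Lemma poly_ideal_principal (I : set {poly K}) : subspace I ->
  (forall p q, I q -> I (p * q)) -> (exists2 p, I p & p != 0) ->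
  exists b, [/\ b \is monic, I b & forall c, I c <-> exists q, c = q * b].
Proof.
move=> sI mI [p0 Ip0 p00].
have ex : exists n, `[< exists p, [/\ I p, p != 0 & size p = n] >].
  by exists (size p0); apply/asboolP; exists p0.
case: (ex_minnP ex) => n /asboolP[p [Ip pn0 sp]] minp.
have lp : lead_coef p != 0 by rewrite lead_coef_eq0.
exists ((lead_coef p)^-1 *: p); split.
- by rewrite monicE lead_coefZ mulVf.
- exact: subspaceZ.
move=> c; split=> [Ic|[q ->]]; last by apply: mI; apply: subspaceZ.
exists (lead_coef p *: (c %/ p)); rewrite -scalerAl -scalerAr scalerA mulfV// scale1r.
have E := divp_eq c p; rewrite {1}E; suff -> : c %% p = 0 by rewrite addr0.
apply/eqP/negPn/negP => r0; have Ir : I (c %% p).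
  by rewrite (_ : c %% p = c - c %/ p * p); [apply: subspaceB => //; apply: mI|rewrite {2}E addrC addKr].
have := ltn_modp c p; rewrite pn0 ltnNge => /negP; apply; rewrite sp.
by apply: minp; apply/asboolP; exists (c %% p).
Qed.

End NaturalPoints.

(** * Bernstein's inequality and the sandwich Bernstein-Sato polynomial *)

Section SandwichFromEnveloping.
Variables (K : fieldType) (R : comAlgType K) (gr : nat -> set R).
Hypotheses (grR : is_grading gr) (gr0 : gr 0%N = range (fun k : K => k%:A)).
Variables (w m : nat) (x : 'I_m -> R) (dg : 'I_m -> nat).
Hypothesis xg : graded_generators gr w x dg.

Let D := diffop R.
Let B : nat -> set D := bern gr w.
Let Bsub i : subspace (B i) := bern_subspace gr w i.
Let Bmono i j d : (i <= j)%N -> B i d -> B j d. Proof. exact: bern_mono. Qed.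
Let B1 : B 0%N 1. Proof. exact: bern1. Qed.
Let BM i j d d' : B i d -> B j d' -> B (i + j)%N (d * d'). Proof. exact: bernM. Qed.
Let box := box_filtration B.
Let orbB := orb B.

Lemma bern_basis_ex t : exists p : {k : nat & 'I_k -> D},
  [/\ forall i, B t (projT2 p i), free_mod [set 0] (projT2 p) &
   forall d, B t d -> exists c, d = \sum_j c j *: projT2 p j].
Proof.
have [|k [v [vB fv vs]]] :=
    @max_free K D [set 0] (B t) (((m * w).+2 * t.+1) ^ (m + m))%N (@subspace_set0 _ _).
  by move=> k v; exact: (bern_dim grR gr0 xg).
by exists (existT _ k v); split=> // d /vs[c /= /eqP]; rewrite subr_eq0 => /eqP h; exists c.
Qed.

Definition bdim t := projT1 (projT1 (cid (bern_basis_ex t))).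
Definition bbasis t : 'I_(bdim t) -> D := projT2 (projT1 (cid (bern_basis_ex t))).

Arguments bbasis : clear implicits.

Lemma bbasis_in t i : B t (bbasis t i).
Proof. by rewrite /bbasis /bdim in i *; case: cid i => p [] /=. Qed.

Lemma bbasis_free t : free_mod [set 0] (bbasis t).
Proof. by rewrite /bbasis /bdim; case: cid => p []. Qed.

Lemma bbasis_span t d : B t d -> exists c, d = \sum_j c j *: bbasis t j.
Proof. by rewrite /bbasis /bdim; case: cid => p [] /= _ _; apply. Qed.

Lemma bdim_max t k (v : 'I_k -> D) : (forall i, B t (v i)) -> free_mod [set 0] v ->
  (k <= bdim t)%N.
Proof.
move=> vB fv; apply: (@steinitz K D [set 0] _ _ (bbasis t) v) => //.
  exact: subspace_set0.
by move=> i; have [c e] := bbasis_span (vB i); exists c; rewrite /= -e subrr.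
Qed.

Lemma bdim_max_fin t (I : finType) (v : I -> D) : (forall i, B t (v i)) ->
  (forall c : I -> K, \sum_i c i *: v i = 0 -> forall i, c i = 0) -> (#|I| <= bdim t)%N.
Proof.
move=> vB fv; apply: (@bdim_max t _ (fun i : 'I_#|I| => v (enum_val i))) => // c c0 i.
have -> : c i = c (enum_rank (enum_val i)) by rewrite enum_valK.
apply: (fv (fun j => c (enum_rank j))); rewrite -[RHS]c0 (reindex (@enum_val I I)) /=.
  by apply: eq_bigr => j _; rewrite enum_valK.
by exists enum_rank => y _; rewrite (enum_rankK, enum_valK).
Qed.

Lemma bdim_gt0 t : (0 < bdim t)%N.
Proof.
have : (#|'I_1| <= bdim t)%N.
  apply: (@bdim_max_fin t 'I_1 (fun _ => 1)) => [i|c]; first exact: Bmono (leq0n t) B1.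
  by rewrite big_ord1 => /eqP; rewrite scaler_eq0 oner_eq0 orbF => /eqP e i; rewrite ord1.
by rewrite card_ord.
Qed.

Lemma bdim_doubling c2 : (0 < c2)%N ->
  exists C3, forall t0, exists2 t, (t0 <= t)%N & (bdim (c2 * t) <= C3 * bdim t)%N.
Proof.
move=> c20; apply: (@poly_growth_doubling _ (m * w).+2 (m + m)) => // [t|t].
  exact: bdim_gt0.
by apply: (bern_dim grR gr0 xg (@bbasis_in t)); apply: bbasis_free.
Qed.

Lemma orb_bern T t v u : B t v -> orbB T v u -> B (T + t + T) u.
Proof. by move=> Bv [r hr <-]; apply: act_box. Qed.

Variable f : R.
Let V j : D := dmul (f ^+ j).
Variable cf : nat.
Hypothesis fcf : gr_le grR cf f.

Let BV j : B (j * cf) (V j).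
Proof. by apply: (@bern_dmul _ _ _ grR); apply: gr_leX. Qed.

Let orb_shift j i : orbB (i * cf) (V j) (V (j + i)).
Proof.
exists (otimes (V i) 1); last by rewrite act_otimes mulr1 /V -dmulM -exprD addnC.
by apply: box_otimes; [exact: BV|exact: Bmono (leq0n _) B1].
Qed.

Lemma free_mod_sub (W : set D) k l (v : 'I_k -> D) (lk : (l <= k)%N) : free_mod W v ->
  free_mod W (v \o widen_ord lk).
Proof.
move=> fv c h i; pose c' (j : 'I_k) := if insub (j : nat) is Some j' then c j' else 0.
have c'E j : c' (widen_ord lk j) = c j by rewrite /c' /= valK.
rewrite -c'E; apply: fv; move: h; rewrite (bigID (fun j : 'I_k => (j < l)%N)) /=.
rewrite [X in W (_ + X)]big1 ?addr0 => [|j jl].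
  rewrite (big_ord_narrow lk) => h; move: h; congr W; apply: eq_bigr => j _.
  by rewrite c'E.
by rewrite /c' insubF ?scale0r//; apply/negbTE.
Qed.

Variable C : nat.
Hypothesis boxC : forall t r, box t r -> r != 0 ->
  kspan [set y | exists a b, [/\ box (C * t) a, box (C * t) b & y = a * r * b]] 1.

(* Bernstein's inequality for the bimodule generated by [f ^ j] modulo the one generated
   by [f ^ j.+1], truncated to finite-dimensional pieces. *)
Lemma bernstein_inequality j t a0 : let s := (C.+1 * t)%N in
  ~ orbB (a0 + s) (V j.+1) (V j) ->
  exists p : 'I_(bdim t) -> D,
    (forall i, orbB s (V j) (p i)) /\ free_mod (orbB a0 (V j.+1)) p.
Proof.
move=> s nV; set W := orbB a0 (V j.+1).
have sW : subspace W by exact: orb_subspace.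
have W0 : [set 0] `<=` W by move=> _ ->; exact: subspace0.
have bound u k (v : 'I_k -> D) : (forall i, orbB u (V j) (v i)) -> free_mod W v ->
    (k <= bdim (u + j * cf + u))%N.
  move=> hv fv; apply: (@bdim_max _ _ v) => [i|c c0]; first exact: orb_bern (hv i).
  by apply: fv; apply: W0.
have [g [p [hp fp sp]]] := max_free sW (bound s).
have [le|lt] := leqP (bdim t) g.
  by exists (p \o widen_ord le); split=> [i|]; [apply: hp|apply: free_mod_sub].
(* The second basis [q], of level [C * t], leaves room for one application of an element of level
   [t] within the level [s] spanned by [p]. *)
exfalso; have [g' [q [hq fq sq]]] := max_free sW (bound (C * t)%N).
have Cts : (C * t <= s)%N by rewrite /s mulSn leq_addl.
have qg : (g' <= g)%N.
  by apply: (steinitz sW fq) => i; apply: sp; apply: (orb_mono Bmono Cts); apply: hq.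
pose I := ('I_(bdim t) * 'I_(bdim t))%type.
have bqb (k : I) i : orbB s (V j) (bbasis t k.1 * q i * bbasis t k.2).
  rewrite -act_otimes /s mulSn; apply: (orb_act BM); last exact: hq.
  by apply: box_otimes; apply: bbasis_in.
have /choice[M hM] : forall z : I * 'I_g', exists c : 'I_g -> K,
    W (bbasis t z.1.1 * q z.2 * bbasis t z.1.2 - \sum_l c l *: p l).
  by move=> z; apply: sp; apply: (bqb z.1 z.2).
(* Maps from the span of [q] to that of [p] form a space of dimension [g' * g], less than that of
   [B^t (x) B^t]; so some nonzero [rho] sends every [q i] into [W]. *)
have cardI : (#|{: 'I_g' * 'I_g}| < #|{: I}|)%N.
  by rewrite !card_prod !card_ord; apply: leq_ltn_trans (leq_mul qg (leqnn g)) _; rewrite ltn_mul.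
have [c [k0 ck0] hc] := nontrivial_relation (fun k (z : 'I_g' * 'I_g) => M (k, z.1) z.2) cardI.
pose rho := \sum_k c k *: otimes (bbasis t k.1) (bbasis t k.2).
have brho : box t rho.
  apply: subspace_sum (box_subspace _ _) _ => k _; apply: subspaceZ (box_subspace _ _) _.
  by apply: box_otimes; apply: bbasis_in.
have rho0 : rho != 0.
  apply: contra_neq ck0 => rho0; exact: (otimes_free (@bbasis_free t) rho0).
have Wq i : W (act rho (q i)).
  rewrite act_suml (_ : \sum_k _ = \sum_k c k *:
      (bbasis t k.1 * q i * bbasis t k.2 - \sum_l M (k, i) l *: p l)).
    by apply: subspace_sum => // k _; apply: subspaceZ => //; apply: (hM (k, i)).
  under [RHS]eq_bigr do rewrite scalerBr.
  rewrite sumrB [X in _ - X](_ : _ = 0) ?subr0.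
    by apply: eq_bigr => k _; rewrite actZl act_otimes.
  under eq_bigr do rewrite scaler_sumr.
  rewrite exchange_big big1// => l _; under eq_bigr do rewrite scalerA.
  by rewrite -scaler_suml (hc (i, l)) scale0r.
(* Linear simplicity writes 1 through [rho]. Applied to [V j], the inner factor [b] lands in the
   span of [q] modulo [W], so [rho] leads into the ideal of [V j.+1], and [V j] would lie there at
   the excluded level. *)
apply: nV; have := boxC brho rho0; rewrite -[V j]act1 => -[n [e [y [hy ->]]]].
rewrite act_suml; apply: subspace_sum (orb_subspace _ _ _) _ => l _; rewrite actZl.
apply: subspaceZ (orb_subspace _ _ _) _.
have [a [b [ha hb ->]]] := hy l; rewrite !actM.
have -> : (a0 + s = C * t + (t + a0))%N by rewrite /s mulSn; lia.
apply: (orb_act BM ha).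
have [d hd] : exists d : 'I_g' -> K, W (act b (V j) - \sum_i d i *: q i).
  by apply: sq; exists b.
have -> : act b (V j) = (act b (V j) - \sum_i d i *: q i) + \sum_i d i *: q i by rewrite subrK.
rewrite linearD; apply: subspaceD (orb_subspace _ _ _) (orb_act BM brho hd) _.
rewrite linear_sum; apply: subspace_sum (orb_subspace _ _ _) _ => i _.
rewrite linearZ; apply: subspaceZ (orb_subspace _ _ _) _.
by apply: (orb_mono Bmono _ (Wq i)); exact: leq_addl.
Qed.

Lemma adl_nilp n (d : D) : diff_le n (val d) -> iter n.+1 (adl (dmul f)) d = 0.
Proof.
elim: n d => [|n IHn] d.
  move=> [r dr]; have -> : d = dmul r by exact: val_inj.
  by rewrite /= /adl -!dmulM mulrC subrr.
move=> hd; rewrite iterSr IHn// (_ : adl _ _ = -1 *: (d * dmul f - dmul f * d)); last first.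
  by rewrite scaleN1r opprB.
have -> : val (-1 *: (d * dmul f - dmul f * d)) = (-1 : K) *: (val d * mulop f - mulop f * val d).
  by [].
exact: (subspaceZ _ (@diff_le_subspace K R n) (hd f)).
Qed.

Lemma adl_bern s k d : B s d -> B (s + k * cf) (iter k (adl (dmul f)) d).
Proof.
have Bf : B cf (dmul f) by exact: (@bern_dmul _ _ _ grR).
elim: k => [|k IHk] Bd; first by rewrite addn0.
rewrite /= /adl mulSn addnCA; apply: subspaceB => //; first by apply: BM => //; apply: IHk.
by rewrite addnC; apply: BM => //; apply: IHk.
Qed.

(** Moving a power of [f] to the right past an operator of order at most [s] costs at most [s]
    factors. All these elements thus share the right factor [V (n - s)], with cofactors in a step
    that does not depend on [n]. *)
Lemma orb_factor s n j k u : (s <= n)%N -> (j <= k)%N -> orbB s (V (n + j)) u ->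
  exists2 g, B (s + (s + s * cf) + k * cf) g & u = g * V (n - s).
Proof.
move=> sn jk [r + <-].
have sub : subspace [set r | exists2 g, B (s + (s + s * cf) + k * cf) g &
    act r (V (n + j)) = g * V (n - s)].
  split=> [|c r1 r2 [g hg e] [g' hg' e']].
    by exists 0; [exact: subspace0|rewrite act0l mul0r].
  exists (c *: g + g'); first exact: (Bsub _).2.
  by rewrite act_linear_l e e' mulrDl -scalerAl.
move: r; apply: (kspan_le sub) => _ [a [b [ha hb ->]]] /=.
rewrite -[tmul _ _]/(otimes a b) act_otimes /V dmulX -mulrA.
have snj : (s <= n + j)%N by apply: leq_trans sn (leq_addr _ _).
rewrite (expr_comm_nilp (adl_nilp (bern_order grR gr0 xg hb)) snj).
rewrite -addnBAC// [(n - s + j)%N]addnC exprD; set y := \sum_(i < _) _.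
exists (a * y * V j); last by rewrite /V !dmulX !mulrA.
apply: BM; last by apply: Bmono (BV j); rewrite leq_mul2r jk orbT.
apply: BM => //; apply: subspace_sum => // i _; rewrite -mulr_natr -scaler_nat -scalerAr mulr1.
apply: subspaceZ => //; apply: (@Bmono (s + i * cf + (s - i) * cf)).
  by rewrite -addnA -mulnDl subnKC// -ltnS.
apply: BM; first exact: adl_bern.
by rewrite -dmulX; apply: BV.
Qed.

(** Otherwise [k] consecutive bimodule quotients contribute [bdim t] independent elements each.
    Their cofactors by [V (n - s)] are independent too and lie in a step of dimension at most
    [C3 * bdim t], too small for [C3.+1] blocks. *)
Lemma sandwich_infinitely_often : exists T, forall N, exists2 n, (N <= n)%N &
  orbB T (V n.+1) (V n).
Proof.
(* With [s = C.+1 * t] and [k <= t], the cofactors from [orb_factor] lie in step [c2 * t]. *)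
pose c2 := (C.+1 + (C.+1 + C.+1 * cf) + cf)%N.
have [//|C3 hC3] := @bdim_doubling c2.
pose k := C3.+1; have [t kt ht] := hC3 k.
(* The term [k * cf] makes room for later blocks: [V (n + j')] with [j' > j] arises from
   [V (n + j).+1] by fewer than [k] multiplications by [f]. *)
pose s := (C.+1 * t)%N; pose a0 := (s + k * cf)%N; exists (a0 + s)%N => N.
apply: contrapT => nN; pose n := maxn N s.
have sn : (s <= n)%N by exact: leq_maxr.
have hV (j : 'I_k) : exists p : 'I_(bdim t) -> D,
    (forall i, orbB s (V (n + j)) (p i)) /\ free_mod (orbB a0 (V (n + j).+1)) p.
  apply: bernstein_inequality => h; apply: nN; exists (n + j)%N => //.
  exact: leq_trans (leq_maxl _ _) (leq_addr _ _).
have /choice[p hp] := hV.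
have /choice[g hg] : forall z : 'I_k * 'I_(bdim t), exists g,
    B (s + (s + s * cf) + k * cf) g /\ p z.1 z.2 = g * V (n - s).
  move=> [j i] /=; have [g Bg e] := orb_factor sn (ltnW (ltn_ord j)) ((hp j).1 i).
  by exists g.
suff : (#|{: 'I_k * 'I_(bdim t)}| <= bdim (c2 * t))%N.
  rewrite card_prod !card_ord => le; have := leq_trans le ht.
  by rewrite leq_mul2r gtn_eqF ?bdim_gt0//= ltnn.
apply: (@bdim_max_fin _ _ g) => [z|c].
  apply: Bmono (hg z).1; rewrite /c2 /s !mulnDl -!mulnA [(t * cf)%N]mulnC !leq_add2l.
  by rewrite mulnC leq_mul2l kt orbT.
move=> c0; have {}c0 : \sum_j \sum_i c (j, i) *: p j i = 0.
  transitivity ((\sum_z c z *: g z) * V (n - s)); last by rewrite c0 mul0r.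
  rewrite pair_big mulr_suml; apply: eq_bigr => z _.
  by rewrite -scalerAl -(hg z).2; case: z.
(* The relation is triangular: once the blocks below [l] vanish, block [l] is a combination of later
   ones, which lie in the subspace modulo which its own elements are free. *)
suff h l : forall j : 'I_k, (j < l)%N -> forall i, c (j, i) = 0.
  by move=> [j i]; apply: (h k).
elim: l => [//|l IHl] j; rewrite ltnS leq_eqVlt => /orP[/eqP jl|]; last exact: IHl.
apply: (hp j).2; move: c0; rewrite (bigD1 j)//= => /eqP; rewrite addr_eq0 => /eqP ->.
have so := orb_subspace B a0 (V (n + j).+1).
apply: subspaceN => //; apply: subspace_sum => // j' jj'; apply: subspace_sum => // i _.
have [lt|ge] := ltnP j' l; first by rewrite IHl// scale0r; apply: subspace0.
have jlt : (j < j')%N by rewrite ltn_neqAle jl ge andbT -jl eq_sym.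
apply: subspaceZ => //; have := (hp j').1 i.
have -> : (n + j' = (n + j).+1 + (j' - j.+1))%N by lia.
move=> /(orb_trans BM (orb_shift _ _)); apply: (orb_mono Bmono).
by rewrite leq_add2l leq_mul2r; apply/orP; right; have := ltn_ord j'; lia.
Qed.

End SandwichFromEnveloping.

Section SandwichEquations.
Variables (K : fieldType) (R : comAlgType K).
Let D := diffop R.

Definition scalar_poly (q : {poly K}) : {poly D} := map_poly (in_alg D) q.

Lemma horner_scalar_polyM q (p : {poly D}) n : (scalar_poly q * p).[n%:R] = q.[n%:R] *: p.[n%:R].
Proof.
rewrite hornerM_comm; last by rewrite /comm_poly commr_nat.
rewrite -{1}[n%:R](rmorph_nat (in_alg D)) horner_map.
exact: mulr_algl.
Qed.

Lemma sandwich_equation_subspace (f : R) : subspace (sandwich_equation f).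
Proof.
split=> [|k b c [s hs] [t ht]].
  by exists [::] => n; rewrite big_nil horner0 scale0r.
exists ([seq (scalar_poly k%:P * p.1, p.2) | p <- s] ++ t) => n.
rewrite big_cat big_map ht hornerD hornerZ scalerDl -scalerA -hs scaler_sumr.
congr (_ + _); apply: eq_bigr => p _ /=.
by rewrite horner_scalar_polyM hornerC -!scalerAl.
Qed.

Lemma sandwich_equationM (f : R) (p q : {poly K}) :
  sandwich_equation f q -> sandwich_equation f (p * q).
Proof.
move=> [s hs]; exists [seq (scalar_poly p * z.1, z.2) | z <- s] => n.
rewrite big_map hornerM -scalerA -hs scaler_sumr; apply: eq_bigr => z _ /=.
by rewrite horner_scalar_polyM -!scalerAl.
Qed.

Lemma sandwich_bs_poly_ex (f : R) (b : {poly K}) : sandwich_equation f b -> b != 0 ->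
  exists b, sandwich_bs_poly f b /\ b != 0.
Proof.
move=> hb b0.
have [|c [cm _ hc]] := poly_ideal_principal (sandwich_equation_subspace f)
  (@sandwich_equationM f); first by exists b.
by exists c; split; [split=> //; left|exact: monic_neq0].
Qed.

End SandwichEquations.

(** * From infinitely many exponents to a polynomial equation *)

Section Interpolation.
Variables (K : fieldType) (R : comAlgType K) (gr : nat -> set R).
Hypothesis charK0 : [pchar K] =i pred0.
Hypotheses (grR : is_grading gr) (gr0 : gr 0%N = range (fun k : K => k%:A)).
Variables (w m : nat) (x : 'I_m -> R) (dg : 'I_m -> nat).
Hypothesis xg : graded_generators gr w x dg.

Let D := diffop R.
Let B : nat -> set D := bern gr w.
Let box := box_filtration B.
Let bb t : 'I_(bdim grR gr0 xg t) -> D := @bbasis K R gr grR gr0 w m x dg xg t.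

Lemma orb_coord t v u : orb B t v u ->
  exists c, u = \sum_p c p *: (@bb t p.1 * v * @bb t p.2).
Proof.
move=> [r + <-]; pose Q := [set r | exists c : _ -> K,
  act r v = \sum_p c p *: (@bb t p.1 * v * @bb t p.2)].
have sQ : subspace Q.
  split=> [|k r1 r2 [c hc] [c' hc']].
    by exists (fun _ => 0); rewrite act0l big1// => p _; rewrite scale0r.
  exists (fun p => k * c p + c' p); rewrite act_linear_l hc hc' scaler_sumr -big_split.
  by apply: eq_bigr => p _; rewrite scalerDl scalerA.
move: r; apply: (kspan_le sQ) => _ [a [b [ha hb ->]]].
have [c hc] := bbasis_span grR gr0 xg ha; have [c' hc'] := bbasis_span grR gr0 xg hb.
exists (fun p => c p.1 * c' p.2); rewrite -[tmul _ _]/(otimes a b) act_otimes hc hc'.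
rewrite !mulr_suml -(pair_big xpredT xpredT (fun i j => (c i * c' j) *: (bb i * v * bb j))) /=.
apply: eq_bigr => i _; rewrite mulr_sumr; apply: eq_bigr => j _.
by rewrite -scalerAr -!scalerAl scalerA mulrC.
Qed.

Variables (f : R) (T : nat).
Let V j : D := dmul (f ^+ j).
Hypothesis often : forall N, exists2 n, (N <= n)%N & orb B T (V n.+1) (V n).

(** Products of basis elements around [f ^ n.+1] are combinations of fixed operators [U], with
    coefficients binomial in [n], times a power of [f]. Coordinates in a basis of the span of the
    [U] modulo [W] turn the sandwich relation into a linear system with polynomial coefficients,
    solvable for infinitely many [n]. *)
Lemma sandwich_interpolation : exists2 b : {poly K}, b != 0 & sandwich_equation f b.
Proof.
pose T1 := T.+1; pose b := bdim grR gr0 xg T1.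
pose I := ('I_b * 'I_b)%type; pose J := option (I * 'I_T1.+1).
(* The entry [f ^ T] represents the right-hand side: since [T1 = T.+1], the power [f ^ n] is [f ^ T]
   times [f ^ (n.+1 - T1)]. *)
pose U (j : J) : D := if j is Some z then
  bb z.1.1 * iter z.2 (adl (dmul f)) (bb z.1.2) * dmul f ^+ (T1 - z.2) else dmul f ^+ T.
(* The operators killed by a power of [f]; they vanish if [f] is a nonzerodivisor. *)
pose W : set D := [set d | exists M, d * dmul f ^+ M = 0].
have killed d M N : (M <= N)%N -> d * dmul f ^+ M = 0 -> d * dmul f ^+ N = 0.
  by move=> /subnKC <- e; rewrite exprD mulrA e mul0r.
have sW : subspace W.
  split=> [|k d d' [M e] [M' e']]; first by exists 0%N; rewrite mul0r.
  exists (maxn M M'); rewrite mulrDl -scalerAl.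
  by rewrite (killed _ _ _ (leq_maxl _ _) e) (killed _ _ _ (leq_maxr _ _) e') scaler0 addr0.
have [|Q [e [_ fe /= se]]] := @max_free K D W (range U) #|{: J}| sW.
  move=> k v hv fv; apply: (@steinitz K D W _ _ (fun i : 'I_#|{: J}| => U (enum_val i)) v) => // i.
  have [j _ <-] := hv i; exists (fun l => (l == enum_rank j)%:R).
  rewrite (bigD1 (enum_rank j))//= eqxx scale1r enum_rankK big1 ?addr0 ?subrr.
    exact: subspace0.
  by move=> l /negbTE->; rewrite scale0r.
have /choice[M hM] : forall j, exists c, W (U j - \sum_q c q *: e q).
  by move=> j; apply: se; exists j.
(* From [n1] on, [n.+1 - T1] exceeds every [E j], so the errors in [W] are killed. *)
have /choice[E hE] := hM; pose n1 := (\sum_j E j + T1)%N.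
have UF n j : (n1 <= n)%N ->
    U j * dmul f ^+ (n.+1 - T1) = \sum_q M j q *: (e q * dmul f ^+ (n.+1 - T1)).
  move=> nn; apply/eqP; rewrite -subr_eq0.
  have -> : \sum_q M j q *: (e q * dmul f ^+ (n.+1 - T1)) =
    (\sum_q M j q *: e q) * dmul f ^+ (n.+1 - T1).
    by rewrite mulr_suml; apply: eq_bigr => q _; rewrite -scalerAl.
  rewrite -mulrBl; apply/eqP; apply: killed (hE j).
  have : (E j <= \sum_j E j)%N by rewrite (bigD1 j)//= leq_addr.
  by move: nn; rewrite /n1; lia.
pose G (p : I) q : {poly K} :=
  \sum_(k < T1.+1) (binomial_poly K k \Po ('X + 1%:P)) * (M (Some (p, k)) q)%:P.
have GE n p : (n1 <= n)%N ->
    bb p.1 * V n.+1 * bb p.2 = \sum_q (G p q).[n%:R] *: (e q * dmul f ^+ (n.+1 - T1)).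
  move=> nn; have Tn : (T1 <= n.+1)%N by move: nn; rewrite /n1; lia.
  have nil : iter T1.+1 (adl (dmul f)) (bb p.2) = 0.
    by apply: adl_nilp; apply: (bern_order grR gr0 xg); apply: bbasis_in.
  rewrite -mulrA /V dmulX (expr_comm_nilp nil Tn) mulrA mulr_sumr mulr_suml.
  transitivity (\sum_(k < T1.+1) 'C(n.+1, k)%:R *: (U (Some (p, k)) * dmul f ^+ (n.+1 - T1))).
    by apply: eq_bigr => k _; rewrite scaler_nat mulrnAr mulrnAl !mulrA.
  under eq_bigr do rewrite (UF _ _ nn) scaler_sumr.
  rewrite exchange_big; apply: eq_bigr => q _; rewrite /G horner_sum scaler_suml.
  apply: eq_bigr => k _; rewrite hornerM hornerC horner_comp hornerD hornerX hornerC natr1.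
  by rewrite binomial_polyE// scalerA.
have VE n : (n1 <= n)%N -> V n = \sum_q M None q *: (e q * dmul f ^+ (n.+1 - T1)).
  move=> nn; rewrite -(UF _ None nn) /U -exprD /V dmulX; congr (_ ^+ _).
  by move: nn; rewrite /n1 /T1; lia.
have [N|d d0 [C hC]] := @generic_solution K charK0 I 'I_Q G (M None).
  have [n Nn hn] := often (maxn N n1); exists n; first exact: leq_trans (leq_maxl _ _) Nn.
  have nn : (n1 <= n)%N by apply: leq_trans (leq_maxr _ _) Nn.
  have : orb B T1 (V n.+1) (V n).
    by apply: (orb_mono _ _ hn) => [i j a|]; [exact: bern_mono|exact: leqnSn].
  move=> /orb_coord[c hc]; exists c => q; apply/eqP; rewrite -subr_eq0; apply/eqP.
  move: q; apply: fe; exists (n.+1 - T1)%N; rewrite mulr_suml.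
  under eq_bigr do rewrite -scalerAl scalerBl.
  rewrite sumrB -VE// hc; apply/eqP; rewrite subr_eq0; apply/eqP.
  under [RHS]eq_bigr do rewrite GE// scaler_sumr.
  rewrite exchange_big; apply: eq_bigr => q _; rewrite scaler_suml.
  by apply: eq_bigr => p _; rewrite scalerA.
(* The expansions hold only from [n1] on; [Z] makes both sides vanish at the smaller [n]. *)
pose Z : {poly K} := \prod_(l < n1) ('X - l%:R%:P).
exists (Z * d).
  rewrite mulf_neq0//; by apply/prodf_neq0 => l _; rewrite polyXsubC_eq0.
exists [seq (scalar_poly R (Z * C p) * (bb p.1)%:P, (bb p.2)%:P) | p <- enum {: I}] => n.
rewrite big_map big_enum /= !hornerM -scalerA.
under eq_bigr do rewrite horner_scalar_polyM !hornerC -!scalerAl hornerM -scalerA.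
rewrite -scaler_sumr; have [nn|nn] := leqP n1 n; last first.
  rewrite (_ : Z.[n%:R] = 0) ?scale0r// horner_prod.
  by rewrite (bigD1 (Ordinal nn))//= hornerXsubC subrr mul0r.
congr (_ *: _); under eq_bigr do rewrite GE// scaler_sumr.
rewrite exchange_big -/(V n) VE// scaler_sumr; apply: eq_bigr => q _.
under eq_bigr do rewrite scalerA -hornerM.
rewrite -scaler_suml -horner_sum hC hornerM hornerC scalerA; congr (_ *: _).
exact: mulrC.
Qed.

End Interpolation.

Lemma linearly_simple_box_sandwich (K : fieldType) (R : comAlgType K) (gr : nat -> set R)
    (w m : nat) (x : 'I_m -> R) (dg : 'I_m -> nat) : [pchar K] =i pred0 ->
  is_grading gr -> gr 0%N = range (fun k : K => k%:A) -> graded_generators gr w x dg ->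
  linearly_simple (box_filtration (bern gr w)) ->
  forall f : R, exists b : {poly K}, sandwich_bs_poly f b /\ b != 0.
Proof.
move=> charK0 grR gr0 xg [C hC] f; have [cf fcf] := gr_le_ex grR f.
have [T often] := sandwich_infinitely_often gr0 xg fcf hC.
have [b b0 hb] := sandwich_interpolation charK0 grR gr0 xg often.
exact: sandwich_bs_poly_ex hb b0.
Qed.

(** * Linear simplicity of the enveloping algebra *)

Section BoxLinearSimplicity.
Variables (K : fieldType) (R : comAlgType K) (gr : nat -> set R).
Hypotheses (grR : is_grading gr) (gr0 : gr 0%N = range (fun k : K => k%:A)).
Variables (w m : nat) (x : 'I_m -> R) (dg : 'I_m -> nat).
Hypothesis xg : graded_generators gr w x dg.

Let D := diffop R.
Let B : nat -> set D := bern gr w.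
Let Bsub i : subspace (B i) := bern_subspace gr w i.
Let Bmono i j d : (i <= j)%N -> B i d -> B j d. Proof. exact: bern_mono. Qed.
Let B1 : B 0%N 1. Proof. exact: bern1. Qed.
Let BM i j d d' : B i d -> B j d' -> B (i + j)%N (d * d'). Proof. exact: bernM. Qed.
Let box := box_filtration B.

Lemma box_basis t r : box t r -> exists a : 'I_(bdim grR gr0 xg t) -> D,
  (forall i, B t (a i)) /\ r = \sum_i otimes (a i) (bbasis (xg := xg) i).
Proof.
pose Q := [set r | exists a : 'I_(bdim grR gr0 xg t) -> D,
  (forall i, B t (a i)) /\ r = \sum_i otimes (a i) (bbasis (xg := xg) i)].
have sQ : subspace Q.
  split=> [|k _ _ [a [ha ->]] [a' [ha' ->]]].
    exists (fun _ => 0); split=> [i|]; first exact: subspace0.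
    by rewrite big1// => i _; rewrite otimes0l.
  exists (fun i => k *: a i + a' i); split=> [i|]; first exact: (Bsub t).2.
  by rewrite scaler_sumr -big_split; apply: eq_bigr => i _; rewrite otimes_linear_l.
apply: (kspan_le sQ) => _ [a [b [ha hb ->]]].
have [c hc] := bbasis_span grR gr0 xg hb.
exists (fun i => c i *: a); split=> [i|]; first exact: subspaceZ.
rewrite -[tmul _ _]/(otimes a b) hc linear_sum; apply: eq_bigr => i _.
by rewrite linearZ otimesZl.
Qed.

(** Write a tensor with its right legs in a basis. Once the left legs are reduced to scalars, not
    all zero, there remains [1] tensored with a nonzero combination of the basis, and linear
    simplicity of D applies to the right leg. *)
Lemma box_linearly_simple c : linearly_simple B ->
  (forall t k (a : 'I_k -> D), (forall i, B t (a i)) -> (exists i, a i != 0) ->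
    exists2 e, box (c * t) e & exists2 l : 'I_k -> K, (exists i, l i != 0) &
      forall i, act e (a i) = l i *: 1) ->
  linearly_simple box.
Proof.
move=> /linearly_simpleP[C hC] hred; exists (c + C)%N => t r hr r0.
have [a [ha re]] := box_basis hr.
have [|e he [l [i0 li0] el]] := hred t _ a ha.
  apply: contrapT => /forallNP h; case/eqP: r0; rewrite re big1// => i _.
  by have /negP/negPn/eqP-> := h i; rewrite otimes0l.
pose bb := bbasis (grR := grR) (gr0 := gr0) (xg := xg) (t := t); pose b := \sum_i l i *: bb i.
have b0 : b != 0.
  by apply: contra_neq li0 => b0; apply: (bbasis_free (c := l)); exact: b0.
have [|e' he' eb] := hC t b _ b0.
  by apply: subspace_sum => // i _; apply: subspaceZ => //; apply: bbasis_in.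
set S := [set _ | _]; have sS := kspan_subspace S.
have -> : 1 = \sum_i otimes (act e (a i)) (act e' (bb i)).
  transitivity (otimes 1 (act e' b)); first by rewrite eb.
  rewrite /b (linear_sum (act e')) /= (linear_sum (otimes 1)) /=; apply: eq_bigr => i _.
  by rewrite el otimesZl !linearZ.
have {}he : box ((c + C) * t) e by apply: (box_mono Bmono _ he); rewrite leq_mul2r leq_addr orbT.
have {}he' : box ((c + C) * t) e' by apply: (box_mono Bmono _ he'); rewrite leq_mul2r leq_addl orbT.
move: e he {el}; apply: (@kspan_le _ _ _ [set e |
    kspan S (\sum_i otimes (act e (a i)) (act e' (bb i)))]).
  split=> [|k e1 e2 h1 h2] /=.
    by rewrite big1 => [|i _]; [exact: subspace0|rewrite act0l otimes0l].
  under eq_bigr do rewrite act_linear_l otimes_linear_l.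
  by rewrite big_split -scaler_sumr; apply: sS.2.
move=> _ [al [be [hal hbe ->]]] /=.
move: e' he' {eb}; apply: (@kspan_le _ _ _ [set e' |
    kspan S (\sum_i otimes (act (otimes al be) (a i)) (act e' (bb i)))]).
  split=> [|k e1 e2 h1 h2] /=.
    by rewrite big1 => [|i _]; [exact: subspace0|rewrite act0l linear0].
  under eq_bigr do rewrite act_linear_l linearP.
  by rewrite big_split -scaler_sumr; apply: sS.2.
move=> _ [al' [be' [hal' hbe' ->]]] /=.
(* As the second factor multiplies in reverse order, this pair puts [al], [be] around the left legs
   and [al'], [be'] around the right ones. *)
apply: sub_kspan; exists (otimes al be'), (otimes be al'); split.
- exact: box_otimes.
- exact: box_otimes.
rewrite re mulr_sumr mulr_suml; apply: eq_bigr => i _.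
by rewrite !otimesM -[tmul _ _]/(otimes al' be') !act_otimes !mulrA.
Qed.

End BoxLinearSimplicity.

Section Derivations.
Variables (K : fieldType) (R : comAlgType K).

Lemma derivation_is_diffop (d : R -> R) (dl : linear d) :
  (forall a b, d (a * b) = a * d b + b * d a) -> is_diffop (linear_endo dl).
Proof.
move=> dM; apply/asboolP; exists 1%N => r; exists (d r).
apply: endo_ext => y; rewrite -[LHS]/(d (r * y) - r * d y) dM.
by rewrite addrC addKr mulrC.
Qed.

Lemma derivation_diffop (d : R -> R) : linear d ->
  (forall a b, d (a * b) = a * d b + b * d a) ->
  exists e : diffop R, (forall r, dapp e r = d r) /\
    forall r, e * dmul r - dmul r * e = dmul (d r).
Proof.
move=> dl dM; exists (Diffop (derivation_is_diffop dl dM)); split=> // r.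
apply: diffop_ext => y; rewrite dappB !dappM !dapp_dmul.
by rewrite -!/(d _) /dapp /= -[LHS]/(d (r * y) - r * d y) dM addrC addKr mulrC.
Qed.

End Derivations.

(** * Euler derivations on monomial algebras *)

Section MonomialAlgebras.
Import mpoly.
Variables (K : fieldType) (R : comAlgType K) (n : nat) (phi : {lrmorphism R -> {mpoly K[n]}}).
Hypothesis phiI : injective phi.

Definition euler (i : 'I_n) (p : {mpoly K[n]}) : {mpoly K[n]} := 'X_i * p^`M(i).

Lemma euler_linear i : linear (euler i).
Proof. by move=> k p q; rewrite /euler linearP mulrDr scalerAr. Qed.

Lemma eulerM i p q : euler i (p * q) = p * euler i q + q * euler i p.
Proof. by rewrite /euler mderivM; ring. Qed.

Lemma eulerX i m : euler i 'X_[m] = (m i)%:R *: 'X_[m].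
Proof.
rewrite /euler mderivX -scalerAr; have [->|mi] := posnP (m i); first by rewrite !scale0r.
by rewrite -mpolyXD addmC submK// lep1mP -lt0n.
Qed.

Lemma euler_coeff i p m : (euler i p)@_m = (m i)%:R * p@_m.
Proof.
rewrite {1}[p]mpolyE /euler linear_sum mulr_sumr raddf_sum /=.
under eq_bigr do rewrite linearZ /= -scalerAr -/(euler i _) mcoeffZ eulerX mcoeffZ mcoeffX.
have [mp|mp] := boolP (m \in msupp p); last first.
  rewrite (memN_msupp_eq0 mp) mulr0 big_seq big1// => k kp.
  by case: eqP => [km|]; rewrite ?mulr0//; rewrite -km kp in mp.
rewrite (bigD1_seq m)//= eqxx mulr1 mulrC big1 ?addr0// => k /negbTE->.
by rewrite !mulr0.
Qed.

Variable s : seq 'X_{1..n}.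
Hypothesis phi_im : phi @` [set: R] = alg_gen [set 'X_[m] | m in [set` s]].

Lemma euler_stable i (r : R) : exists r', phi r' = euler i (phi r).
Proof.
pose Im := alg_gen ([set 'X_[m] | m in [set` s]] : set {mpoly K[n]}).
have [I1 sI IM] : subalgebra Im := alg_gen_subalgebra _.
suff : [set p | Im p /\ Im (euler i p)] (phi r).
  by move=> [_]; rewrite /Im -phi_im => -[r' _ e]; exists r'.
have : Im (phi r) by rewrite /Im -phi_im; exists r.
apply: alg_gen_le.
  split=> /=.
  - by split=> //; rewrite /euler -mpolyC1 mderivC mulr0; apply: (subspace0 sI).
  - split=> [|k p q [hp hp'] [hq hq']] /=; first by rewrite /euler linear0 mulr0; split; apply: (subspace0 sI).
    by rewrite euler_linear; split; apply: sI.2.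
  - move=> p q [hp hp'] [hq hq'] /=; split; first exact: IM.
    by rewrite eulerM; apply: (subspaceD sI); apply: IM.
move=> _ [m sm <-] /=; have h : Im 'X_[m] by apply: sub_alg_gen; exists m.
by split=> //; rewrite eulerX; apply: (subspaceZ _ sI).
Qed.

Lemma euler_diffop i : exists e : diffop R, forall r, exists r',
  e * dmul r - dmul r * e = dmul r' /\ phi r' = euler i (phi r).
Proof.
have /choice[d hd] := euler_stable i.
have [||e [_ he]] := @derivation_diffop K R d.
- by move=> k a b; apply: phiI; rewrite hd !linearP /= euler_linear !hd.
- by move=> a b; apply: phiI; rewrite hd rmorphM eulerM rmorphD !rmorphM /= !hd.
by exists e => r; exists (d r).
Qed.

Variable gr : nat -> set R.
Hypotheses (grR : is_grading gr) (gr0 : gr 0%N = range (fun k : K => k%:A)).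
Variables (w m : nat) (x : 'I_m -> R) (dg : 'I_m -> nat).
Hypothesis xg : graded_generators gr w x dg.

Let D := diffop R.
Let B : nat -> set D := bern gr w.
Let Bsub i : subspace (B i) := bern_subspace gr w i.
Let Bmono i j d : (i <= j)%N -> B i d -> B j d. Proof. exact: bern_mono. Qed.
Let B1 : B 0%N 1. Proof. exact: bern1. Qed.
Let BM i j d d' : B i d -> B j d' -> B (i + j)%N (d * d'). Proof. exact: bernM. Qed.
Let box := box_filtration B.

Definition diagonal (r : enveloping D) (e : 'X_{1..n} -> K) :=
  forall g : R, exists g', act r (dmul g) = dmul g' /\
    forall k, (phi g')@_k = e k * (phi g)@_k.

Lemma diagonal1 : diagonal 1 (fun _ => 1).
Proof. by move=> g; exists g; rewrite act1; split=> // k; rewrite mul1r. Qed.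

Lemma diagonalM r r' e e' : diagonal r e -> diagonal r' e' ->
  diagonal (r * r') (fun k => e k * e' k).
Proof.
move=> h h' g; have [g' [eg' hg']] := h' g; have [g'' [eg'' hg'']] := h g'.
by exists g''; rewrite actM eg'; split=> // k; rewrite hg'' hg' mulrA.
Qed.

Lemma diagonal_prod c t (I : eqType) (l : seq I) (r : I -> enveloping D) e :
  (forall i, i \in l -> box c (r i) /\ diagonal (r i) (e i)) -> (size l <= t)%N ->
  exists2 r', box (c * t) r' & diagonal r' (fun k => \prod_(i <- l) e i k).
Proof.
elim: l t => [|i l IHl] t hl lt.
  exists 1; first exact: box1.
  by move=> g; have [g' [eg' hg']] := diagonal1 g; exists g'; split=> // k; rewrite big_nil.
case: t lt => // t; rewrite ltnS => lt.
have [j jl|r' br' dr'] := IHl t _ lt; first by apply: hl; rewrite inE jl orbT.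
have [bi di] := hl i (mem_head _ _).
exists (r i * r'); first by rewrite mulnS; apply: boxM.
move=> g; have [g' [eg' hg']] := diagonalM di dr' g.
by exists g'; split=> // k; rewrite big_cons.
Qed.

(** The commutator of the Euler operator with multiplication by [g] is multiplication by the
    derivative of [g], which scales the monomial of exponent [k] by [k i]. The level [c] is uniform
    in [a], because scalars lie in level 0. *)
Lemma euler_diagonal : exists c, forall i (a : K), exists2 r, box c r &
  diagonal r (fun k => (k i)%:R - a).
Proof.
have /choice[e he] := euler_diffop.
have /choice[c hc] i := bern_exhaustive grR gr0 xg (e i).
exists (\sum_i c i)%N => i a; pose r := otimes (e i) 1 - otimes 1 (e i) - a *: 1.
have ci : (c i <= \sum_i c i)%N by rewrite (bigD1 i)//= leq_addr.
have Be : B (\sum_i c i)%N (e i) by apply: Bmono ci (hc i).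
have B1' : B (\sum_i c i)%N 1 by apply: Bmono B1.
exists r.
  apply: subspaceB (box_subspace _ _) _ _.
    by apply: subspaceB (box_subspace _ _) _ _; apply: box_otimes.
  by apply: subspaceZ (box_subspace _ _) _; exact: box1.
move=> g; have [g' [eg' hg']] := he i g; exists (g' - a *: g); split=> [|k].
  rewrite !actBl !act_otimes actZl act1 !(mulr1, mul1r) eg'.
  by rewrite -scaleNr addrC -dmul_linear scaleNr addrC.
by rewrite -scaleNr addrC linearP /= mcoeffD mcoeffZ hg' euler_coeff mulrBl mulNr addrC.
Qed.

Definition mdeg_le d (p : {mpoly K[n]}) := forall k, p@_k != 0 -> (mdeg k <= d)%N.

Lemma mdeg_le_subspace d : subspace (mdeg_le d).
Proof.
split=> [k|c p q hp hq k]; first by rewrite mcoeff0 eqxx.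
rewrite mcoeffD mcoeffZ => ne; have [p0|/hp//] := eqVneq p@_k 0.
by apply: hq; apply: contra_neq ne => q0; rewrite p0 q0 mulr0 addr0.
Qed.

Lemma mdeg_le_mono d d' p : (d <= d')%N -> mdeg_le d p -> mdeg_le d' p.
Proof. by move=> dd' hp k /hp/leq_trans; apply. Qed.

Lemma mdeg_leM d d' p q : mdeg_le d p -> mdeg_le d' q -> mdeg_le (d + d') (p * q).
Proof.
move=> hp hq; rewrite [p]mpolyE [q]mpolyE mulr_suml.
apply: subspace_sum_in (mdeg_le_subspace _) _ => k kp.
rewrite mulr_sumr; apply: subspace_sum_in (mdeg_le_subspace _) _ => l lq.
rewrite -scalerAl -scalerAr; do 2 apply: subspaceZ (mdeg_le_subspace _) _.
rewrite -mpolyXD => j; rewrite mcoeffX; case: (_ =P j) => [<- _|_]; last by rewrite eqxx.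
by rewrite mdegD leq_add//; [apply: hp|apply: hq]; rewrite -mcoeff_msupp.
Qed.

Lemma mdeg_le1 d : mdeg_le d 1.
Proof. by move=> k; rewrite mcoeff1; case: (k =P _) => [->|]; rewrite ?mdeg0 ?eqxx. Qed.

(** The given grading may be unrelated to the degree in the polynomial ring. It suffices that the
    generators have bounded degree there and positive degree in the grading. *)
Lemma gr_le_mdeg : exists c, forall t g, gr_le grR t g -> mdeg_le (c * t) (phi g).
Proof.
have xc i : mdeg_le (msize (phi (x i))) (phi (x i)).
  by move=> k kx; apply: ltnW; apply: msize_mdeg_lt; rewrite mcoeff_msupp.
pose c := (\sum_i msize (phi (x i)))%N; exists c => t g /(gr_le_monom gr0 xg).
have sub : subspace [set g | mdeg_le (c * t) (phi g)].
  split=> [|k a b ha hb] /=; first by rewrite raddf0; apply: subspace0 (mdeg_le_subspace _).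
  by rewrite linearP; apply: (mdeg_le_subspace _).2.
apply: (kspan_le sub) => _ [a /= at_ <-].
apply: (@mdeg_le_mono (\sum_i c * a i)%N).
  rewrite -big_distrr /= leq_mul2l (leq_trans _ at_) ?orbT// /wt leq_sum// => i _.
  by rewrite leq_pmull//; case/andP: (ggen_deg xg i).
rewrite /monom rmorph_prod; elim/big_rec2: _ => [|i d p _ IH]; first exact: mdeg_le1.
apply: mdeg_leM => //; rewrite rmorphXn /=.
have ci : mdeg_le c (phi (x i)).
  by apply: mdeg_le_mono (xc i); rewrite /c (bigD1 i)//= leq_addr.
elim: (a i) => [|b IHb]; first by rewrite expr0; exact: mdeg_le1.
by rewrite exprS mulnS; apply: mdeg_leM.
Qed.

Hypothesis charK0 : [pchar K] =i pred0.

(** Keep a monomial [k0] that occurs in some [g j] and kill all others by factors with eigenvalue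
    [k i - b], for each variable [i] and each [b <= N] other than [k0 i], enumerated by [bump]. All
    exponents are at most [N = d * t], so the number of factors is linear in [t]. *)
Lemma monomial_projection : exists c, forall t k (g : 'I_k -> R),
  (forall j, gr_le grR t (g j)) -> (exists j, g j != 0) ->
  exists2 r, box (c * t) r & exists2 g' : 'I_k -> R, (forall j, act r (dmul (g j)) = dmul (g' j)) &
    exists2 j0, g' j0 != 0 & forall j, exists l : K, g' j = l *: g' j0.
Proof.
have [c hc] := euler_diagonal; have [d hd] := gr_le_mdeg.
exists (c * (n * d))%N => t k g hg [j0 gj0].
have [k0 hk0] : exists k0, (phi (g j0))@_k0 != 0.
  apply: contrapT => /forallNP h; case/eqP: gj0; apply: phiI; rewrite raddf0.
  by apply/mpolyP => k0; rewrite mcoeff0; apply/eqP/negPn/negP/h.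
pose N := (d * t)%N; pose l := enum {: 'I_n * 'I_N}.
have kN j k' (i : 'I_n) : (phi (g j))@_k' != 0 -> (k' i <= N)%N.
  by move=> /(hd t _ (hg j)); apply: leq_trans; rewrite mdegE (bigD1 i)//= leq_addr.
have /choice[r0 hr0] : forall p : 'I_n * 'I_N, exists r, box c r /\
    diagonal r (fun k => (k p.1)%:R - (bump (k0 p.1) p.2)%:R).
  by move=> p; have [r br dr] := hc p.1 (bump (k0 p.1) p.2)%:R; exists r.
have [p _||r br dr] := @diagonal_prod c (n * d * t) _ l r0 (fun p k => (k p.1)%:R - (bump (k0 p.1) p.2)%:R).
- exact: hr0.
- by rewrite -cardE card_prod !card_ord /N mulnA.
exists r; first by rewrite -mulnA.
pose E (k' : 'X_{1..n}) : K := \prod_(p <- l) ((k' p.1)%:R - (bump (k0 p.1) p.2)%:R).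
have /choice[g' hg'] : forall j, exists g', act r (dmul (g j)) = dmul g' /\
  forall k', (phi g')@_k' = E k' * (phi (g j))@_k' by move=> j; apply: dr.
have E0 : E k0 != 0.
  rewrite /E prodf_seq_neq0; apply/allP => p _ /=; rewrite subr_eq0.
  by apply/negP => /eqP/(natr_inj0 charK0) e; have := neq_bump (k0 p.1) p.2; rewrite -e eqxx.
have g'E j k' : (phi (g' j))@_k' = if k' == k0 then E k0 * (phi (g j))@_k0 else 0.
  rewrite (hg' j).2; case: eqP => [->//|/eqP ne].
  have [->|nz] := eqVneq (phi (g j))@_k' 0; first by rewrite mulr0.
  have [i ki] : exists i, k' i != k0 i.
    apply: contrapT => /forallNP h; case/eqP: ne; apply/mnmP => i.
    by apply/eqP/negPn/negP/h.
  have lt : (unbump (k0 i) (k' i) < N)%N.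
    have := kN _ _ i nz; have := kN _ _ i hk0; rewrite /unbump; move/eqP: ki.
    by case: (ltnP (k0 i) (k' i)) => /=; lia.
  have mem : (i, Ordinal lt) \in l by rewrite mem_enum.
  rewrite /E (big_rem _ mem) /= (unbumpK _) ?inE// subrr !mul0r//.
exists g' => [j|]; first by have [] := hg' j.
exists j0.
  apply/eqP => g0; have := g'E j0 k0; rewrite g0 raddf0 mcoeff0 eqxx => /esym/eqP.
  by rewrite mulf_eq0 (negbTE E0) (negbTE hk0).
move=> j; exists ((phi (g j))@_k0 / (phi (g j0))@_k0); apply: phiI; apply/mpolyP => k'.
rewrite linearZ /= mcoeffZ !g'E; case: eqP => _; last by rewrite mulr0.
by rewrite mulrCA divfK.
Qed.

(** Commutators make all coefficients multiplications, the monomial projection makes them multiples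
    of a single one, and linear simplicity of D sends that one to 1. *)
Lemma toric_box_linearly_simple : linearly_simple B -> linearly_simple box.
Proof.
move=> ls; have /linearly_simpleP[C hC] := ls.
have [c hc] := monomial_projection.
have [c2 hc2] : exists c2, c2 = (w + (w + 1 + w) * c)%N by eexists.
apply: (@box_linearly_simple _ _ _ grR gr0 _ _ _ _ xg (c2 + C * (c2 + 1 + c2))%N) => // t k a ha a0.
have [e he [g g0 eg]] := commutator_reduction grR gr0 xg ha a0.
have gt j : gr_le grR ((w + 1 + w) * t) (g j).
  have := act_box Bsub BM he (ha j); rewrite eg -[X in (_ + X + _)%N]mul1n -!mulnDl.
  by move=> /(@bern_app1 K R gr grR gr0 w); rewrite dapp_dmul mulr1.
have [e' he' [g' eg' [j0 gj0 hj0]]] := hc _ _ g gt g0.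
have bee : box (c2 * t) (e' * e).
  have := boxM BM he' he; congr box; rewrite hc2; lia.
have Bg : B ((c2 + 1 + c2) * t) (dmul (g' j0)).
  have := act_box Bsub BM bee (ha j0); rewrite actM eg eg'; congr B; lia.
have [|e2 he2 e2g] := hC _ _ Bg; first by apply: contra_neq gj0; exact: dmul_eq0.
exists (e2 * (e' * e)).
  by have := boxM BM he2 bee; congr box; lia.
have /choice[l hl] := hj0; exists l => [|j]; last first.
  by rewrite !actM eg eg' hl linearZ linearZ /= e2g.
exists j0; apply: contra_neq gj0 => l0; by rewrite hl l0 scale0r.
Qed.

End MonomialAlgebras.

(** * Noetherian rings and extension of derivations *)

Section IdealPredicates.
Variable S : comNzRingType.

Definition is_ideal (I : set S) :=
  [/\ I 0, forall a b, I a -> I b -> I (a + b) & forall a b, I b -> I (a * b)].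

Definition is_prime (P : set S) :=
  [/\ is_ideal P, ~ P 1 & forall a b, P (a * b) -> P a \/ P b].

Lemma ideal_sum (I : set S) J (r : seq J) (Q : pred J) (F : J -> S) : is_ideal I ->
  (forall j, Q j -> I (F j)) -> I (\sum_(j <- r | Q j) F j).
Proof. by move=> [I0 ID _] h; apply: (big_ind I). Qed.

Lemma idealN (I : set S) a : is_ideal I -> I a -> I (- a).
Proof. by move=> [_ _ IM] Ia; rewrite -mulN1r; apply: IM. Qed.

Lemma idealB (I : set S) a b : is_ideal I -> I a -> I b -> I (a - b).
Proof. by move=> hI Ia Ib; have [_ ID _] := hI; apply: ID => //; apply: idealN. Qed.

Lemma prime_prod (P : set S) J (r : seq J) (Q : pred J) (F : J -> S) : is_prime P ->
  (forall j, Q j -> ~ P (F j)) -> ~ P (\prod_(j <- r | Q j) F j).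
Proof. by move=> [_ P1 PM] h; apply: (big_ind (fun v => ~ P v)) => // a b na nb /PM[]. Qed.

Lemma det_notin_prime (P : set S) n (M : 'M[S]_n) : is_prime P ->
  (forall i j, i != j -> P (M i j)) -> (forall i, ~ P (M i i)) -> ~ P (\det M).
Proof.
move=> pP off diag; have [iP _ _] := pP; have [P0 PD PM] := iP.
rewrite /determinant (bigD1 (1%g : 'S_n))//= => h.
have : P (\prod_i M i ((1 : 'S_n)%g i)).
  have : P (\sum_(s : 'S_n | s != 1%g) (-1) ^+ s * \prod_i M i (s i)).
    apply: ideal_sum => // s s1; apply: (PM).
    have [i si] : exists i, s i != i.
      apply: contrapT => /forallNP hs; case/eqP: s1; apply/permP => i.
      by rewrite perm1; apply/eqP/negPn/negP/hs.
    by rewrite (bigD1 i)//= mulrC; apply: PM; apply: off; rewrite eq_sym.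
  by move=> /(idealB iP h); rewrite addrK odd_perm1 mul1r.
by apply: prime_prod => // i _; rewrite perm1.
Qed.

End IdealPredicates.

Section Noetherian.

Definition ideal_gen (L : comNzRingType) (s : seq L) : set L :=
  [set x | forall I : set L, is_ideal I -> (forall y, y \in s -> I y) -> I x].

Definition noeth (L : comNzRingType) :=
  forall I : set L, is_ideal I -> exists2 s, (forall y, y \in s -> I y) & I `<=` ideal_gen s.

Lemma ideal_gen_ideal (L : comNzRingType) (s : seq L) : is_ideal (ideal_gen s).
Proof.
split=> [I [I0 _ _] _//|a b ha hb I hI hs|a b hb I hI hs]; have [_ ID IM] := hI.
  by apply: ID; [apply: ha|apply: hb].
by apply: IM; apply: hb.
Qed.

Lemma ideal_genP (L : comNzRingType) (s : seq L) x :
  ideal_gen s x <-> exists c : 'I_(size s) -> L, x = \sum_i c i * s`_i.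
Proof.
split=> [h|[c ->] I hI hs]; last first.
  have [_ _ IM] := hI; apply: ideal_sum => // i _; apply: IM; apply: hs; exact: mem_nth.
apply: (h [set x | exists c : 'I_(size s) -> L, x = \sum_i c i * s`_i]).
  split=> [|_ _ [c ->] [c' ->]|a _ [c ->]].
  - by exists (fun _ => 0); rewrite big1// => i _; rewrite mul0r.
  - exists (fun i => c i + c' i); rewrite -big_split; apply: eq_bigr => i _.
    by rewrite mulrDl.
  - by exists (fun i => a * c i); rewrite mulr_sumr; apply: eq_bigr => i _; rewrite mulrA.
move=> y ys; have iy : (index y s < size s)%N by rewrite index_mem.
exists (fun i => if i == Ordinal iy then 1 else 0).
rewrite (bigD1 (Ordinal iy))//= eqxx mul1r nth_index// big1 ?addr0// => i /negbTE->.
by rewrite mul0r.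
Qed.

Lemma noeth_of_noetherian (L : comNzRingType) : noetherian L -> noeth L.
Proof.
move=> hL I hI; have [I0 ID IM] := hI; have [I1|nI1] := pselect (I 1).
  exists [:: 1] => [y|x _ J [_ _ JM] /(_ 1 (mem_head _ _)) J1].
    by rewrite inE => /eqP->.
  by rewrite -[x]mulr1; apply: JM.
have [|s hs] := hL [pred x | `[< I x >]].
  split; rewrite ?inE; first exact/asboolP.
    by apply/asboolP.
  move=> a x y; rewrite !inE => /asboolP Ix /asboolP Iy; apply/asboolP.
  by apply: ID => //; apply: IM.
have {}hs x : I x <-> ideal_gen s x.
  rewrite ideal_genP -hs inE; split=> [Ix|/asboolP//]; exact/asboolP.
exists s => [y ys|x /hs//]; apply/hs => J _; exact.
Qed.

Lemma noeth_acc (L : comNzRingType) (I : nat -> set L) : noeth L ->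
  (forall n, is_ideal (I n)) -> (forall n, I n `<=` I n.+1) ->
  exists N, forall n, I n `<=` I N.
Proof.
move=> hL hI hS; have mono m n : (m <= n)%N -> I m `<=` I n.
  by move=> /subnK <-; elim: (n - m)%N => // k IHk x /IHk; rewrite addSn; apply: hS.
have [|s hs sI] := hL (\bigcup_n I n).
  split=> [|a b [m _ am] [n _ bn]|a b [n _ bn]].
  - by exists 0%N => //; have [] := hI 0%N.
  - have [_ ID _] := hI (maxn m n); exists (maxn m n) => //; apply: ID.
      exact: mono (leq_maxl _ _) _ am.
    exact: mono (leq_maxr _ _) _ bn.
  - by have [_ _ IM] := hI n; exists n => //; apply: IM.
have [N hN] : exists N, forall y, y \in s -> I N y.
  elim: s hs {sI} => [|y s IHs] hs; first by exists 0%N.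
  have [N hN] := IHs (fun z zs => hs z (mem_behead (s := y :: s) zs)).
  have [n _ yn] := hs y (mem_head _ _); exists (maxn n N) => z.
  rewrite inE => /orP[/eqP->|/hN]; first exact: mono (leq_maxl _ _) _ yn.
  by apply: mono; apply: leq_maxr.
by exists N => n x xn; apply: (sI x); [exists n|exact: hI|].
Qed.

Lemma noeth_field (K : fieldType) : noeth K.
Proof.
move=> I [I0 _ IM]; have [[a [Ia /eqP a0]]|h] := pselect (exists a, I a /\ a <> 0).
  exists [:: a] => [y|x _ J [_ _ JM] /(_ a (mem_head _ _)) Ja].
    by rewrite inE => /eqP->.
  by rewrite -[x](mulfVK a0); apply: JM.
exists [::] => // x Ix; have -> : x = 0 by apply: contrapT => x0; apply: h; exists x.
by have [] := ideal_gen_ideal (L := K) [::].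
Qed.

Lemma noeth_surjective (A B : comNzRingType) (phi : {rmorphism A -> B}) :
  (forall b, exists a, phi a = b) -> noeth A -> noeth B.
Proof.
move=> onto hA J [J0 JD JM].
have [|s hs sJ] := hA [set a | J (phi a)].
  split=> [|a b Ja Jb|a b Jb] /=; first by rewrite rmorph0.
    by rewrite rmorphD; apply: JD.
  by rewrite rmorphM; apply: JM.
exists (map phi s) => [_ /mapP[a /hs Ja ->]//|b Jb I [I0 ID IM] hI].
have [a ab] := onto b; rewrite -ab in Jb *; apply: (sJ a Jb [set a | I (phi a)]).
  split=> [|c d Ic Id|c d Id] /=; first by rewrite rmorph0.
    by rewrite rmorphD; apply: ID.
  by rewrite rmorphM; apply: IM.
by move=> y ys; apply: hI; apply: map_f.
Qed.

(** [L n] collects the coefficients in degree [n] of the elements of [I] of degree at most [n]. This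
    ascending chain stabilizes at some [N], and lifts of generators of [L 0], ..., [L N] suffice to
    cancel every leading term. *)
Theorem hilbert_basis (A : comNzRingType) : noeth A -> noeth {poly A}.
Proof.
move=> hA I hI; have [I0 ID IM] := hI.
pose L n := [set a | exists p, [/\ I p, (size p <= n.+1)%N & p`_n = a]].
have Lid n : is_ideal (L n).
  split=> [|_ _ [p [Ip sp <-]] [q [Iq sq <-]]|a _ [p [Ip sp <-]]].
  - by exists 0; rewrite size_poly0 coef0.
  - exists (p + q); rewrite coefD; split=> //; first exact: ID.
    by apply: leq_trans (size_polyD _ _) _; rewrite geq_max sp.
  - exists (a%:P * p); rewrite coefCM; split=> //; first exact: IM.
    by rewrite mul_polyC; apply: leq_trans (size_scale_leq _ _) _.
have Lmono n : L n `<=` L n.+1.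
  move=> _ [p [Ip sp <-]]; exists ('X * p); rewrite coefXM; split=> //; first exact: IM.
  by rewrite mulrC; apply: leq_trans (size_mul_leq _ _) _; rewrite size_polyX addn2.
have [N hN] := noeth_acc hA Lid Lmono.
have /choice[s hs] n : exists s : seq {poly A}, (forall p, p \in s -> I p /\ (size p <= n.+1)%N) /\
    forall a, L n a -> ideal_gen [seq p`_n | p : {poly A} <- s] a.
  have [t ht tL] := hA _ (Lid n).
  have [s [hs e]] : exists s : seq {poly A},
      (forall p, p \in s -> I p /\ (size p <= n.+1)%N) /\ t = [seq p`_n | p : {poly A} <- s].
    elim: t ht {tL} => [|a t IHt] ht; first by exists [::].
    have [s [hs ->]] := IHt (fun z zs => ht z (mem_behead (s := a :: t) zs)).
    have [p [Ip sp pa]] := ht a (mem_head _ _); exists (p :: s); rewrite /= pa; split=> // q.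
    by rewrite inE => /orP[/eqP->|/hs].
  by exists s; split=> // a /tL; rewrite e.
pose S := flatten [seq s n | n <- iota 0 N.+1].
have sS n p : (n <= N)%N -> p \in s n -> p \in S.
  by move=> nN ps; apply/flattenP; exists (s n) => //; apply: map_f; rewrite mem_iota.
exists S => [p /flattenP[_ /mapP[n _ ->]] /(hs n).1[]//|p].
have gS := ideal_gen_ideal S; have [g0 gD gM] := gS.
have memS q : q \in S -> ideal_gen S q by move=> qS J _; apply.
have [k] := ubnP (size p); elim: k p => // k IHk p; rewrite ltnS => pk Ip.
have [->//|p0] := eqVneq p 0.
pose n := (size p).-1; have sp : size p = n.+1 by rewrite prednK// lt0n size_poly_eq0.
pose n' := minn n N; have n'n : (n' <= n)%N by apply: geq_minl.
have Lp : L n' p`_n.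
  have Ln : L n p`_n by exists p; rewrite sp.
  rewrite /n'; have [le|lt] := leqP n N; last exact: hN Ln.
  exact: Ln.
have {Lp}/ideal_genP[c hc] := (hs n').2 _ Lp; rewrite size_map in c hc.
pose q := \sum_(i < size (s n')) (c i)%:P * ('X^(n - n') * (s n')`_i).
have Iq : I q /\ ideal_gen S q.
  split; apply: ideal_sum => // i _.
    by apply: (IM); apply: (IM); have [] := (hs n').1 _ (mem_nth 0 (ltn_ord i)).
  by apply: (gM); apply: (gM); apply: memS; apply: sS (geq_minr _ _) (mem_nth 0 (ltn_ord i)).
have -> : p = (p - q) + q by rewrite subrK.
apply: (gD) Iq.2; apply: IHk; last by apply: idealB => //; case: Iq.
apply: leq_trans pk; rewrite sp ltnS; apply/leq_sizeP => j.
have sq : (size q <= n.+1)%N.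
  apply: leq_trans (size_sum _ _ _) _; apply/bigmax_leqP => i _; rewrite mul_polyC.
  apply: leq_trans (size_scale_leq _ _) _; apply: leq_trans (size_mul_leq _ _) _.
  rewrite size_polyXn addSn /=; have [_ le] := (hs n').1 _ (mem_nth 0 (ltn_ord i)).
  by apply: leq_trans (leq_add (leqnn _) le) _; rewrite addnS subnK.
rewrite leq_eqVlt => /orP[/eqP<-|lt].
  rewrite coefB hc /q coef_sum; apply/eqP; rewrite subr_eq0; apply/eqP; apply: eq_bigr => i _.
  rewrite coefCM coefXnM ltnNge leq_subr /= subKn//.
  by rewrite (nth_map 0).
by rewrite coefB !nth_default ?subrr// ?sp// (leq_trans sq).
Qed.

End Noetherian.

(** * Extension of derivations by one element *)

Section TwistedDerivations.
Variable S : comNzRingType.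
Hypothesis dom : forall a b : S, a * b = 0 -> a = 0 \/ b = 0.
Hypothesis char0 : forall n, (0 < n)%N -> n%:R != 0 :> S.

Lemma dom_mulI (a b c : S) : a != 0 -> a * b = a * c -> b = c.
Proof.
move=> a0 /eqP; rewrite -subr_eq0 -mulrBr => /eqP/dom[/eqP|/eqP].
  by rewrite (negbTE a0).
by rewrite subr_eq0 => /eqP.
Qed.

Lemma dom_neq0 (a b : S) : a != 0 -> b != 0 -> a * b != 0.
Proof. by move=> a0 b0; apply/eqP => /dom[] /eqP; apply/negP. Qed.

Lemma dom_prod_neq0 (I : finType) (F : I -> S) : (forall i, F i != 0) -> \prod_i F i != 0.
Proof.
by move=> h; apply: (big_ind (fun v => v != 0)) => //; [exact: oner_neq0|exact: dom_neq0].
Qed.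

(** A derivation of the image of [phi] with values in [S], described on a presentation [T];
    [twder_ker] makes it descend, so that the image ring is never formed. *)
Record twisted_derivation (T : comNzRingType) (phi : {rmorphism T -> S}) (d : T -> S) : Prop :=
  TwistedDerivation {
    twder_add : zmod_morphism d;
    twder_mul : forall a b, d (a * b) = phi a * d b + phi b * d a;
    twder_ker : forall a, phi a = 0 -> d a = 0
  }.

Definition adjoin (T : comNzRingType) (phi : {rmorphism T -> S}) (u : S) :
  {rmorphism {poly T} -> S} := horner_eval u \o map_poly phi.

Lemma adjoinE (T : comNzRingType) (phi : {rmorphism T -> S}) u p : adjoin phi u p = (map_poly phi p).[u].
Proof. by []. Qed.

Lemma size_cancel_lead (p g : {poly S}) : p != 0 -> g != 0 -> (size g <= size p)%N ->
  (size (lead_coef g *: p - lead_coef p *: ('X^(size p - size g) * g))%R < size p)%N.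
Proof.
move=> p0 g0 gp; have sp : (0 < size p)%N by rewrite lt0n size_poly_eq0.
have sg : (0 < size g)%N by rewrite lt0n size_poly_eq0.
rewrite -[X in (_ < X)%N](prednK sp) ltnS; apply/leq_sizeP => i; rewrite leq_eqVlt => /orP[/eqP<-|lt].
  rewrite coefB !coefZ coefXnM ifF; last by apply/negbTE; lia.
  have -> : ((size p).-1 - (size p - size g) = (size g).-1)%N.
    by move: (size p) (size g) gp sp sg => a b; lia.
  by rewrite mulrC -/(lead_coef p) -/(lead_coef g) subrr.
have pi : (size p <= i)%N by rewrite -(prednK sp).
rewrite coefB !coefZ coefXnM ifF; last first.
  by apply/negbTE; rewrite -leqNgt (leq_trans (leq_subr _ _)).
have -> : p`_i = 0 by apply: nth_default.
have -> : g`_(i - (size p - size g)) = 0.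
  by apply: nth_default; rewrite leq_subRL ?subnK// (leq_trans (leq_subr _ _)).
by rewrite !mulr0 subrr.
Qed.

(* [d] extends to [T[X]] once scaled: with [g] a polynomial of minimal degree killing [u],
   [s = g'(u)] clears the denominator of the value [- g^d(u) / g'(u)] forced at [u]. *)
Lemma twisted_derivation_step (T : comNzRingType) (phi : {rmorphism T -> S}) (d : T -> S) (u : S) :
  twisted_derivation phi d ->
  exists s d', [/\ s != 0, twisted_derivation (adjoin phi u) d',
    forall a, d' a%:P = s * d a &
    (forall p, adjoin phi u p = 0 -> map_poly phi p = 0) -> d' 'X != 0].
Proof.
move=> [dadd dmul dker]; pose dA : {additive T -> S} :=
  HB.pack d (GRing.isZmodMorphism.Build T S d dadd).
have d1 : dA 1 = 0.
  have := dmul 1 1; rewrite mulr1 rmorph1 mul1r -[d 1]/(dA 1) => /eqP.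
  by rewrite -subr_eq0 opprD addrA subrr sub0r oppr_eq0 => /eqP.
pose Th s c (p : {poly T}) := s * (map_poly dA p).[u] + (map_poly phi p)^`().[u] * c.
have Tadd s c : zmod_morphism (Th s c).
  move=> p q; have mB : map_poly dA (p - q) = map_poly dA p - map_poly dA q.
    by apply/polyP => i; rewrite coefB !coef_map coefB raddfB.
  by rewrite /Th mB rmorphB derivB !(hornerD, hornerN); ring.
have Tmul s c p q : Th s c (p * q) =
    adjoin phi u p * Th s c q + adjoin phi u q * Th s c p.
  have E : map_poly dA (p * q) = map_poly phi p * map_poly dA q + map_poly phi q * map_poly dA p.
    apply/polyP => i; rewrite coefD coef_map coefM [map_poly phi q * _]mulrC !coefM raddf_sum -big_split.
    by apply: eq_bigr => j _; rewrite !coef_map [LHS]dmul [X in _ = _ + X]mulrC.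
  by rewrite /Th E !adjoinE rmorphM derivM !(hornerD, hornerM); ring.
have TC s c a : Th s c a%:P = s * d a.
  by rewrite /Th !map_polyC derivC !hornerC ?horner0 mul0r addr0.
have TX s c : Th s c 'X = c.
  rewrite /Th map_polyX derivX hornerC mul1r (_ : map_poly dA 'X = 0) ?horner0 ?mulr0 ?add0r//.
  apply/polyP => i; rewrite coef_map coefX coef0; case: eqP => _; [exact: d1|exact: raddf0].
have T0 s c p : map_poly phi p = 0 -> Th s c p = 0.
  move=> p0; rewrite /Th p0 deriv0 horner0 mul0r addr0 (_ : map_poly dA p = 0) ?horner0 ?mulr0//.
  apply/polyP => i; rewrite coef_map coef0; apply: dker.
  by have := congr1 (fun q : {poly S} => q`_i) p0; rewrite coef_map coef0.
have [tr|ntr] := pselect (forall p, adjoin phi u p = 0 -> map_poly phi p = 0).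
  exists 1, (Th 1 1); split=> //; first exact: oner_neq0.
    by split=> // p /tr; apply: T0.
  by move=> _; rewrite TX oner_neq0.
have ex : exists n, `[< exists G, [/\ adjoin phi u G = 0, map_poly phi G != 0 &
    size (map_poly phi G) = n] >].
  move/existsNP: ntr => [G /not_implyP[uG /eqP G0]].
  by exists (size (map_poly phi G)); apply/asboolP; exists G.
case: (ex_minnP ex) => n /asboolP[G [uG G0 sG]] minG; set g := map_poly phi G in G0 sG *.
have {}minG p : adjoin phi u p = 0 -> (size (map_poly phi p) < n)%N -> map_poly phi p = 0.
  move=> up; rewrite ltnNge => /negP h; apply/eqP/negPn/negP => p0; apply: h; apply: minG.
  by apply/asboolP; exists p.
have n1 : (1 < n)%N.
  rewrite ltnNge; apply/negP; rewrite -sG => /size1_polyC gC.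
  by move: uG G0; rewrite adjoinE -/g gC hornerC => ->; rewrite polyC0 eqxx.
pose s := g^`().[u]; pose c := - (map_poly dA G).[u].
(* By minimality of [g], [g'(u) = 0] would force [g' = 0], which characteristic zero excludes. *)
have s0 : s != 0.
  apply/eqP => s0; have g'0 : g^`() = 0.
    rewrite /g deriv_map; apply: minG; first by rewrite adjoinE -deriv_map.
    by rewrite -deriv_map -/g -sG lt_size_deriv.
  have := congr1 (fun q : {poly S} => q`_n.-2) g'0; rewrite coef0 coef_deriv.
  rewrite -mulr_natr => /dom[|/eqP]; last by apply/negP; apply: char0.
  have -> : n.-2.+1 = n.-1 by lia.
  by move/eqP; rewrite -sG -/(lead_coef g) lead_coef_eq0 (negbTE G0).
have TG : Th s c G = 0 by rewrite /Th -/g -/s /c mulrN subrr.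
exists s, (Th s c); split=> //.
(* The extension kills every relation [p] of [u]: cancel its leading term against [G] after scaling,
   then remove the scaling factor, which is nonzero in the domain [S]. *)
split=> // p; have [k] := ubnP (size (map_poly phi p)).
elim: k p => // k IHk p; rewrite ltnS => pk up.
have [p0|p0] := eqVneq (map_poly phi p) 0; first exact: T0.
have np : (n <= size (map_poly phi p))%N.
  by rewrite leqNgt; apply/negP => /(minG _ up)/eqP; apply/negP.
pose e := (size (map_poly phi p) - n)%N.
pose lG := G`_n.-1; pose lp := p`_(size (map_poly phi p)).-1.
have ulG : phi lG = lead_coef g by rewrite /lG -coef_map -sG.
have ulp : phi lp = lead_coef (map_poly phi p) by rewrite /lp -coef_map.
pose q := lG%:P * p - lp%:P * ('X^e * G).
have uq : adjoin phi u q = 0.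
  by rewrite /q rmorphB !rmorphM up uG !mulr0 subrr.
have mq : map_poly phi q = lead_coef g *: map_poly phi p -
    lead_coef (map_poly phi p) *: ('X^e * g).
  by rewrite /q rmorphB !rmorphM /= map_polyXn !map_polyC /= ulG ulp !mul_polyC.
have Tq : Th s c q = 0.
  apply: IHk => //; apply: leq_trans pk; rewrite mq /e -sG.
  by apply: size_cancel_lead => //; rewrite sG.
move: Tq; rewrite /q Tadd !Tmul TG uG up rmorphM uG !(mulr0, mul0r, addr0, oppr0).
rewrite adjoinE map_polyC hornerC /= ulG => /dom[/eqP|//].
by rewrite lead_coef_eq0 (negbTE G0).
Qed.

End TwistedDerivations.

(** * Separating derivations *)

Section GeneratedSubrings.
Variables (K : fieldType) (S : comNzRingType) (iota : {rmorphism K -> S}).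

Definition subring (A : set S) :=
  [/\ forall k, A (iota k), forall a b, A a -> A b -> A (a + b) &
      forall a b, A a -> A b -> A (a * b)].

Definition coefs_in (A : set S) (p : {poly S}) := forall i, A p`_i.

(** The subring generated by [l] over [K], the head being adjoined last. The recursion follows
    towers of polynomial rings, which serves both presentations and algebraic independence. *)
Fixpoint sub (l : seq S) : set S :=
  if l is u :: l' then [set v | exists p, coefs_in (sub l') p /\ v = p.[u]] else range iota.

Lemma sub_subring l : subring (sub l).
Proof.
elim: l => [|u l [lk lD lM]] /=.
  split; first by move=> k; exists k.
    by move=> _ _ [a _ <-] [b _ <-]; exists (a + b); rewrite ?rmorphD.
  by move=> _ _ [a _ <-] [b _ <-]; exists (a * b); rewrite ?rmorphM.
have l0 : sub l 0 by rewrite -(rmorph0 iota).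
split.
- move=> k; exists (iota k)%:P; rewrite hornerC; split=> // i.
  by rewrite coefC; case: eqP.
- move=> _ _ [p [hp ->]] [q [hq ->]]; exists (p + q); rewrite hornerD; split=> // i.
  by rewrite coefD; apply: (lD).
- move=> _ _ [p [hp ->]] [q [hq ->]]; exists (p * q); rewrite hornerM; split=> // i.
  by rewrite coefM; apply: (big_ind (sub l)) => // j _; apply: (lM).
Qed.

Lemma subring0 (A : set S) : subring A -> A 0.
Proof. by move=> [h _ _]; rewrite -(rmorph0 iota). Qed.

Lemma subring1 (A : set S) : subring A -> A 1.
Proof. by move=> [h _ _]; rewrite -(rmorph1 iota). Qed.

Lemma sub_cons u l : sub l `<=` sub (u :: l).
Proof.
move=> v lv; exists v%:P; rewrite hornerC; split=> // i.
by rewrite coefC; case: eqP => // _; apply: subring0 (sub_subring l).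
Qed.

Lemma sub_head u l : sub (u :: l) u.
Proof.
exists 'X; rewrite hornerX; split=> // i; rewrite coefX.
by case: eqP => _; [apply: subring1 (sub_subring l)|apply: subring0 (sub_subring l)].
Qed.

Lemma mem_sub l v : v \in l -> sub l v.
Proof.
elim: l => // u l IHl; rewrite inE => /orP[/eqP->|/IHl]; [exact: sub_head|exact: sub_cons].
Qed.

Lemma sub_min l (A : set S) : subring A -> (forall v, v \in l -> A v) -> sub l `<=` A.
Proof.
move=> hA; have [Ak AD AM] := hA; elim: l => [_ _ [k _ <-]//|u l IHl h v [p [hp ->]]].
rewrite horner_coef; apply: (big_ind A) => [|//|i _]; first exact: subring0 hA.
apply: (AM); first by apply: IHl (hp i) => w wl; apply: (h); rewrite inE wl orbT.
elim: (i : nat) => [|j IHj]; first by rewrite expr0; apply: subring1 hA.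
by rewrite exprS; apply: (AM) => //; apply: (h); rewrite mem_head.
Qed.

Lemma sub_presentation l :
  exists (T : comNzRingType) (phi : {rmorphism T -> S}), range phi = sub l /\ noeth T.
Proof.
elim: l => [|u l [T [phi [hphi nT]]]].
  by exists K, iota; split=> //; apply: noeth_field.
exists {poly T}, (adjoin phi u); split; last exact: hilbert_basis.
apply/seteqP; split.
  move=> _ [p _ <-]; exists (map_poly phi p); split=> // i.
  suff : sub l (map_poly phi p)`_i by [].
  by rewrite coef_map -hphi; exists p`_i.
move=> _ [p [hp ->]]; have /choice[c hc] : forall i, exists t, phi t = p`_i.
  by move=> i; have : sub l p`_i := hp i; rewrite -hphi => -[t _ e]; exists t.
exists (\poly_(i < size p) c i) => //; rewrite adjoinE; congr _.[_].
apply/polyP => i; rewrite coef_map coef_poly; case: ltnP => [_|le]; first exact: hc.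
by rewrite nth_default//; exact: rmorph0.
Qed.

Definition derivation (D : S -> S) :=
  [/\ forall a b, D (a + b) = D a + D b, forall a b, D (a * b) = a * D b + b * D a &
      forall k, D (iota k) = 0].

Lemma derivation0 D : derivation D -> D 0 = 0.
Proof. by move=> [_ _ h]; rewrite -[X in D X](rmorph0 iota) h. Qed.

Lemma derivation_sum D I (r : seq I) (P : pred I) (F : I -> S) : derivation D ->
  D (\sum_(i <- r | P i) F i) = \sum_(i <- r | P i) D (F i).
Proof.
move=> hD; have [DD _ _] := hD; apply: big_morph => //; exact: derivation0 hD.
Qed.

Lemma derivationX D a n : derivation D -> D (a ^+ n) = n%:R * a ^+ n.-1 * D a.
Proof.
move=> hD; have [_ DM Dk] := hD; elim: n => [|n IHn].
  by rewrite expr0 -(rmorph1 iota) Dk !mul0r.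
rewrite exprS DM IHn; case: n {IHn} => [|n]; first by rewrite expr0; ring.
by rewrite /= exprS -!natr1; ring.
Qed.

Lemma derivation_horner D (p : {poly S}) u : derivation D ->
  D p.[u] = p^`().[u] * D u + \sum_(i < size p) D p`_i * u ^+ i.
Proof.
move=> hD; have [DD DM _] := hD.
rewrite horner_coef derivation_sum//.
under eq_bigr do rewrite DM derivationX//.
rewrite big_split; congr (_ + _); last by apply: eq_bigr => i _; rewrite mulrC.
case E : (size p) => [|s].
  by rewrite big_ord0; move/eqP: E; rewrite size_poly_eq0 => /eqP->; rewrite deriv0 horner0 mul0r.
rewrite (@horner_coef_wide _ s); last first.
  by apply/leq_sizeP => i si; rewrite coef_deriv nth_default ?mul0rn// E ltnS.
rewrite big_ord_recl /=. rewrite mulr0n !mul0r mulr0 add0r mulr_suml. apply: eq_bigr => i _.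
by rewrite coef_deriv -mulr_natr /bump /= add1n; ring.
Qed.

(** The coefficients do not depend on [D]: this takes the place of the module of differentials. *)
Lemma derivation_span l v : sub l v -> exists c : 'I_(size l) -> S,
  forall D, derivation D -> D v = \sum_i c i * D l`_i.
Proof.
pose A := [set v | exists c : 'I_(size l) -> S,
  forall D, derivation D -> D v = \sum_i c i * D l`_i].
apply: (@sub_min l A); first split.
- move=> k; exists (fun _ => 0) => D hD; rewrite big1 => [|i _]; last by rewrite mul0r.
  by have [_ _ ->] := hD.
- move=> a b [c hc] [c' hc']; exists (fun i => c i + c' i) => D hD; have [DD _ _] := hD.
  by rewrite DD hc// hc'// -big_split; apply: eq_bigr => i _; rewrite mulrDl.
- move=> a b [c hc] [c' hc']; exists (fun i => a * c' i + b * c i) => D hD.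
  have [_ DM _] := hD; rewrite DM hc// hc'// !mulr_sumr -big_split.
  by apply: eq_bigr => i _ /=; ring.
- move=> u ul; have iu : (index u l < size l)%N by rewrite index_mem.
  exists (fun i => if i == Ordinal iu then 1 else 0) => D _.
  rewrite (bigD1 (Ordinal iu))//= eqxx mul1r nth_index// big1 ?addr0// => i /negbTE->.
  by rewrite mul0r.
Qed.

Hypothesis dom : forall a b : S, a * b = 0 -> a = 0 \/ b = 0.
Hypothesis char0 : forall n, (0 < n)%N -> n%:R != 0 :> S.

Lemma twisted_derivation_extend (xs : seq S) (T : comNzRingType) (phi : {rmorphism T -> S}) d :
  twisted_derivation phi d ->
  exists (T' : comNzRingType) (phi' : {rmorphism T' -> S}) d' (j : T -> T') s,
    [/\ twisted_derivation phi' d', s != 0, forall t, phi' (j t) = phi t,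
        forall t, d' (j t) = s * d t & forall v, v \in xs -> range phi' v].
Proof.
elim: xs T phi d => [|x xs IHxs] T phi d hd.
  exists T, phi, d, id, 1; split=> //; first exact: oner_neq0.
  by move=> t; rewrite mul1r.
have [s [d1 [s0 hd1 d1C _]]] := twisted_derivation_step dom char0 x hd.
have [T' [phi' [d' [j [s' [hd' s'0 jphi jd hxs]]]]]] := IHxs _ _ _ hd1.
exists T', phi', d', (j \o polyC), (s' * s); split=> //.
- exact: dom_neq0.
- by move=> t; rewrite /= jphi adjoinE map_polyC hornerC.
- by move=> t; rewrite /= jd d1C mulrA.
- move=> v; rewrite inE => /orP[/eqP->|/hxs//].
  by exists (j 'X) => //; rewrite jphi adjoinE map_polyX hornerX.
Qed.

Definition transcendental (A : set S) a := forall p, coefs_in A p -> p.[a] = 0 -> p = 0.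

(** Start from zero on a presentation of [sub l], choose a nonzero value at [a], which transcendence
    permits, and extend through the generators [xs] up to a nonzero factor. The result kills the
    kernel of a presentation of [S], hence descends. *)
Lemma separating_derivation xs l a : (forall v, sub xs v) -> transcendental (sub l) a ->
  exists D, [/\ derivation D, forall v, sub l v -> D v = 0 & D a != 0].
Proof.
move=> gen tr; have [T [phi [hphi _]]] := sub_presentation l.
have h0 : twisted_derivation phi (fun _ => 0).
  by split=> // [x y|x y]; rewrite ?subrr ?mulr0 ?addr0.
have [s [d1 [s0 hd1 d1C d1X]]] := twisted_derivation_step dom char0 a h0.
have {}d1X : d1 'X != 0.
  apply: d1X => p; rewrite adjoinE; apply: tr => i.
  by rewrite coef_map -hphi; exists p`_i.
have [T' [phi' [d' [j [s' [[dadd dmul dker] s'0 jphi jd hxs]]]]]] := twisted_derivation_extend xs hd1.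
have d'0 : d' 0 = 0 by rewrite -[0 in LHS](subrr 0) dadd subrr.
have jl v : sub l v -> exists t, phi' (j t%:P) = v /\ d' (j t%:P) = 0.
  rewrite -hphi => -[t _ <-]; exists t; rewrite jphi adjoinE map_polyC hornerC; split=> //.
  by rewrite jd d1C !mulr0.
have onto v : exists t, phi' t = v.
  suff : sub xs `<=` range phi' by move=> /(_ v (gen v))[t _ e]; exists t.
  apply: sub_min => //; split.
  - by move=> k; have [/(_ k) /jl[t [e _]] _ _] := sub_subring l; exists (j t%:P).
  - by move=> _ _ [x _ <-] [y _ <-]; exists (x + y); rewrite ?rmorphD.
  - by move=> _ _ [x _ <-] [y _ <-]; exists (x * y); rewrite ?rmorphM.
have wd t t' : phi' t = phi' t' -> d' t = d' t'.
  move=> e; apply/eqP; rewrite -subr_eq0 -dadd dker//.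
  by rewrite rmorphB e subrr.
have /choice[r hr] := onto; have dD x y : d' (x + y) = d' x + d' y.
  by rewrite -{1}[y]opprK dadd -[- y]sub0r dadd d'0 sub0r opprK.
exists (d' \o r); split=> [||].
- split=> [x y|x y|k] /=.
  + by rewrite -dD; apply: wd; rewrite rmorphD !hr.
  + rewrite -[X in X * _ + _]hr -[X in _ + X * _]hr -dmul; apply: wd.
    by rewrite rmorphM !hr.
  + have [/(_ k) /jl[t [e <-]] _ _] := sub_subring l.
    by apply: wd; rewrite hr.
- by move=> v /jl[t [e <-]]; apply: wd; rewrite hr.
- rewrite /= (_ : d' (r a) = d' (j 'X)); first by rewrite jd; apply: dom_neq0.
  by apply: wd; rewrite hr jphi adjoinE map_polyX hornerX.
Qed.

End GeneratedSubrings.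

(** * Charts at regular primes *)

Section Charts.
Variables (K : fieldType) (S : comNzRingType) (iota : {rmorphism K -> S}).
Local Notation sub := (sub iota).
Local Notation derivation := (derivation iota).
Local Notation transcendental := (@transcendental S).

(* Algebraic independence modulo [q], read from the end of the list to its head. *)
Fixpoint indep_mod (q : set S) (l : seq S) : Prop :=
  if l is u :: l' then indep_mod q l' /\
    (forall p, coefs_in (sub l') p -> q p.[u] -> p = 0) else True.

Lemma indep_mod_sub0 q l v : is_prime q -> indep_mod q l -> sub l v -> q v -> v = 0.
Proof.
move=> [[_ _ qM] q1 _]; case: l => [_ [k _ <-] qk|u l [_ h] [p [hp ->]] /(h p hp)->].
  have [->|k0] := eqVneq k 0; first by rewrite rmorph0.
  by case: q1; rewrite -(rmorph1 iota) -(mulVf k0) rmorphM; apply: qM.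
by rewrite horner0.
Qed.

Lemma indep_mod_anti (p q : set S) l : p `<=` q -> indep_mod q l -> indep_mod p l.
Proof.
move=> pq; elim: l => // u l IHl [/IHl hl h]; split=> // r hr /pq; exact: h.
Qed.

(** A relation of [b] modulo [p] has its constant term in [q], because [b] lies there; by
    independence modulo [q] that term is 0, and since [b] is outside [p] the relation can be divided
    by [b]. *)
Lemma indep_mod_cons (p q : set S) b l : is_prime p -> is_prime q -> p `<=` q ->
  q b -> ~ p b -> indep_mod q l -> indep_mod p (b :: l).
Proof.
move=> pp pq sub_pq qb npb hl; split; first exact: indep_mod_anti hl.
have [iq _ _] := pq; have [_ _ qM] := iq; have [ip _ pP] := pp.
elim/poly_ind => // r c IHr hr; rewrite hornerMXaddC => h.
have rc : sub l c by have := hr 0%N; rewrite coefD coefMX coefC add0r.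
have rr : coefs_in (sub l) r.
  by move=> i; have := hr i.+1; rewrite coefD coefMX coefC addr0.
have c0 : c = 0.
  apply: (indep_mod_sub0 pq hl rc).
  have -> : c = (r.[b] * b + c) - r.[b] * b by rewrite addrC addKr.
  by apply: (idealB iq (sub_pq _ h)); apply: qM.
move: h; rewrite c0 addr0 => h; have [|//] := pP _ _ h.
by move=> /(IHr rr)->; rewrite mul0r add0r.
Qed.

(** Each strict inclusion of primes contributes one more independent element; in this form the Krull
    dimension enters the charts. *)
Lemma indep_mod_chain d (p : nat -> set S) z :
  (forall i, (i <= d)%N -> is_prime (p i)) ->
  (forall i, (i < d)%N -> p i `<=` p i.+1 /\ exists b, p i.+1 b /\ ~ p i b) ->
  indep_mod (p d) z -> exists2 l, size l = d & indep_mod (p 0%N) (l ++ z).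
Proof.
elim: d z => [|d IHd] z hp hs hz; first by exists [::].
have [sd [b [pb npb]]] := hs d (leqnn _).
have hl := indep_mod_cons (hp d (leqnSn d)) (hp d.+1 (leqnn _)) sd pb npb hz.
have [||l <- {}hl] := IHd (b :: z) _ _ hl.
- by move=> i id; apply: hp; apply: leqW.
- by move=> i id; apply: hs; apply: leqW.
- by exists (rcons l b); rewrite ?size_rcons// cat_rcons.
Qed.

Lemma subringN (A : set S) a : subring iota A -> A a -> A (- a).
Proof.
move=> [Ak _ AM] Aa; rewrite -mulN1r -(rmorph1 iota) -rmorphN; exact: AM.
Qed.

Lemma transcendence_basis_mod (P : set S) (xs : seq S) : is_prime P ->
  exists z, indep_mod P z /\
    forall x, x \in xs -> exists p, [/\ coefs_in (sub z) p, P p.[x] & p != 0].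
Proof.
move=> hP; elim: xs => [|x xs [z [hz hx]]]; first by exists [::].
have [[p [hp Pp p0]]|np] := pselect (exists p, [/\ coefs_in (sub z) p, P p.[x] & p != 0]).
  by exists z; split=> // v; rewrite inE => /orP[/eqP->|/hx//]; exists p.
exists (x :: z); split.
  split=> // p hp Pp; apply/eqP/negPn/negP => p0; apply: np; by exists p.
move=> v; rewrite inE => /orP[/eqP->|/hx[p [hp Pp p0]]].
  have [s0 s1] := (subring0 (sub_subring iota (x :: z)), subring1 (sub_subring iota (x :: z))).
  exists ('X - x%:P); split.
  - move=> i; rewrite coefB coefX coefC.
    have [_ sD _] := sub_subring iota (x :: z); apply: sD; first by case: eqP.
    by apply: subringN (sub_subring _ _) _; case: eqP => // _; apply: sub_head.
  - by rewrite !hornerE subrr; have [[]] := hP.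
  - by rewrite polyXsubC_eq0.
by exists p; split=> // i; apply: sub_cons; apply: hp.
Qed.

Hypothesis charK0 : [pchar K] =i pred0.

Lemma mulrn_inj0 (a : S) n : (0 < n)%N -> a *+ n = 0 -> a = 0.
Proof.
move=> n0 e; rewrite -[a]mulr1 -(rmorph1 iota) -(mulfV (natr_neq0 charK0 n0)).
by rewrite rmorphM rmorph_nat mulrA mulr_natr e mul0r.
Qed.

Lemma transcendence_basis_separable (P : set S) z x : is_prime P -> indep_mod P z ->
  (exists p, [/\ coefs_in (sub z) p, P p.[x] & p != 0]) ->
  exists p, [/\ coefs_in (sub z) p, P p.[x] & ~ P p^`().[x]].
Proof.
move=> hP hz [p0 [hp0 Pp0 p00]].
have ex : exists n, `[< exists p, [/\ coefs_in (sub z) p, P p.[x], p != 0 & size p = n] >].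
  by exists (size p0); apply/asboolP; exists p0.
case: (ex_minnP ex) => n /asboolP[p [hp Pp pn0 sp]] minp; exists p; split=> // Pp'.
have p'0 : p^`() = 0.
  apply/eqP/negPn/negP => p'0; suff : (n <= size p^`())%N by rewrite leqNgt -sp lt_size_deriv.
  apply: minp; apply/asboolP; exists p^`(); split=> // i; rewrite coef_deriv -mulr_natr.
  have [sk _ sM] := sub_subring iota z; apply: sM => //.
  by rewrite -(rmorph_nat iota).
have /size1_polyC pC : (size p <= 1)%N.
  rewrite leqNgt; apply/negP => n1.
  have := congr1 (fun q : {poly S} => q`_(size p).-2) p'0; rewrite coef0 coef_deriv.
  have -> : ((size p).-2.+1 = (size p).-1)%N by move: n1; case: (size p) => [|[]].
  move=> /mulrn_inj0; rewrite -/(lead_coef p) => h.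
  have /eqP : lead_coef p = 0 by apply: h; move: n1; case: (size p) => [|[]].
  by rewrite lead_coef_eq0 (negbTE pn0).
case/eqP: pn0; rewrite pC (indep_mod_sub0 hP hz (hp 0%N)) ?polyC0//.
by move: Pp; rewrite pC hornerC coefC eqxx.
Qed.

Hypothesis dom : forall a b : S, a * b = 0 -> a = 0 \/ b = 0.

Let char0 n : (0 < n)%N -> n%:R != 0 :> S.
Proof. by move=> n0; apply/eqP => e; have /eqP := mulrn_inj0 n0 e; rewrite oner_eq0. Qed.

Lemma derivation_algebraic z (p : {poly S}) u : coefs_in (sub z) p ->
  exists c : 'I_(size z) -> S, forall D, derivation D ->
    D p.[u] = p^`().[u] * D u + \sum_j c j * D z`_j.
Proof.
move=> hp; have /choice[c hc] : forall i, exists c : 'I_(size z) -> S,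
    forall D, derivation D -> D p`_i = \sum_j c j * D z`_j.
  by move=> i; apply: derivation_span (hp i).
exists (fun j => \sum_(i < size p) c i j * u ^+ i) => D hD.
rewrite (derivation_horner p u hD); congr (_ + _).
under eq_bigr do rewrite (hc _ _ hD) mulr_suml.
rewrite exchange_big; apply: eq_bigr => j _; rewrite mulr_suml; apply: eq_bigr => i _.
by ring.
Qed.

(* Every derivation [D] satisfies [h D(a) = sum_j A_j(a) D(t_j)] when [P] is cut out locally
   by the [y_l] and [z] is a transcendence basis of the residue field, [t = (y, z)]. *)
Lemma derivation_relation (P : set S) xs d (y : 'I_d -> S) : is_prime P ->
  (forall v, sub xs v) -> (forall l, P (y l)) ->
  (forall v, P v -> exists u, ~ P u /\ exists c : 'I_d -> S, u * v = \sum_l c l * y l) ->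
  exists z, indep_mod P z /\ exists2 h, ~ P h &
    forall a, exists (A : 'I_d -> S) (B : 'I_(size z) -> S), forall D, derivation D ->
      h * D a = \sum_l A l * D (y l) + \sum_j B j * D z`_j.
Proof.
move=> hP gen Py cut; have [z [hz hx]] := transcendence_basis_mod xs hP; exists z; split=> //.
have [iP _ PP] := hP; have [P0 PD PM] := iP; pose m := size xs.
have /choice[p hp] : forall i : 'I_m, exists p : {poly S},
    [/\ coefs_in (sub z) p, P p.[xs`_i] & ~ P p^`().[xs`_i]].
  by move=> i; apply: (transcendence_basis_separable hP hz); apply: hx; apply: mem_nth.
have /choice[u hu] : forall i, exists u, ~ P u /\ exists c : 'I_d -> S,
    u * (p i).[xs`_i] = \sum_l c l * y l.
  by move=> i; apply: cut; have [] := hp i.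
have /choice[a ha] : forall i, exists c : 'I_d -> S, u i * (p i).[xs`_i] = \sum_l c l * y l.
  by move=> i; have [] := hu i.
have /choice[b hb] : forall i, exists c : 'I_(size z) -> S, forall D, derivation D ->
    D (p i).[xs`_i] = (p i)^`().[xs`_i] * D xs`_i + \sum_j c j * D z`_j.
  by move=> i; apply: derivation_algebraic; have [] := hp i.
have span v : exists c : 'I_m -> S, forall D, derivation D -> D v = \sum_k c k * D xs`_k.
  exact: derivation_span (gen v).
have /choice[cu hcu] := fun i => span (u i).
have /choice[ca hca] := fun il : 'I_m * 'I_d => span (a il.1 il.2).
(* Differentiating the equations [ha] gives a linear system for the values of [D] on the generators.
   Modulo [P] its matrix is diagonal, with entries [u i * p_i'(x_i)] outside [P], so Cramer's rule
   has a determinant outside [P]. *)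
pose M : 'M[S]_m := \matrix_(i, k) ((i == k)%:R * (u i * (p i)^`().[xs`_i]) +
  ((p i).[xs`_i] * cu i k - \sum_l y l * ca (i, l) k)).
have PM2 i k : P ((p i).[xs`_i] * cu i k - \sum_l y l * ca (i, l) k).
  have [_ Pp _] := hp i; apply: idealB => //; first by rewrite mulrC; apply: (PM).
  by apply: ideal_sum => // l _; rewrite mulrC; apply: (PM).
pose h := \det M; exists h.
  apply: det_notin_prime => // [i k ik|i].
    by rewrite mxE (negbTE ik) mul0r add0r.
  rewrite mxE eqxx mul1r => hi; have [_ _ np] := hp i; have [nu _] := hu i.
  have := idealB iP hi (PM2 i i); rewrite addrK => /PP[]//.
have MD D i : derivation D -> \sum_k M i k * D xs`_k =
    \sum_l a i l * D (y l) - u i * \sum_j b i j * D z`_j.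
  move=> hD; have [_ DM _] := hD.
  have E : D (u i * (p i).[xs`_i]) = D (\sum_l a i l * y l) by rewrite ha.
  rewrite DM (hb i D hD) (hcu i D hD) (derivation_sum _ _ _ hD) in E.
  have E2 : \sum_l D (a i l * y l) = \sum_l a i l * D (y l) +
      \sum_k (\sum_l y l * ca (i, l) k) * D xs`_k.
    under eq_bigr do rewrite DM (hca (i, _) D hD).
    rewrite big_split; congr (_ + _); under [RHS]eq_bigr do rewrite mulr_suml.
    rewrite exchange_big; apply: eq_bigr => l _; rewrite mulr_sumr.
    by apply: eq_bigr => k _; rewrite mulrA.
  rewrite E2 in E; under eq_bigr do rewrite mxE mulrDl.
  rewrite big_split /= (bigD1 i)//= eqxx mul1r big1 ?addr0 => [|k ki]; last first.
    by rewrite eq_sym (negbTE ki) !mul0r.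
  under eq_bigr do rewrite mulrBl -mulrA.
  rewrite sumrB -mulr_sumr; move: E.
  set X1 := \sum_l _; set X2 := \sum_k _; set X3 := \sum_j _; set X4 := \sum_k _ => E.
  have -> : X4 = (u i * ((p i)^`().[xs`_i] * D xs`_i + X1) + (p i).[xs`_i] * X2) - X3.
    by rewrite E addrC addKr.
  by ring.
have DX k : exists (A : 'I_d -> S) (B : 'I_(size z) -> S), forall D, derivation D ->
    h * D xs`_k = \sum_l A l * D (y l) + \sum_j B j * D z`_j.
  have [lt|ge] := ltnP k m; last first.
    exists (fun _ => 0), (fun _ => 0) => D hD; rewrite nth_default// (derivation0 hD) mulr0.
    by rewrite !big1 ?addr0// => i _; rewrite mul0r.
  pose k' := Ordinal lt; rewrite -[k]/(k' : nat).
  exists (fun l => \sum_i (\adj M) k' i * a i l), (fun j => - \sum_i (\adj M) k' i * u i * b i j).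
  move=> D hD.
  have -> : h * D xs`_k' = \sum_i (\adj M) k' i * \sum_k M i k * D xs`_k.
    under eq_bigr do rewrite mulr_sumr; rewrite exchange_big /=.
    under eq_bigr do (under eq_bigr do rewrite mulrA; rewrite -mulr_suml).
    have E j : \sum_i (\adj M) k' i * M i j = (k' == j)%:R * h.
      by have := congr1 (fun N : 'M_m => N k' j) (mul_adj_mx M); rewrite !mxE mulr_natl.
    under eq_bigr do rewrite E.
    rewrite (bigD1 k')//= eqxx mul1r big1 ?addr0// => j jk.
    by rewrite eq_sym (negbTE jk) !mul0r.
  under eq_bigr do rewrite MD// mulrBr.
  rewrite sumrB; congr (_ + _).
    under [RHS]eq_bigr do rewrite mulr_suml.
    rewrite exchange_big; apply: eq_bigr => i _; rewrite mulr_sumr.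
    by apply: eq_bigr => l _; rewrite mulrA.
  under [RHS]eq_bigr do rewrite mulNr mulr_suml.
  rewrite sumrN exchange_big; congr (- _); apply: eq_bigr => i _.
  by rewrite mulrA mulr_sumr; apply: eq_bigr => j _; rewrite mulrA.
have /choice[A /choice[B hAB]] := DX.
move=> v; have [al hal] := span v.
exists (fun l => \sum_k al k * A k l), (fun j => \sum_k al k * B k j) => D hD.
rewrite (hal D hD) mulr_sumr.
under [X in _ = X + _]eq_bigr do rewrite mulr_suml.
under [X in _ = _ + X]eq_bigr do rewrite mulr_suml.
rewrite exchange_big [X in _ = _ + X]exchange_big -big_split; apply: eq_bigr => k _ /=.
rewrite mulrCA (hAB k D hD) mulrDr !mulr_sumr; congr (_ + _).
  by apply: eq_bigr => l _; rewrite mulrA.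
by apply: eq_bigr => l _; rewrite mulrA.
Qed.

(* The data of an etale coordinate system on the complement of [h = 0]. *)
Record chart (n : nat) (t : 'I_n -> S) (delta : 'I_n -> S -> S) (h : S) : Prop := Chart {
  chart_der : forall k, derivation (delta k);
  chart_dual : forall k j, delta k (t j) = if k == j then h else 0;
  chart_alg : forall a, exists p,
    [/\ p != 0, coefs_in (sub [seq t i | i : 'I_n]) p & p.[a] = 0]
}.

(** Each [w_i] is transcendental over the subring of the later elements, which gives a derivation
    trivial on them and nonzero at [w_i]. *)
Lemma indep_derivations xs w : (forall v, sub xs v) -> indep_mod [set 0] w ->
  exists D : 'I_(size w) -> S -> S, [/\ forall i, derivation (D i),
    forall i j : 'I_(size w), (i < j)%N -> D i w`_j = 0 &
    forall i : 'I_(size w), D i w`_i != 0].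
Proof.
move=> gen hw.
have H (i : 'I_(size w)) : exists D, [/\ derivation D,
    forall j : 'I_(size w), (i < j)%N -> D w`_j = 0 & D w`_i != 0].
  have tr : transcendental (sub (drop i.+1 w)) w`_i.
    move=> p; elim: w i hw p => [|u w IHw] [[|i] //= lt] [hw h] p.
      by rewrite drop0; apply: h.
    by apply: (IHw (Ordinal (lt : (i < size w)%N))).
  have [D [hD D0 Di]] := separating_derivation dom char0 gen tr.
  exists D; split=> // j ij; apply: D0; apply: mem_sub.
  rewrite -[j : nat](subnKC ij) -nth_drop; apply: mem_nth.
  by rewrite size_drop ltn_sub2r// (leq_ltn_trans ij).
by have /choice[D hD] := H; exists D; split=> i; have [] := hD i.
Qed.

(** The coordinates are the parameters [y] and a transcendence basis [z] modulo [P]. They determine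
    every derivation up to the factor [h]. Conversely, chain and basis give as many independent
    elements as there are coordinates, hence enough derivations for a nonsingular matrix of values
    on [t]. *)
Lemma regular_chart (P : set S) xs d (y : 'I_d -> S) (p : nat -> set S) : is_prime P ->
  (forall v, sub xs v) -> (forall l, P (y l)) ->
  (forall v, P v -> exists u, ~ P u /\ exists c : 'I_d -> S, u * v = \sum_l c l * y l) ->
  (forall i, (i <= d)%N -> is_prime (p i)) -> p d `<=` P ->
  (forall i, (i < d)%N -> p i `<=` p i.+1 /\ exists b, p i.+1 b /\ ~ p i b) ->
  exists e (t : 'I_(d + e) -> S) delta h,
    [/\ chart t delta h, ~ P h & forall l, t (lshift e l) = y l].
Proof.
move=> hP gen Py cut hp pdP pstep.
have [z [hz [h nh hAB]]] := derivation_relation hP gen Py cut.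
pose e := size z; pose n := (d + e)%N.
pose t (i : 'I_(d + e)) := match split i with inl l => y l | inr j => z`_j end.
have ty l : t (lshift e l) = y l by rewrite /t (unsplitK (inl l)).
have tz j : t (rshift d j) = z`_j by rewrite /t (unsplitK (inr j)).
have rel a : exists A : 'I_n -> S, forall D, derivation D -> h * D a = \sum_j A j * D (t j).
  have [A [B hD]] := hAB a.
  exists (fun i => match split i with inl l => A l | inr j => B j end) => D /hD->.
  rewrite big_split_ord /=; congr (_ + _); apply: eq_bigr => i _.
    by rewrite (unsplitK (inl i)) ty.
  by rewrite (unsplitK (inr i)) tz.
have /choice[A hA] := rel.
have h0 : h != 0.
  by apply/eqP => h0; apply: nh; rewrite h0; have [[]] := hP.
have [l ld lz] := indep_mod_chain hp pstep (indep_mod_anti pdP hz).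
have {lz} : indep_mod [set 0] (l ++ z).
  by apply: indep_mod_anti lz => _ ->; have [[]] := hp 0%N (leq0n _).
have nE : size (l ++ z) = n by rewrite size_cat ld.
move: (l ++ z) nE => w nE hw.
have [D [hD Dlt Dii]] : exists D : 'I_n -> S -> S, [/\ forall i, derivation (D i),
    forall i j : 'I_n, (i < j)%N -> D i w`_j = 0 & forall i : 'I_n, D i w`_i != 0].
  by have := indep_derivations gen hw; rewrite nE.
pose M : 'M[S]_n := \matrix_(i, j) D i (t j).
(* The triangular matrix [W] has nonzero determinant, and [h *: W] factors through [M]. *)
have M0 : \det M != 0.
  pose W : 'M[S]_n := \matrix_(i, j) D i w`_j; pose Aw : 'M[S]_n := \matrix_(j, k) A w`_j k.
  have trW : is_trig_mx W by apply/is_trig_mxP => i j ij; rewrite mxE Dlt.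
  have E : h *: W = M *m Aw^T.
    apply/matrixP => i j; rewrite !mxE hA//; apply: eq_bigr => k _.
    by rewrite !mxE mulrC.
  have := congr1 determinant E; rewrite detZ det_mulmx (det_trig trW) => e0.
  apply/eqP => M0; move/eqP: e0; rewrite M0 mul0r; apply/negP.
  apply: (dom_neq0 dom).
    by elim: n {t ty tz rel A hA D hD Dlt Dii M M0 W Aw trW E nE} => [|k IHk];
      rewrite ?expr0 ?oner_neq0// exprS (dom_neq0 dom).
  by apply: (dom_prod_neq0 dom) => i; rewrite mxE.
(* The adjugate gives derivations dual to [t] up to [\det M]. By [pdA], [h * pd k a] is divisible by
   [\det M], and the quotient [A a k] is a derivation in [a], dual to [t] up to [h]. *)
pose pd k a := \sum_i (\adj M) k i * D i a.
have pdt k j : pd k (t j) = (k == j)%:R * \det M.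
  have := congr1 (fun N : 'M_n => N k j) (mul_adj_mx M).
  rewrite [LHS]mxE [in RHS]mxE => e1; rewrite mulr_natl -e1.
  by apply: eq_bigr => i _; rewrite [M i j]mxE.
have pdA k a : h * pd k a = A a k * \det M.
  rewrite /pd mulr_sumr.
  under eq_bigr do rewrite mulrCA hA// mulr_sumr.
  rewrite exchange_big /=.
  transitivity (\sum_j A a j * pd k (t j)).
    by apply: eq_bigr => j _; rewrite /pd mulr_sumr; apply: eq_bigr => i _; rewrite mulrCA.
  rewrite (bigD1 k)//= pdt eqxx mul1r big1 ?addr0// => j jk.
  by rewrite pdt eq_sym (negbTE jk) mul0r mulr0.
have dpd k : derivation (pd k).
  split=> [a b|a b|c]; rewrite /pd.
  - by rewrite -big_split; apply: eq_bigr => i _; have [-> _ _] := hD i; rewrite mulrDr.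
  - rewrite !mulr_sumr -big_split; apply: eq_bigr => i _; have [_ -> _] := hD i.
    by rewrite /=; ring.
  - by rewrite big1// => i _; have [_ _ ->] := hD i; rewrite mulr0.
have AI k a c : h * pd k a = c * \det M -> A a k = c.
  by rewrite pdA ![_ * \det M]mulrC; apply: (dom_mulI dom M0).
exists e, t, (fun k a => A a k), h; split=> //; split.
- move=> k; have [pD pM pk] := dpd k; split=> [a b|a b|c]; apply: AI.
  + by rewrite pD mulrDr !pdA mulrDl.
  + by rewrite pM mulrDr [h * (a * _)]mulrCA [h * (b * _)]mulrCA !pdA; ring.
  + by rewrite pk mulr0 mul0r.
- by move=> k j; apply: AI; rewrite pdt; case: (k == j); rewrite ?mul1r// !mul0r mulr0.
(* An element transcendental over the coordinates would admit a derivation that kills all of them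
   but not it, against [hA]. *)
- move=> a; apply: contrapT => na.
  have tr : transcendental (sub [seq t i | i : 'I_(d + e)]) a.
    by move=> q hq qa; apply/eqP/negPn/negP => q0; apply: na; exists q.
  have [D' [hD' D'0 /eqP D'a]] := separating_derivation dom char0 gen tr.
  apply: D'a; have /eqP : h * D' a = 0.
    rewrite (hA a D' hD') big1// => j _; rewrite D'0 ?mulr0//.
    by apply: mem_sub; apply: map_f; rewrite mem_enum.
  by move/eqP => /dom[/eqP|//]; rewrite (negbTE h0).
Qed.

End Charts.

(** * Krull's intersection theorem *)

Section PrimesAndPowers.
Variable L : comNzRingType.

Lemma prime_avoiding (I : set L) (f : L) : is_ideal I -> (forall n, ~ I (f ^+ n)) ->
  exists P, [/\ is_prime P, I `<=` P & ~ P f].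
Proof.
move=> hI If.
have [||M [[hM Mf] IM Mmax]] :=
    @zorn_above L [set J | is_ideal J /\ forall n, ~ J (f ^+ n)] I => //.
  move=> F [J0 FJ0] FP Ftot; split; last by move=> n [J FJ Jf]; have [_ /(_ n)] := FP J FJ.
  split=> [|a b [J FJ Ja] [J' FJ' J'b]|a b [J FJ Jb]].
  - by exists J0 => //; have [[]] := FP _ FJ0.
  - case: (Ftot J J' FJ FJ') => h.
      by exists J' => //; have [[_ JD _] _] := FP J' FJ'; apply: JD => //; apply: h.
    by exists J => //; have [[_ JD _] _] := FP J FJ; apply: JD => //; apply: h.
  - by exists J => //; have [[_ _ JM] _] := FP J FJ; apply: JM.
have [M0 MD MM] := hM.
have ext a : ~ M a -> exists n u r, M u /\ f ^+ n = u + r * a.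
  move=> na; apply: contrapT => h; apply: na.
  pose J : set L := [set v | exists u r, M u /\ v = u + r * a].
  suff <- : J = M by exists 0, 1; rewrite add0r mul1r.
  apply: Mmax => [|u Mu]; last by exists u, 0; rewrite mul0r addr0.
  split; last by move=> n [u [r [Mu e]]]; apply: h; exists n, u, r.
  split=> [|_ _ [u [r [Mu ->]]] [u' [r' [Mu' ->]]]|c _ [u [r [Mu ->]]]].
  - by exists 0, 0; rewrite mul0r addr0.
  - by exists (u + u'), (r + r'); split; [apply: MD|ring].
  - by exists (c * u), (c * r); split; [apply: MM|ring].
exists M; split=> //; last by rewrite -[f]expr1; apply: Mf.
split=> //; first by rewrite -(expr0 f); apply: Mf.
move=> a b Mab; apply: contrapT => /not_orP[/ext[n [u [r [Mu e]]]] /ext[k [v [s [Mv e']]]]].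
apply: (Mf (n + k)%N); rewrite exprD e e'.
have -> : (u + r * a) * (v + s * b) = (v + s * b) * u + r * a * v + r * s * (a * b) by ring.
by apply: (MD); [apply: (MD)|]; apply: (MM).
Qed.

Variables (d : nat) (y : 'I_d -> L).

Fixpoint ideal_pow (n : nat) : set L :=
  if n is n'.+1 then [set v | exists c : 'I_d -> L,
    (forall l, ideal_pow n' (c l)) /\ v = \sum_l c l * y l] else [set: L].

Lemma ideal_pow_ideal n : is_ideal (ideal_pow n).
Proof.
elim: n => [//|n [I0 ID IM]]; split=> /=.
- by exists (fun _ => 0); split=> //; rewrite big1// => l _; rewrite mul0r.
- move=> _ _ [c [hc ->]] [c' [hc' ->]]; exists (fun l => c l + c' l).
  split; first by move=> l; apply: ID.
  by rewrite -big_split; apply: eq_bigr => l _; rewrite mulrDl.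
- move=> a _ [c [hc ->]]; exists (fun l => a * c l); split; first by move=> l; apply: IM.
  by rewrite mulr_sumr; apply: eq_bigr => l _; rewrite mulrA.
Qed.

Lemma ideal_powS n : ideal_pow n.+1 `<=` ideal_pow n.
Proof.
elim: n => // n IHn _ [c [hc ->]]; exists c; split=> // l; exact: IHn (hc l).
Qed.

Lemma ideal_powM i j a b : ideal_pow i a -> ideal_pow j b -> ideal_pow (i + j) (a * b).
Proof.
elim: i a => [|i IHi] a.
  by move=> _ hb; have [_ _ IM] := ideal_pow_ideal j; apply: IM.
move=> [c [hc ->]] hb; exists (fun l => c l * b); split; first by move=> l; exact: IHi (hc l) hb.
by rewrite mulr_suml; apply: eq_bigr => l _; rewrite mulrAC.
Qed.

Lemma ideal_pow_y l : ideal_pow 1 (y l).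
Proof.
exists (fun j => (j == l)%:R); split=> //.
by rewrite (bigD1 l)//= eqxx mul1r big1 ?addr0// => j /negbTE->; rewrite mul0r.
Qed.

Lemma ideal_pow_sub (P : set L) n : is_ideal P -> (forall l, P (y l)) -> ideal_pow n.+1 `<=` P.
Proof. by move=> hP Py _ [c [_ ->]]; apply: ideal_sum => // l _; have [_ _ PM] := hP; apply: PM. Qed.

(** A product of more than [\sum_l k l] of the [y l] contains some [y l] at least [k l] times; [e]
    records the factors already split off. *)
Lemma ideal_pow_bounded (M : set L) (k : 'I_d -> nat) : is_ideal M ->
  (forall l, M (y l ^+ k l)) -> ideal_pow (\sum_l k l).+1 `<=` M.
Proof.
move=> hM Mk; have [M0 MD MM] := hM.
suff h n (e : 'I_d -> nat) v : (\sum_l k l < n + \sum_l e l)%N -> ideal_pow n v ->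
    M (v * \prod_l y l ^+ e l).
  move=> v hv; have <- : v * \prod_l y l ^+ 0 = v by rewrite big1 ?mulr1// => l _; rewrite expr0.
  by apply: (h _ (fun _ => 0%N)) hv; rewrite addSn ltnS leq_addr.
elim: n e v => [|n IHn] e v.
  rewrite add0n => lt _; apply: (MM).
  have [l kl] : exists l, (k l <= e l)%N.
    apply: contrapT => /forallNP h; move: lt; rewrite ltnNge => /negP; apply.
    by apply: leq_sum => l _; apply: ltnW; rewrite ltnNge; apply/negP/h.
  by rewrite (bigD1 l)//= -(subnK kl) exprD mulrC mulrA; apply: (MM).
move=> lt [c [hc ->]]; rewrite mulr_suml; apply: ideal_sum => // l _.
rewrite -mulrA; have -> : y l * \prod_j y j ^+ e j = \prod_j y j ^+ ((j == l) + e j).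
  rewrite (bigD1 l)//= [in RHS](bigD1 l)//=. rewrite eqxx exprS -mulrA; congr (_ * (_ * _)).
  by apply: eq_bigr => j /negbTE->.
apply: IHn (hc l); rewrite big_split /= (_ : \sum_j (j == l) = 1)%N.
  by rewrite addnCA add1n -addSn addSn.
by rewrite (bigD1 l)//= eqxx big1 ?addn0// => j /negbTE->.
Qed.

(* Krull's intersection theorem, after Herstein: an ideal [M] maximal among those meeting
   [I] in [m I] contains a power of [m]. *)
Lemma krull_intersection (m I : set L) : noeth L -> is_ideal m -> ~ m 1 ->
  (forall v, ~ m v -> exists v', v * v' = 1) -> (forall l, m (y l)) ->
  is_ideal I -> (forall n, I `<=` ideal_pow n) -> forall v, I v -> v = 0.
Proof.
move=> hL hm m1 munit my hI Ipow; have [m0 mD mM] := hm; have [I0 ID IM] := hI.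
pose mI : set L := [set v | exists c : 'I_d -> L, (forall l, I (c l)) /\ v = \sum_l c l * y l].
have hmI : is_ideal mI.
  split=> [|_ _ [c [hc ->]] [c' [hc' ->]]|a _ [c [hc ->]]].
  - by exists (fun _ => 0); split=> //; rewrite big1// => l _; rewrite mul0r.
  - exists (fun l => c l + c' l); split; first by move=> l; apply: ID.
    by rewrite -big_split; apply: eq_bigr => l _; rewrite mulrDl.
  - exists (fun l => a * c l); split; first by move=> l; apply: IM.
    by rewrite mulr_sumr; apply: eq_bigr => l _; rewrite mulrA.
have [||M [[hM MI] mIM Mmax]] :=
    @zorn_above L [set J | is_ideal J /\ forall v, J v -> I v -> mI v] mI => //.
  move=> F [J0 FJ0] FP Ftot; split; last by move=> v [J FJ Jv]; have [_ h] := FP J FJ; apply: h.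
  split=> [|a b [J FJ Ja] [J' FJ' J'b]|a b [J FJ Jb]].
  - by exists J0 => //; have [[]] := FP _ FJ0.
  - case: (Ftot J J' FJ FJ') => h.
      by exists J' => //; have [[_ JD _] _] := FP J' FJ'; apply: JD => //; apply: h.
    by exists J => //; have [[_ JD _] _] := FP J FJ; apply: JD => //; apply: h.
  - by exists J => //; have [[_ _ JM] _] := FP J FJ; apply: JM.
have [M0 MD MM] := hM.
(* The colon ideals of [y l ^+ k] into [M] stabilize at some [N]. Then adding [y l ^+ N] to [M]
   still leaves the intersection with [I] inside [mI], so maximality puts it in [M]. *)
have /choice[k hk] l : exists k, M (y l ^+ k).
  have [|n|N hN] := @noeth_acc L (fun k => [set v | M (y l ^+ k * v)]) hL.
  - move=> n; split=> /= [|a b ha hb|a b hb]; first by rewrite mulr0.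
      by rewrite mulrDr; apply: MD.
    by rewrite mulrCA; apply: MM.
  - by move=> v /= h; rewrite exprS -mulrA; apply: MM.
  exists N; pose J : set L := [set v | exists u r, M u /\ v = u + r * y l ^+ N].
  suff <- : J = M by exists 0, 1; rewrite add0r mul1r.
  apply: Mmax => [|u Mu]; last by exists u, 0; rewrite mul0r addr0.
  split.
    split=> [|_ _ [u [r [Mu ->]]] [u' [r' [Mu' ->]]]|c _ [u [r [Mu ->]]]].
    - by exists 0, 0; rewrite mul0r addr0.
    - by exists (u + u'), (r + r'); split; [apply: MD|ring].
    - by exists (c * u), (c * r); split; [apply: MM|ring].
  move=> _ [u [r [Mu ->]]] Iv; apply: MI => //; apply: (MD) => //.
  rewrite mulrC; apply: (hN N.+1); rewrite /= exprS.
  have -> : y l * y l ^+ N * r = (u + r * y l ^+ N) * y l - y l * u by ring.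
  apply: idealB => //; last by apply: (MM).
  apply: mIM; exists (fun j => if j == l then u + r * y l ^+ N else 0); split.
    by move=> j; case: eqP => /= _; [|exact: I0].
  by rewrite (bigD1 l)//= eqxx big1 ?addr0// => j /negbTE->; rewrite mul0r.
(* So [I] lies in [M], hence in [mI]; the rest is Nakayama's lemma by a determinant. *)
have II v : I v -> mI v by move=> Iv; apply: MI => //; apply: (ideal_pow_bounded hM hk); apply: Ipow.
have [g hg gI] := hL I hI.
have coef v : I v -> exists c : 'I_(size g) -> L, (forall j, m (c j)) /\ v = \sum_j c j * g`_j.
  move=> /II[c [hc ->]]; have /choice[b hb] l : exists b : 'I_(size g) -> L, c l = \sum_j b j * g`_j.
    by apply/ideal_genP; apply: gI.
  exists (fun j => \sum_l b l j * y l); split.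
    by move=> j; apply: ideal_sum => // l _; apply: (mM).
  under [RHS]eq_bigr do rewrite mulr_suml.
  rewrite exchange_big; apply: eq_bigr => l _; rewrite hb mulr_suml.
  by apply: eq_bigr => j _; rewrite mulrAC.
have /choice[c hc] : forall i : 'I_(size g), exists c : 'I_(size g) -> L,
    (forall j, m (c j)) /\ g`_i = \sum_j c j * g`_j.
  by move=> i; apply: coef; apply: hg; apply: mem_nth.
pose N : 'M[L]_(size g) := \matrix_(i, j) ((i == j)%:R - c i j).
have pm : is_prime m.
  split=> // a b mab; apply: contrapT => /not_orP[/munit[a' ea] /munit[b' eb]].
  apply: m1; have -> : 1 = (a' * b') * (a * b) by rewrite mulrACA [a' * a]mulrC ea [b' * b]mulrC eb mulr1.
  exact: mM.
have /munit[r hr] : ~ m (\det N).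
  apply: det_notin_prime => // [i j ij|i].
    by rewrite mxE (negbTE ij) sub0r; apply: idealN => //; have [] := hc i.
  rewrite mxE eqxx => h; apply: m1; rewrite -[1](subrK (c i i)); apply: mD => //.
  by have [] := hc i.
have g0 i : (i < size g)%N -> g`_i = 0.
  move=> lt; rewrite -[g`_i]mul1r -hr [_ * r]mulrC -mulrA.
  suff -> : \det N * g`_i = 0 by rewrite mulr0.
  pose G : 'cV[L]_(size g) := \col_j g`_j.
  have NG : N *m G = 0.
    apply/colP => j; rewrite !mxE; under eq_bigr do rewrite !mxE mulrBl.
    rewrite sumrB -(hc j).2 (bigD1 j)//= eqxx mul1r big1 ?addr0 ?subrr// => l lj.
    by rewrite eq_sym (negbTE lj) mul0r.
  have := congr1 (mulmx (\adj N)) NG; rewrite mulmxA mul_adj_mx mul_scalar_mx mulmx0.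
  by move=> /colP/(_ (Ordinal lt)); rewrite !mxE.
by move=> v /gI/ideal_genP[b ->]; rewrite big1// => i _; rewrite g0// mulr0.
Qed.

End PrimesAndPowers.

(** * Quotients and localization *)

Section Quotient.
Variable R : comNzRingType.

Lemma quotient_ring (p : set R) : is_ideal p -> ~ p 1 ->
  exists (S : comNzRingType) (pr : {rmorphism R -> S}),
    (forall s, exists r, pr r = s) /\ forall r, pr r = 0 <-> p r.
Proof.
move=> hp p1; have [p0 pD pM] := hp.
pose I : pred R := fun r => `[< p r >].
have Iin r : (r \in I) = `[< p r >] by [].
have Icl : idealr_closed I.
  split=> [||a x y]; rewrite ?Iin; [exact/asboolP|exact/asboolP|].
  by move=> /asboolP px /asboolP py; apply/asboolP; apply: pD => //; apply: pM.
pose IH := isIdealr.Build R I Icl.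
pose J : idealr R := HB.pack I IH.
exists {ideal_quot J}, (\pi_{ideal_quot J}); split=> [s|r].
  by exists (repr s); exact: reprK.
have E : (r == 0 %[mod {ideal_quot J}]) = `[< p r >] by rewrite -Quotient.idealrBE subr0.
have pi0 : \pi_{ideal_quot J} 0 = 0 by exact: (rmorph0 (\pi_{ideal_quot J})).
by split=> [e|pr]; [apply/asboolP; rewrite -E pi0; apply/eqP|rewrite -pi0; apply/eqP; rewrite E; apply/asboolP].
Qed.

End Quotient.

Section LocalizationMap.
Variable R : comNzRingType.

(** All that is used of the localization at [Q]; later arguments are spared the quotient of
    pairs. *)
Record local_map (Q : set R) (L : comNzRingType) (phi : R -> L) : Prop := LocalMap {
  local_unit : forall s, ~ Q s -> exists v, phi s * v = 1;
  local_frac : forall v, exists s r, ~ Q s /\ phi s * v = phi r;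
  local_ker : forall r, phi r = 0 -> exists u, ~ Q u /\ u * r = 0
}.

Lemma localization_map (Q : set R) : is_prime Q -> exists P : prime_idealr R,
  (forall r, (r \in (P : pred R)) <-> Q r) /\
  exists phi : {rmorphism R -> localization P}, local_map Q phi.
Proof.
move=> [hp p1 prp]; have [p0 pD pM] := hp.
pose I : pred R := fun r => `[< Q r >].
have Iin r : (r \in I) = `[< Q r >] by [].
have Icl : idealr_closed I.
  split=> [||a x y]; rewrite ?Iin; [exact/asboolP|exact/asboolP|].
  by move=> /asboolP px /asboolP py; apply/asboolP; apply: pD => //; apply: pM.
have Pcl : prime_idealr_closed I.
  move=> a b; rewrite !Iin => /asboolP/prp[h|h]; apply/orP; [left|right]; exact/asboolP.
pose IH := isIdealr.Build R I Icl.
pose PH := isPrimeIdealrClosed.Build R I Pcl.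
pose P : prime_idealr R := HB.pack I IH PH.
exists P; split; first by move=> r; split=> /asboolP.
pose phi r : localization P := \pi_(localization P) (r, loc_den1 P).
have phiB : zmod_morphism phi.
  move=> a b; rewrite /phi.
  have -> : - \pi_(localization P) (b, loc_den1 P) = \pi_(localization P) (- b, loc_den1 P).
    exact: loc_oppE.
  apply/esym; apply: etrans (loc_addE _ _) _; apply: loc_pi_eq => /=; ring.
have phiM : monoid_morphism phi.
  split=> // a b; rewrite /phi; apply/esym; apply: etrans (loc_mulE _ _) _.
  by apply: loc_pi_eq => /=; ring.
pose H1 := GRing.isZmodMorphism.Build _ _ phi phiB.
pose H2 := GRing.isMonoidMorphism.Build _ _ phi phiM.
pose f : {rmorphism R -> localization P} := HB.pack phi H1 H2.
exists f; split=> [s Qs|v|r].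
- have sP : s \notin (P : pred R) by apply/negP => /asboolP.
  exists (\pi_(localization P) (1, exist _ s sP)); apply: etrans (loc_mulE _ _) _.
  by apply: loc_pi_eq => /=; ring.
- elim/quotW: v => -[r [s sP]]; exists s, r; split; first by move=> /asboolP h; case/negP: sP.
  by apply: etrans (loc_mulE _ _) _; apply: loc_pi_eq => /=; ring.
- move=> /eqP/loc_piP[u uP] /=; rewrite mulr1 mul0r subr0 => ur; exists u; split=> //.
  by move=> /asboolP h; case/negP: uP.
Qed.

End LocalizationMap.

Section PrimeComplement.
Variables (R : comNzRingType) (Q : set R).
Hypothesis Qprime : is_prime Q.

Lemma prime_cut_family (I : finType) (F : I -> R -> Prop) :
  (forall i u v, F i u -> F i (v * u)) -> (forall i, exists u, ~ Q u /\ F i u) ->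
  exists u, ~ Q u /\ forall i, F i u.
Proof.
move=> FM /choice[u hu]; exists (\prod_i u i); split; first by apply: prime_prod => // i _; have [] := hu i.
by move=> i; rewrite (bigD1 i)//= mulrC; apply: FM; have [] := hu i.
Qed.

Lemma notin_prime_mul a b : ~ Q a -> ~ Q b -> ~ Q (a * b).
Proof. by move=> na nb; have [_ _ h] := Qprime; move=> /h[]. Qed.

End PrimeComplement.

Section LocalRings.
Variables (R L : comNzRingType) (Q : set R) (phi : {rmorphism R -> L}).
Hypotheses (Qprime : is_prime Q) (loc : local_map Q phi).

Definition extended_ideal (I : set R) : set L :=
  [set v | exists s x, [/\ ~ Q s, I x & phi s * v = phi x]].

Lemma extended_ideal_ideal I : is_ideal I -> is_ideal (extended_ideal I).
Proof.
move=> [I0 ID IM]; have [_ Q1 _] := Qprime; split.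
- by exists 1, 0; rewrite mulr0 rmorph0.
- move=> a b [s [x [Qs Ix ea]]] [s' [x' [Qs' Ix' eb]]]; exists (s * s'), (s' * x + s * x').
  split; [exact: notin_prime_mul|by apply: ID; apply: IM|].
  by rewrite rmorphD !rmorphM -ea -eb; ring.
- move=> a b [s [x [Qs Ix eb]]]; have [s' [r [Qs' ea]]] := local_frac loc a.
  exists (s * s'), (r * x); split; [exact: notin_prime_mul|exact: IM|].
  by rewrite !rmorphM -ea -eb; ring.
Qed.

Lemma extended_ideal_phi (I : set R) x : I x -> extended_ideal I (phi x).
Proof. by move=> Ix; have [_ Q1 _] := Qprime; exists 1, x; rewrite rmorph1 mul1r. Qed.

Lemma local_eq a b : phi a = phi b -> exists u, ~ Q u /\ u * a = u * b.
Proof.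
move=> e; have [|u [Qu h]] := local_ker loc (r := a - b); first by rewrite rmorphB e subrr.
by exists u; split=> //; apply/eqP; rewrite -subr_eq0 -mulrBr h.
Qed.

Lemma extended_prime_phi x : extended_ideal Q (phi x) -> Q x.
Proof.
move=> [s [y [Qs Qy]]]; rewrite -rmorphM => /local_eq[u [Qu e]]; apply: contrapT => Qx.
have [[_ _ QM] _ _] := Qprime; have [] : ~ Q (u * (s * x)).
  by apply: notin_prime_mul => //; apply: notin_prime_mul.
by rewrite e; apply: QM.
Qed.

Lemma extended_prime1 : ~ extended_ideal Q 1.
Proof. by rewrite -(rmorph1 phi) => /extended_prime_phi; have [] := Qprime. Qed.

Lemma extended_prime_unit v : ~ extended_ideal Q v -> exists v', v * v' = 1.
Proof.
move=> nv; have [s [r [Qs e]]] := local_frac loc v.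
have Qr : ~ Q r by move=> Qr; apply: nv; exists s, r.
by have [w hw] := local_unit loc Qr; exists (phi s * w); rewrite mulrCA mulrA e.
Qed.

Lemma proper_sub_extended_prime (I : set L) : is_ideal I -> ~ I 1 -> I `<=` extended_ideal Q.
Proof.
move=> [_ _ IM] I1 v Iv; apply: contrapT => /extended_prime_unit[v' e]; apply: I1.
by rewrite -e mulrC; apply: IM.
Qed.

Lemma ideal_closedP (I : {pred L}) : idealr_closed I -> is_ideal [set x | x \in I] /\ 1 \notin I.
Proof.
move=> [I0 I1 h]; split=> //; split=> //= a b; first by move=> Ia Ib; rewrite -[a]mul1r; apply: h.
by move=> Ib; rewrite -[a * b]addr0; apply: h.
Qed.

Lemma extended_prime_maximal : maximal_ideal (fun v => `[< extended_ideal Q v >]).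
Proof.
have [Qi _ _] := Qprime; have [e0 eD eM] := extended_ideal_ideal Qi.
have mE v : (v \in (fun v => `[< extended_ideal Q v >]) : bool) = `[< extended_ideal Q v >] by [].
split.
  split; rewrite ?mE; [exact/asboolP|exact/asboolP/extended_prime1|].
  by move=> a x y; rewrite !mE => /asboolP hx /asboolP hy; apply/asboolP; apply: eD => //; apply: eM.
move=> I /ideal_closedP[hI I1] sub v; apply/idP/idP; last exact: sub.
move=> Iv; apply/asboolP; apply: (proper_sub_extended_prime hI) => //; exact/negP.
Qed.

(** Regularity is carried from the localization to [R]: parameters are multiplied by their
    denominators, and the chain of primes is contracted. Of the dimension only a chain as long as
    the number of parameters is kept. *)
Lemma regular_parameters : regular_local_ring L -> exists d (y : 'I_d -> R) (p : nat -> set R),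
  [/\ forall l, Q (y l),
      forall v, Q v -> exists u, ~ Q u /\ exists c : 'I_d -> R, u * v = \sum_l c l * y l,
      forall i, (i <= d)%N -> is_prime (p i),
      p d `<=` Q &
      forall i, (i < d)%N -> p i `<=` p i.+1 /\ exists b, p i.+1 b /\ ~ p i b].
Proof.
move=> [_ [m [_ muniq [s [ms [[q [qprime qstrict]] _]]]]]].
have mE v : v \in m <-> extended_ideal Q v.
  by rewrite -(muniq _ extended_prime_maximal); split=> /asboolP.
have /choice[tr htr] (l : 'I_(size s)) : exists tr : R * R, [/\ ~ Q tr.1, Q tr.2 & phi tr.1 * s`_l = phi tr.2].
  have [t [r [Qt Qr e]]] : extended_ideal Q s`_l.
    apply/mE/ms; exists (fun j => (j == l)%:R).
    by rewrite (bigD1 l)//= eqxx mul1r big1 ?addr0// => j /negbTE->; rewrite mul0r.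
  by exists (t, r).
exists (size s), (fun l => (tr l).2), (fun i => [set r | phi r \in q i]); split.
- by move=> l; have [] := htr l.
- move=> v Qv; have /mE/ms[c e] := extended_ideal_phi Qv.
  have /choice[w hw] l : exists w, phi (tr l).1 * w = 1 by apply: (local_unit loc); have [] := htr l.
  have [u [Qu /choice[a ha]]] : exists u, ~ Q u /\ forall l, exists a, phi u * (c l * w l) = phi a.
    apply: (prime_cut_family Qprime) => [l u v' [a ea]|l].
      by exists (v' * a); rewrite !rmorphM -mulrA ea.
    by have [t [r [Qt et]]] := local_frac loc (c l * w l); exists t; split=> //; exists r.
  have [u' [Qu' e']] : exists u', ~ Q u' /\ u' * (u * v) = u' * \sum_l a l * (tr l).2.
    apply: local_eq; rewrite rmorphM e rmorph_sum mulr_sumr; apply: eq_bigr => l _.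
    have [_ _ el] := htr l; rewrite rmorphM -ha -el -[LHS]mul1r -(hw l); ring.
  exists (u' * u); split; first exact: notin_prime_mul.
  by exists (fun l => u' * a l); rewrite -mulrA e' mulr_sumr; apply: eq_bigr => l _; rewrite mulrA.
- move=> i /qprime[/ideal_closedP[[q0 qD qM] q1] qp]; split=> /=.
  + split=> [|a b|a b] /=; rewrite ?rmorph0//; first by rewrite rmorphD; apply: qD.
    by rewrite rmorphM; apply: qM.
  + by rewrite rmorph1; apply/negP.
  + by move=> a b; rewrite rmorphM => /qp/orP[]; [left|right].
- move=> r /= h; apply: extended_prime_phi; have [/ideal_closedP[qi q1] _] := qprime _ (leqnn _).
  by apply: (proper_sub_extended_prime qi) h; apply/negP.
- move=> i /[dup] lt /qstrict[sub nsub]; split; first by move=> r; apply: sub.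
  apply: contrapT => h; apply: nsub => v qv; apply: contrapT => nv; apply: h.
  have [[q0 qD qM] _] := ideal_closedP (qprime _ lt).1.
  have [[q0' qD' qM'] _] := ideal_closedP (qprime _ (ltnW lt)).1.
  have [t [r [Qt e]]] := local_frac loc v; exists r; split; first by rewrite /= -e; apply: qM.
  move=> /= h; apply: nv; have [w hw] := local_unit loc Qt.
  by rewrite -[v]mul1r -hw mulrAC mulrC e; apply: qM'.
Qed.

Lemma ideal_pow_phi d (y : 'I_d -> R) n x : ideal_pow y n x -> ideal_pow (phi \o y) n (phi x).
Proof.
elim: n x => //= n IHn _ [c [hc ->]]; exists (phi \o c); split; first by move=> l; apply: IHn.
by rewrite rmorph_sum; apply: eq_bigr => l _; rewrite rmorphM.
Qed.

Lemma local_krull d (y : 'I_d -> R) (p : set R) : noeth L -> is_ideal p -> (forall l, Q (y l)) ->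
  (forall x, p x -> forall n, exists u, ~ Q u /\ ideal_pow y n (u * x)) ->
  forall x, p x -> exists u, ~ Q u /\ u * x = 0.
Proof.
move=> hL hp Qy hpow x px; apply: (local_ker loc).
have [Qi _ _] := Qprime.
apply: (krull_intersection hL (extended_ideal_ideal Qi) extended_prime1 extended_prime_unit
  (y := phi \o y) _ (extended_ideal_ideal hp)) (extended_ideal_phi px).
  by move=> l; apply: extended_ideal_phi.
move=> n v [s [x' [Qs px' e]]]; have [u [Qu h]] := hpow _ px' n.
have [w hw] := local_unit loc (notin_prime_mul Qprime Qu Qs).
have -> : v = w * phi (u * x') by rewrite rmorphM -e -[LHS]mul1r -hw rmorphM; ring.
by have [_ _ IM] := ideal_pow_ideal (phi \o y) n; apply: IM; apply: ideal_pow_phi.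
Qed.

End LocalRings.

(** * Regular local rings are domains *)

Section LeadingForms.
Variables (K : fieldType) (S : comNzRingType) (iota : {rmorphism K -> S}).
Variables (d : nat) (y : 'I_d -> S).

Lemma derivation_ideal_pow D n v : derivation iota D -> ideal_pow y n.+1 v -> ideal_pow y n (D v).
Proof.
move=> hD; have [_ DM _] := hD; elim: n v => // n IHn _ [c [hc ->]].
have hI := ideal_pow_ideal y n.+1; have [_ ID IM] := hI.
rewrite (derivation_sum _ _ _ hD); apply: ideal_sum => // l _; rewrite DM; apply: ID.
  by rewrite mulrC; apply: IM; exact: hc.
rewrite -[n.+1]add1n; apply: ideal_powM; first exact: ideal_pow_y.
exact: IHn (hc l).
Qed.

Variables (R : comNzRingType) (pr : {rmorphism R -> S}) (x : 'I_d -> R).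
Hypothesis prx : forall l, pr (x l) = y l.
Variables (delta : 'I_d -> S -> S) (h : S).
Hypotheses (der : forall k, derivation iota (delta k))
           (dual : forall k l, delta k (y l) = if k == l then h else 0).

(* The derivations need not lift from [S] to [R]; the [w k] play the role of the partial
   derivatives of a form in the [x l] representing [v]. *)
Lemma formal_derivatives n v : ideal_pow x n.+1 v -> exists w : 'I_d -> R,
  [/\ forall k, ideal_pow x n (w k), n.+1%:R * v = \sum_k w k * x k
    & forall k, ideal_pow y n.+1 (delta k (pr v) - h * pr (w k))].
Proof.
elim: n v => [|n IHn] v [c [hc ->]].
  exists c; split=> [//||k]; first by rewrite mul1r.
  have hI := ideal_pow_ideal y 1; have [_ ID IM] := hI.
  have [_ DM _] := der k.
  rewrite rmorph_sum (derivation_sum _ _ _ (der k)).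
  under eq_bigr do rewrite rmorphM prx DM dual.
  rewrite big_split /= (bigD1 k)//= eqxx big1 ?addr0 => [|l lk]; last by rewrite eq_sym (negbTE lk) mulr0.
  rewrite mulrC addrAC subrr add0r; apply: (ideal_sum (I := ideal_pow y 1)) => // l _.
  by rewrite mulrC; exact: IM _ _ (ideal_pow_y y l).
have /choice[w hw] l := IHn _ (hc l).
have [_ ID IM] := ideal_pow_ideal x n.+1.
exists (fun k => c k + \sum_l w l k * x l); split.
- move=> k; apply: (ID _ _ (hc k)); exists (fun l => w l k); split=> // l.
  by have [h1 _ _] := hw l; exact: h1.
- under [RHS]eq_bigr do rewrite mulrDl mulr_suml.
  rewrite big_split exchange_big /= -natr1 mulrDl mul1r addrC; congr (_ + _).
  rewrite mulr_sumr; apply: eq_bigr => l _; have [_ h2 _] := hw l.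
  rewrite mulrA h2 mulr_suml; apply: eq_bigr => k _; ring.
- move=> k; have hI := ideal_pow_ideal y n.+2; have [_ DM _] := der k.
  rewrite rmorphD !rmorph_sum (derivation_sum _ _ _ (der k)).
  under eq_bigr do rewrite rmorphM prx DM dual.
  rewrite big_split /= (bigD1 k)//= eqxx big1 ?addr0 => [|l lk]; last by rewrite eq_sym (negbTE lk) mulr0.
  rewrite mulrDr opprD [pr (c k) * h]mulrC addrACA subrr add0r mulr_sumr -sumrB.
  apply: (ideal_sum (I := ideal_pow y n.+2)) => // l _; have [_ _ h3] := hw l; rewrite rmorphM prx.
  have -> : y l * delta k (pr (c l)) - h * (pr (w l k) * y l) =
    y l * (delta k (pr (c l)) - h * pr (w l k)) by ring.
  by rewrite -[n.+2]add1n; apply: ideal_powM; [exact: ideal_pow_y|apply: h3].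
Qed.

Hypothesis charK0 : [pchar K] =i pred0.
Variables (iotaR : {rmorphism K -> R}) (Q : set R) (Q' : set S).
Hypotheses (Qprime : is_prime Q) (Qprime' : is_prime Q').
Hypotheses (Qh : ~ Q' h) (Qy : forall l, Q' (y l)) (prQ : forall r, Q' (pr r) -> Q r).
Hypothesis cut : forall v, Q v -> exists u, ~ Q u /\ exists c : 'I_d -> R, u * v = \sum_l c l * x l.

(** The formal derivatives of [v] satisfy the same hypothesis one degree lower, so by induction they
    lie one power deeper after multiplication by an element outside [Q]. Euler's relation recovers
    [v], dividing by [n.+1]. *)
Lemma leading_form_zero n v u : ideal_pow x n v -> ~ Q' u -> ideal_pow y n.+1 (u * pr v) ->
  exists u', ~ Q u' /\ ideal_pow x n.+1 (u' * v).
Proof.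
elim: n v u => [|n IHn] v u hv Qu huv.
  have [iQ' _ prQ'] := Qprime'.
  have /cut[u' [Qu' [c e]]] : Q v.
    by apply: prQ; have [//|] := prQ' _ _ (ideal_pow_sub iQ' Qy huv).
  by exists u'; split=> //; exists c.
have [w [hw euler hdw]] := formal_derivatives hv.
have hI := ideal_pow_ideal y n.+1; have [_ ID IM] := hI.
have [u' [Qu' hu']] : exists u', ~ Q u' /\ forall k, ideal_pow x n.+1 (u' * w k).
  apply: (prime_cut_family Qprime) => [k a b|k].
    by rewrite -mulrA; have [_ _ M] := ideal_pow_ideal x n.+1; apply: M.
  apply: (IHn _ (u * (u * h))) => //; first by do 2?apply: (notin_prime_mul Qprime').
  have -> : u * (u * h) * pr (w k) = u * (delta k (u * pr v) - pr v * delta k u)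
    - u * u * (delta k (pr v) - h * pr (w k)).
    by have [_ -> _] := der k; ring.
  apply: idealB => //; last by apply: IM.
  rewrite mulrBr; apply: idealB => //; first by apply: IM; exact: derivation_ideal_pow huv.
  have -> : u * (pr v * delta k u) = delta k u * (u * pr v) by ring.
  by apply: IM; apply: ideal_powS.
exists u'; split=> //; have [_ _ IMx] := ideal_pow_ideal x n.+2.
have n0 : n.+1%:R != 0 :> K := natr_neq0 charK0 (ltn0Sn n).
have -> : u' * v = iotaR n.+1%:R^-1 * (u' * (n.+1%:R * v)).
  have e : iotaR n.+1%:R^-1 * n.+1%:R = 1 by rewrite -(rmorph_nat iotaR) -rmorphM mulVf// rmorph1.
  by rewrite mulrCA [iotaR _ * (_ * v)]mulrA e mul1r.
rewrite euler; apply: IMx; exists (fun k => u' * w k); split=> //.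
by rewrite mulr_sumr; apply: eq_bigr => k _; rewrite mulrA.
Qed.

End LeadingForms.

Section RegularPrimes.
Variables (K : fieldType) (R : comNzRingType) (iota : {rmorphism K -> R}).
Hypothesis charK0 : [pchar K] =i pred0.
Variable xs : seq R.
Hypothesis xsgen : forall v, sub iota xs v.

Lemma sub_noeth : noeth R.
Proof.
have [T [phi [rphi hT]]] := sub_presentation iota xs.
apply: (noeth_surjective (phi := phi)) hT => v.
by have : range phi v; [rewrite rphi|move=> [a _ <-]; exists a].
Qed.

Lemma image_prime (S : comNzRingType) (pr : {rmorphism R -> S}) (p q : set R) :
  (forall s, exists r, pr r = s) -> (forall r, pr r = 0 <-> p r) -> is_prime q -> p `<=` q ->
  is_prime (pr @` q) /\ forall r, (pr @` q) (pr r) -> q r.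
Proof.
move=> onto ker [[q0 qD qM] q1 qp] pq.
have back r : (pr @` q) (pr r) -> q r.
  move=> [r' qr' e]; rewrite -(subrK r' r) addrC; apply: (qD) => //.
  by apply: pq; apply/ker; rewrite rmorphB e subrr.
split=> //; split.
- split.
  + by exists 0; rewrite ?rmorph0.
  + by move=> _ _ [a qa <-] [b qb <-]; exists (a + b); rewrite ?rmorphD//; apply: qD.
  + move=> a _ [b qb <-]; have [a' <-] := onto a.
    by exists (a' * b); rewrite ?rmorphM//; apply: qM.
- by rewrite -(rmorph1 pr) => /back.
- move=> a b; have [a' <-] := onto a; have [b' <-] := onto b.
  by rewrite -rmorphM => /back/qp[h|h]; [left|right]; [exists a'|exists b'].
Qed.

(** This says that a regular localization is a domain. With [p] the bottom of the chain, [R/p] has a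
    chart at the image of [Q]. Elements of [p] map to 0, so [leading_form_zero] pushes them, up to
    factors outside [Q], into every power of the ideal of parameters, and Krull's theorem
    applies. *)
Lemma regular_prime_killed (L : comNzRingType) (Q : set R) (phi : {rmorphism R -> L}) :
  is_prime Q -> local_map Q phi -> regular_local_ring L ->
  exists p, [/\ is_prime p, p `<=` Q & forall x, p x -> exists u, ~ Q u /\ u * x = 0].
Proof.
move=> hQ loc reg; have [d [y [p [Qy cut pp pQ pS]]]] := regular_parameters hQ loc reg.
have psub i : (i <= d)%N -> p 0%N `<=` p i.
  elim: i => [_ x //|i IHi lt x /(IHi (ltnW lt))]; have [h _] := pS i lt; exact: h.
have p0 : is_prime (p 0%N) by apply: pp.
exists (p 0%N); split=> //; first exact: subset_trans (psub d (leqnn d)) pQ.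
have [p0i p01 p0p] := p0.
have [S [pr [onto ker]]] := quotient_ring p0i p01.
have dom (a b : S) : a * b = 0 -> a = 0 \/ b = 0.
  have [a' <-] := onto a; have [b' <-] := onto b.
  by rewrite -rmorphM => /ker/p0p[/ker h|/ker h]; [left|right].
have [pQ' backQ] := image_prime onto ker hQ (subset_trans (psub d (leqnn d)) pQ).
have im i : (i <= d)%N -> is_prime (pr @` p i) /\ forall r, (pr @` p i) (pr r) -> p i r.
  by move=> le; apply: (image_prime onto ker (pp i le) (psub i le)).
have Sgen v : sub (pr \o iota) (map pr xs) v.
  have [r <-] := onto v; have sS := sub_subring (pr \o iota) (map pr xs).
  have [lk lD lM] := sS.
  apply: (sub_min (iota := iota) (l := xs) (A := [set r | sub (pr \o iota) (map pr xs) (pr r)])) => //.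
    split=> [k|a b|a b] /=; first exact: (lk k).
      by rewrite rmorphD; apply: lD.
    by rewrite rmorphM; apply: lM.
  by move=> w wx /=; apply: mem_sub; apply: map_f.
have [e [t [delta [h [ch Qh tl]]]]] : exists e (t : 'I_(d + e) -> S) delta h,
    [/\ chart (pr \o iota) t delta h, ~ (pr @` Q) h & forall l, t (lshift e l) = pr (y l)].
  apply: (regular_chart charK0 dom (p := fun i => pr @` p i) pQ' Sgen).
  - by move=> l; exists (y l).
  - move=> _ [v Qv <-]; have [u [Qu [c e]]] := cut v Qv; exists (pr u); split.
      by move=> /backQ.
    exists (pr \o c); rewrite -rmorphM e rmorph_sum; apply: eq_bigr => l _.
    by rewrite rmorphM.
  - by move=> i le; have [] := im i le.
  - by move=> _ [r pr' <-]; exists r => //; apply: pQ.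
  - move=> i lt; have [sub [b [b1 b2]]] := pS i lt; split.
      by move=> _ [r h <-]; exists r => //; apply: sub.
    exists (pr b); split; first by exists b.
    by have [_ back] := im i (ltnW lt); move=> /back.
have [der dual _] := ch.
apply: (local_krull hQ loc (noeth_of_noetherian reg.1) p0i Qy) => x px.
elim=> [|n [u [Qu hu]]]; first by exists 1; split=> //; have [] := hQ.
have dual' k l : delta (lshift e k) (pr (y l)) = if k == l then h else 0.
  by rewrite -tl dual (inj_eq (@lshift_inj _ _)).
have Qy' l : (pr @` Q) (pr (y l)) by exists (y l).
have Q1 : ~ (pr @` Q) 1 by have [] := pQ'.
have ux0 : ideal_pow (pr \o y) n.+1 (1 * pr (u * x)).
  rewrite mul1r rmorphM (ker x).2// mulr0.
  by have [] := ideal_pow_ideal (pr \o y) n.+1.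
have [u' [Qu' hu']] := @leading_form_zero K S (pr \o iota) d (pr \o y) R pr y (fun=> erefl)
   (fun k => delta (lshift e k)) h (fun k => der _) dual' charK0 iota Q _ hQ pQ' Qh Qy' backQ cut
   n (u * x) 1 hu Q1 ux0.
exists (u' * u); rewrite -mulrA; split=> //; exact: notin_prime_mul.
Qed.

End RegularPrimes.

(** * Reduction to a domain *)

Section GradedProducts.
Variables (K : fieldType) (R : comAlgType K) (gr : nat -> set R).
Hypothesis grR : is_grading gr.
Local Notation pj := (gpr grR).

Lemma gprM x y j : pj j (x * y) = \sum_(i < j.+1) pj i x * pj (j - i) y.
Proof.
move: x y j; pose Q : set R := [set x | forall y j, pj j (x * y) = \sum_(i < j.+1) pj i x * pj (j - i) y].
apply: (@graded_ind _ _ _ grR Q).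
  split=> [y j|k x x' hx hx' y j].
    by rewrite mul0r linear0 big1// => i _; rewrite linear0 mul0r.
  rewrite mulrDl -scalerAl (gpr_linear grR) hx hx' scaler_sumr -big_split; apply: eq_bigr => i _ /=.
  by rewrite (gpr_linear grR) mulrDl scalerAl.
move=> a x gx y j; move: y; pose Q' : set R := [set y | pj j (x * y) = \sum_(i < j.+1) pj i x * pj (j - i) y].
apply: (@graded_ind _ _ _ grR Q').
  split=> [|k y y' hy hy'].
    by rewrite /Q' /= mulr0 linear0 big1// => i _; rewrite linear0 mulr0.
  rewrite /Q' /= mulrDr -scalerAr (gpr_linear grR) hy hy' scaler_sumr -big_split; apply: eq_bigr => i _ /=.
  by rewrite (gpr_linear grR) mulrDr scalerAr.
move=> b y gy; rewrite /Q' /= (gpr_hom _ _ (grading_mul grR gx gy)).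
under eq_bigr do rewrite (gpr_hom _ _ gx) (gpr_hom _ _ gy).
case: eqP => [->|ne].
  have lt : (a < (a + b).+1)%N by rewrite ltnS leq_addr.
  rewrite (bigD1 (Ordinal lt))//= eqxx addKn eqxx big1 ?addr0// => i /eqP ia.
  by case: eqP => [e|_]; [case: ia; apply: val_inj|rewrite mul0r].
rewrite big1// => i _; case: eqP => [ia|_]; last by rewrite mul0r.
case: eqP => [ib|_]; last by rewrite mulr0.
by case: ne; rewrite -ia -ib subnKC// -ltnS.
Qed.

Hypothesis gr0 : gr 0%N = range (fun k : K => k%:A).

(** By [e * e = e], an idempotent without component in degree 0 vanishes degree by degree. The
    degree 0 component is an idempotent of [K], so this applies to [e] or to [1 - e]. *)
Lemma idempotent_trivial (e : R) : e * e = e -> e = 0 \/ e = 1.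
Proof.
have E0 (e' : R) : e' * e' = e' -> pj 0%N e' = 0 -> e' = 0.
  move=> ee h0; apply: (gpr_ext (grR := grR)) => j; rewrite linear0.
  elim/ltn_ind: j => j IH; rewrite -ee gprM big1// => i _.
  have := ltn_ord i; rewrite ltnS leq_eqVlt => /orP[/eqP->|ij].
    by rewrite subnn h0 mulr0.
  by rewrite IH// mul0r.
move=> ee; have := gpr_gr grR 0 e; rewrite gr0 => -[k _ /esym ek].
have kk : k * k = k.
  have inj : injective (fun k : K => k%:A : R) by exact: fmorph_inj (in_alg R).
  apply: inj => /=; rewrite -ek -[in RHS]ee gprM big_ord1 subnn ek.
  by rewrite -scalerAl mul1r scalerA.
have : k * (k - 1) = 0 by rewrite mulrBr kk mulr1 subrr.
move=> /eqP; rewrite mulf_eq0 => /orP[/eqP k0|]; first by left; apply: E0; rewrite // ek k0 scale0r.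
rewrite subr_eq0 => /eqP k1; right; apply/eqP; rewrite eq_sym -subr_eq0; apply/eqP; apply: E0.
  by rewrite mulrBr mulr1 mulrBl mul1r ee subrr subr0.
have h1 : pj 0%N 1 = 1 by have := gpr_hom grR 0 (gr0_scalar gr0 1); rewrite scale1r eqxx.
by rewrite linearB /= h1 ek k1 scale1r subrr.
Qed.

Hypothesis dom : forall x y : R, x * y = 0 -> x = 0 \/ y = 0.

Lemma gpr_top x : x != 0 -> exists a, pj a x != 0 /\ gr_le grR a x.
Proof.
move=> x0; have [s hs] := gr_le_ex grR x; elim: s hs => [|s IHs] hs.
  exists 0%N; split=> //; apply: contra x0 => /eqP h; rewrite (gr_le_sum hs) big_ord1 h.
  exact: eqxx.
have [h|h] := eqVneq (pj s.+1 x) 0; last by exists s.+1.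
by apply: IHs => j; rewrite leq_eqVlt => /orP[/eqP<-//|/hs].
Qed.

Lemma gr_le_cofactor s x y : x != 0 -> gr_le grR s (x * y) -> gr_le grR s y.
Proof.
move=> x0; have [->|y0] := eqVneq y 0; first by move=> _; exact: subspace0 (gr_le_subspace _ _).
have [a [xa ha]] := gpr_top x0; have [b [yb hb]] := gpr_top y0.
move=> h; apply: gr_le_mono (hb); rewrite leqNgt; apply/negP => sb.
have := h (a + b)%N (leq_trans sb (leq_addl _ _)).
have lt : (a < (a + b).+1)%N by rewrite ltnS leq_addr.
rewrite gprM (bigD1 (Ordinal lt))//= addKn big1 ?addr0 => [/dom[]/eqP|i ia]; rewrite ?(negbTE xa) ?(negbTE yb)//.
have : nat_of_ord i != a by apply: contra ia => /eqP ia; apply/eqP/val_inj.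
rewrite neq_ltn => /orP[ia'|ai]; last by rewrite ha// mul0r.
by rewrite hb ?mulr0//; rewrite ltn_subRL ltn_add2r.
Qed.

End GradedProducts.

Section BernsteinBox.
Variables (K : fieldType) (R : comAlgType K) (gr : nat -> set R).
Hypothesis grR : is_grading gr.
Hypothesis gr0 : gr 0%N = range (fun k : K => k%:A).
Variable w : nat.
Local Notation B := (bern gr w).
Local Notation box := (box_filtration B).

Lemma bern_box_mono i j r : (i <= j)%N -> box i r -> box j r.
Proof. by apply: box_mono; exact: bern_mono. Qed.

Lemma bern_box1 i : box i 1.
Proof. by apply: box1; [exact: bern_mono|exact: (@bern1 K R gr grR gr0 w)]. Qed.

Lemma bern_boxM i j r s : box i r -> box j s -> box (i + j) (r * s).
Proof. by apply: boxM => *; apply: bernM. Qed.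

End BernsteinBox.

Section SandwichPowers.
Variables (K : fieldType) (R : comAlgType K) (gr : nat -> set R).
Hypothesis grR : is_grading gr.
Hypothesis gr0 : gr 0%N = range (fun k : K => k%:A).
Variables (w m : nat) (x : 'I_m -> R) (dg : 'I_m -> nat).
Hypothesis xg : graded_generators gr w x dg.
Local Notation B := (bern gr w).
Local Notation box := (box_filtration B).

Lemma bern_coefs (p : {poly diffop R}) : exists c, forall n : nat, B c p.[n%:R].
Proof.
have /choice[c hc] i : exists c, B c p`_i by exact: (bern_exhaustive grR gr0 xg).
exists (\max_(i < size p) c i) => n; rewrite horner_coef.
apply: subspace_sum (bern_subspace _ _ _) _ => i _.
rewrite -natrX mulr_natr -scaler_nat; apply: subspaceZ (bern_subspace _ _ _) _.
by apply: bern_mono (hc i); apply: (leq_bigmax (F := fun i : 'I_(size p) => c i)).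
Qed.

(** Each use of the equation lowers the exponent by one. Its operators at natural points lie in a
    step independent of the point, so the cost is linear in [N]. *)
Lemma sandwich_powers (f : R) (b : {poly K}) : sandwich_equation f b ->
  (forall n : nat, ~~ root b n%:R) ->
  exists c, forall N, exists e, box (c * N) e /\ act e (dmul (f ^+ N)) = 1.
Proof.
move=> [s hs] nr.
have [c hc] : exists c, forall n p, p \in s -> B c p.1.[n%:R] /\ B c p.2.[n%:R].
  elim: (s) => [|p s' [c IH]]; first by exists 0%N.
  have [c1 h1] := bern_coefs p.1; have [c2 h2] := bern_coefs p.2.
  exists (maxn c (maxn c1 c2)) => n q; rewrite inE => /orP[/eqP->|/(IH n)[h h']].
    split; [apply: bern_mono (h1 n)|apply: bern_mono (h2 n)]; lia.
  split; [apply: bern_mono h|apply: bern_mono h']; lia.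
exists c; elim=> [|N [e [he eN]]].
  exists 1; rewrite act1 expr0 dmul1; split=> //; exact: (bern_box1 grR gr0).
have bN : b.[N%:R] != 0 by apply: nr.
pose e' := b.[N%:R]^-1 *: \sum_(p <- s) otimes p.1.[N%:R] p.2.[N%:R].
exists (e * e'); split.
  rewrite mulnSr; apply: (bern_boxM grR) => //.
  apply: subspaceZ (box_subspace _ _) _; apply: subspace_sum_in (box_subspace _ _) _ => p ps.
  by have [] := hc N p ps; apply: box_otimes.
rewrite actM actZl act_suml; under eq_bigr do rewrite act_otimes.
by rewrite hs scalerA mulVf// scale1r.
Qed.

End SandwichPowers.

(** * Annihilating pairs and connectedness *)

Section AnnihilatingPairs.
Variables (K : fieldType) (R : comAlgType K) (f u v : R) (N : nat).
Hypotheses (freg : nonzerodivisor f) (fE : f ^+ N = u + v) (uv0 : u * v = 0).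

Lemma regX n (x : R) : f ^+ n * x = 0 -> x = 0.
Proof. by elim: n => [|n IHn]; rewrite ?expr0 ?mul1r// exprS -mulrA => /freg/IHn. Qed.

(** By induction on the order, commutators of [d] vanish between [u] and [v]. The one with [v] gives
    [u d v v = 0]; the one with [f ^+ N = u + v] identifies [f ^+ N] times [u d v] with [u d v v],
    and [f] is a nonzerodivisor. *)
Lemma annihilating_diffop (d : diffop R) : dmul u * d * dmul v = 0.
Proof.
case: d => d hd; have /asboolP[n dn] := hd; move: d dn hd; elim: n => [|n IHn] d dn hd.
  have -> : Diffop hd = dmul (dapp (Diffop hd) 1).
    case: dn => r e; apply: diffop_ext => y; rewrite dapp_dmul /dapp /= e /=.
    by rewrite mulr1.
  by rewrite -!dmulM mulrAC uv0 mul0r (linear0 (@dmul K R)).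
set D := Diffop hd.
have IH r : dmul u * (D * dmul r - dmul r * D) * dmul v = 0.
  have -> : D * dmul r - dmul r * D = Diffop (valP (D * dmul r - dmul r * D)) by apply: val_inj.
  by apply: IHn; exact: dn r.
have hv : dmul u * D * dmul v * dmul v = 0.
  have := IH v; rewrite mulrBr mulrBl [dmul u * (dmul v * D)]mulrA -dmulM uv0 (linear0 (@dmul K R)) !mul0r subr0.
  by rewrite !mulrA.
have hf := IH (f ^+ N).
have : dmul (f ^+ N) * (dmul u * D * dmul v) = 0.
  have -> : dmul (f ^+ N) * (dmul u * D * dmul v) = dmul u * D * (dmul (f ^+ N) * dmul v)
      - dmul u * (D * dmul (f ^+ N) - dmul (f ^+ N) * D) * dmul v.
    rewrite mulrBr mulrBl !mulrA -!dmulM [f ^+ N * u]mulrC opprB [RHS]addrC subrK.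
    by [].
  by rewrite hf subr0 -dmulM fE mulrDl uv0 add0r dmulM mulrA hv.
move=> h; apply: diffop_ext => y; apply: (@regX N).
by rewrite -dapp_dmul -dappM h.
Qed.

Lemma annihilating_act (e e' : enveloping (diffop R)) r :
  act e (dmul (u * u)) * dmul r * act e' (dmul (v * v)) = 0.
Proof.
move: e; pose Q : set (enveloping (diffop R)) := [set e | act e (dmul (u * u)) * dmul r * act e' (dmul (v * v)) = 0].
apply: (@env_ind _ _ Q).
  split=> [|k e1 e2 h1 h2]; rewrite /Q /=; first by rewrite act0l !mul0r.
  by rewrite act_linear_l !mulrDl -!scalerAl h1 h2 scaler0 addr0.
move=> a b; rewrite /Q /= act_otimes; move: {Q} e'.
pose Q' : set (enveloping (diffop R)) := [set e' | a * dmul (u * u) * b * dmul r * act e' (dmul (v * v)) = 0].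
apply: (@env_ind _ _ Q').
  split=> [|k e1 e2 h1 h2]; rewrite /Q' /=; first by rewrite act0l !mulr0.
  by rewrite act_linear_l !mulrDr -!scalerAr h1 h2 scaler0 addr0.
move=> c d; rewrite /Q' /= act_otimes !dmulM.
have := annihilating_diffop (b * dmul r * c) => h.
have -> : a * (dmul u * dmul u) * b * dmul r * (c * (dmul v * dmul v) * d) =
  a * dmul u * (dmul u * (b * dmul r * c) * dmul v) * dmul v * d by rewrite !mulrA.
by rewrite h mulr0 !mul0r.
Qed.

End AnnihilatingPairs.

Section GradedDomain.
Variables (K : fieldType) (R : comAlgType K) (gr : nat -> set R).
Hypothesis grR : is_grading gr.
Hypothesis gr0 : gr 0%N = range (fun k : K => k%:A).
Variable f : R.
Hypothesis freg : nonzerodivisor f.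
Hypothesis funit : forall N, exists e : enveloping (diffop R), act e (dmul (f ^+ N)) = 1.

(* The two halves of [1 = act e (f ^ 2N)] are orthogonal idempotents of [R]. *)
Lemma connected_splitting N u v : f ^+ N = u + v -> u * v = 0 -> u = 0 \/ v = 0.
Proof.
move=> fE uv0; have [e he] := funit (N * 2).
pose E := act e (dmul (u * u)); pose E' := act e (dmul (v * v)).
have EE' : E + E' = 1.
  rewrite -[E + E']linearD -he /=; congr (act e _).
  rewrite exprM fE expr2 mulrDl !mulrDr uv0 addr0 [v * u]mulrC uv0 add0r.
  by apply: diffop_ext => y; rewrite dappD !dapp_dmul mulrDl.
have ErE r : E * dmul r * E' = 0 by apply: (annihilating_act freg fE uv0).
have E'rE r : E' * dmul r * E = 0.
  by apply: (@annihilating_act K R f v u N freg _ _ e e r); [rewrite addrC|rewrite mulrC].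
(* As [E + E' = 1] and the mixed products around [r] vanish, [E] commutes with [R]; it is therefore
   multiplication by an element, which is idempotent. *)
have Er r : E * dmul r = dmul r * E.
  rewrite -[LHS]mulr1 -[RHS]mul1r -EE' mulrDr ErE addr0 mulrDl.
  by rewrite [E' * _]mulrA E'rE addr0 mulrA.
have Ed : E = dmul (dapp E 1).
  apply: diffop_ext => y; have := congr1 (fun d => dapp d 1) (Er y).
  by rewrite !dappM !dapp_dmul mulr1 mulrC.
have EE : E * E = E by rewrite -[RHS]mulr1 -EE' mulrDr -[E * E']mulr1 -dmul1 -mulrA [E' * _](_ : _ = dmul 1 * E') ?mulrA ?ErE ?addr0 // dmul1 mulr1 mul1r.
have [] := @idempotent_trivial K R gr grR gr0 (dapp E 1).
- apply/eqP; rewrite -subr_eq0; apply/eqP; apply: (@dmul_eq0 K).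
  apply: diffop_ext => y; rewrite dapp_dmul mulrBl dapp0.
  by rewrite -[_ * _ * y]/(dapp (dmul (dapp E 1 * dapp E 1)) y) dmulM -Ed EE {1}Ed dapp_dmul subrr.
- move=> e0; left; have E0 : E = 0 by rewrite Ed e0; apply: diffop_ext => y; rewrite dapp_dmul mul0r.
  apply: (@dmul_eq0 K); rewrite -[LHS]mulr1 -EE' E0 add0r /E'.
  move: e {he E E' EE' ErE E'rE Er Ed EE e0 E0}; pose Q : set (enveloping (diffop R)) :=
    [set e | dmul u * act e (dmul (v * v)) = 0].
  apply: (@env_ind _ _ Q).
    split=> [|k e1 e2 h1 h2]; rewrite /Q /=; first by rewrite act0l mulr0.
    by rewrite act_linear_l mulrDr -scalerAr h1 h2 scaler0 addr0.
  move=> a b; rewrite /Q /= act_otimes dmulM !mulrA.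
  by rewrite (annihilating_diffop freg fE uv0) !mul0r.
- move=> e1; right; have E0 : E' = 0.
    by move: EE'; rewrite Ed e1 dmul1 => /(congr1 (fun d => d - 1)); rewrite addrC addKr subrr.
  apply: (@dmul_eq0 K); rewrite -[LHS]mulr1 -EE' E0 addr0 /E.
  move: e {he E E' EE' ErE E'rE Er Ed EE e1 E0}; pose Q : set (enveloping (diffop R)) :=
    [set e | dmul v * act e (dmul (u * u)) = 0].
  apply: (@env_ind _ _ Q).
    split=> [|k e1 e2 h1 h2]; rewrite /Q /=; first by rewrite act0l mulr0.
    by rewrite act_linear_l mulrDr -scalerAr h1 h2 scaler0 addr0.
  move=> a b; rewrite /Q /= act_otimes dmulM !mulrA.
  have fE' : f ^+ N = v + u by rewrite addrC.
  have vu0 : v * u = 0 by rewrite mulrC.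
  by rewrite (annihilating_diffop freg fE' vu0) !mul0r.
Qed.

Hypothesis Rnoeth : noeth R.
Hypothesis loc_dom : forall Q : set R, is_prime Q -> ~ Q f ->
  exists p, [/\ is_prime p, p `<=` Q & forall x, p x -> exists u, ~ Q u /\ u * x = 0].

Lemma common_annihilator (Q p : set R) : is_prime Q -> is_ideal p ->
  (forall x, p x -> exists u, ~ Q u /\ u * x = 0) -> exists u, ~ Q u /\ forall x, p x -> u * x = 0.
Proof.
move=> hQ hp h; have [g gp pg] := Rnoeth hp.
have [u [Qu hu]] : exists u, ~ Q u /\ forall i : 'I_(size g), u * g`_i = 0.
  apply: (prime_cut_family hQ) => [i a b e|i]; first by rewrite -mulrA e mulr0.
  by apply: h; apply: gp; apply: mem_nth.
exists u; split=> // x /pg/ideal_genP[c ->]; rewrite mulr_sumr big1// => i _.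
by rewrite mulrCA hu mulr0.
Qed.

(* [p] is the kernel of localization at a prime [P0] avoiding [f].  At every prime avoiding [f]
   either [p] or its annihilator becomes trivial, so that a power of [f] lies in their sum. *)
Lemma graded_domain (a b : R) : a * b = 0 -> a = 0 \/ b = 0.
Proof.
have [||P0 [hP0 _ P0f]] := @prime_avoiding R [set 0] f.
- split=> // [_ _ -> ->|c _ ->]; [by rewrite /= addr0|by rewrite /= mulr0].
- move=> n /= e; have := @regX K R f freg n 1; rewrite e mul0r => /(_ erefl)/eqP.
  by rewrite oner_eq0.
have [p [hp pP0 kill]] := loc_dom hP0 P0f; have [pi p1 pp] := hp; have [p0 pD pM] := pi.
have [s [P0s sp]] := common_annihilator hP0 pi kill.
pose I : set R := [set x | exists y z, [/\ p y, (forall t, p t -> z * t = 0) & x = y + z]].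
have hI : is_ideal I.
  split=> [|_ _ [y [z [py az ->]]] [y' [z' [py' az' ->]]]|c _ [y [z [py az ->]]]].
  - by exists 0, 0; split=> // [t _|]; rewrite ?mul0r ?addr0.
  - exists (y + y'), (z + z'); split; [exact: pD| |by rewrite addrACA].
    by move=> t pt; rewrite mulrDl az// az'// addr0.
  - exists (c * y), (c * z); split; [exact: pM| |by rewrite mulrDr].
    by move=> t pt; rewrite -mulrA az// mulr0.
have Isub y : p y -> I y by move=> py; exists y, 0; split=> // [t _|]; rewrite ?mul0r ?addr0.
have Iann z : (forall t, p t -> z * t = 0) -> I z by move=> h; exists 0, z; rewrite add0r.
have [N [u [v [pu av fE]]]] : exists N, I (f ^+ N).
  apply: contrapT => /forallNP/(prime_avoiding hI)[P [hP IP Pf]].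
  have [q [hq qP qkill]] := loc_dom hP Pf; have [[q0 qD qM] _ qq] := hq.
  have [qs|pq] := pselect (q s).
    have [t [Pt ts]] := qkill _ qs; apply: Pt; apply: IP; apply: Isub.
    by have [//|/pP0] : p t \/ p s by apply: pp; rewrite ts.
  have [t [Pt ht]] : exists t, ~ P t /\ forall x, p x -> t * x = 0.
    apply: common_annihilator => // x px; apply: qkill.
    by have [] : q s \/ q x by apply: qq; rewrite sp.
  by apply: Pt; apply: IP; apply: Iann.
have p_0 x : p x -> x = 0.
  (* If [u = 0], then [f ^+ N = v] annihilates [p], so [p = 0]. If [v = 0], then [f ^+ N] lies in
     [p] and is killed by [s], which is nonzero. *)
  have [u0|v0] := @connected_splitting N u v fE (etrans (mulrC _ _) (av u pu)).
    move=> px; apply: (@regX K R f freg N); rewrite fE u0 add0r; exact: av.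
  have [] : ~ (s * f ^+ N = 0); last by apply: sp; rewrite fE v0 addr0.
  rewrite mulrC => /(@regX K R f freg N) s0; apply: P0s; rewrite s0.
  by have [[]] := hP0.
by move=> ab; have [/p_0|/p_0] : p a \/ p b by [apply: pp; rewrite ab]; [left|right].
Qed.

End GradedDomain.

(** * Reduction to powers in a chart *)

Section PolynomialFiltration.
Variables (K : fieldType) (R : comAlgType K) (n : nat) (t : 'I_n -> R).

Fixpoint poly_le (s : nat) : set R :=
  if s is s'.+1 then [set v | exists c0 (c : 'I_n -> R),
    [/\ poly_le s' c0, forall l, poly_le s' (c l) & v = c0 + \sum_l c l * t l]]
  else range (in_alg R).
Local Notation Y := poly_le.

Lemma poly_le_subspace s : subspace (Y s).
Proof.
elim: s => [|s [Y0 Yl]]; split.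
- by exists 0; rewrite //= scale0r.
- by move=> k _ _ [a _ <-] [b _ <-]; exists (k * a + b); rewrite //= scalerDl scalerA.
- by exists 0, (fun _ => 0); split=> //; rewrite big1 ?addr0// => l _; rewrite mul0r.
- move=> k _ _ [c0 [c [h0 h ->]]] [c0' [c' [h0' h' ->]]].
  exists (k *: c0 + c0'), (fun l => k *: c l + c' l); split=> [|l|]; [exact: Yl _ _ _ h0 h0'|exact: Yl _ _ _ (h l) (h' l)|].
  rewrite scalerDr addrACA; congr (_ + _); rewrite scaler_sumr -big_split; apply: eq_bigr => l _.
  by rewrite mulrDl scalerAl.
Qed.

Lemma poly_leS s v : Y s v -> Y s.+1 v.
Proof.
move=> h; exists v, (fun _ => 0); split=> // [l|]; first exact: subspace0 (poly_le_subspace s).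
by rewrite big1 ?addr0// => l _; rewrite mul0r.
Qed.

Lemma poly_le_mono s s' v : (s <= s')%N -> Y s v -> Y s' v.
Proof. by move=> /subnK <-; elim: (s' - s)%N => // k IHk /IHk; rewrite addSn; apply: poly_leS. Qed.

Lemma poly_le_scalar s k : Y s k%:A.
Proof. by apply: (poly_le_mono (leq0n s)); exists k. Qed.

Lemma poly_le1 s : Y s 1. Proof. by rewrite -(scale1r 1); apply: poly_le_scalar. Qed.

Lemma poly_leM i j a b : Y i a -> Y j b -> Y (i + j) (a * b).
Proof.
move=> ha hb; elim: i a ha => [|i IHi] a.
  by move=> [k _ <-]; rewrite /= -scalerAl mul1r; apply: subspaceZ (poly_le_subspace j) _.
move=> [c0 [c [h0 h ->]]]; exists (c0 * b), (fun l => c l * b); split; [exact: IHi _ h0|by move=> l; exact: IHi _ (h l)|].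
by rewrite mulrDl mulr_suml; congr (_ + _); apply: eq_bigr => l _; rewrite mulrAC.
Qed.

Lemma poly_le_var l : Y 1 (t l).
Proof.
exists 0, (fun j => (j == l)%:R); split=> [|j|]; first exact: subspace0 (poly_le_subspace 0).
  by case: eqP => _; [exact: poly_le1|exact: subspace0 (poly_le_subspace 0)].
by rewrite add0r (bigD1 l)//= eqxx mul1r big1 ?addr0// => j /negbTE->; rewrite mul0r.
Qed.

Lemma poly_le_exhaustive v : sub (in_alg R) [seq t i | i : 'I_n] v -> exists s, Y s v.
Proof.
apply: (@sub_min K R (in_alg R) _ [set v | exists s, Y s v]).
  split=> [k|a b [i ha] [j hb]|a b [i ha] [j hb]] /=; first by exists 0%N; exists k.
  - exists (maxn i j); apply: subspaceD (poly_le_subspace _) _ _.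
      exact: poly_le_mono (leq_maxl _ _) ha.
    exact: poly_le_mono (leq_maxr _ _) hb.
  - by exists (i + j)%N; apply: poly_leM.
by move=> _ /codomP[i ->]; exists 1%N; apply: poly_le_var.
Qed.

Lemma poly_le_max (I : finType) (F : I -> R) : (forall i, exists s, Y s (F i)) ->
  exists s, forall i, Y s (F i).
Proof.
move=> /choice[s hs]; exists (\max_i s i) => i.
exact: poly_le_mono (leq_bigmax i) (hs i).
Qed.

Lemma poly_le_coefM i j p q : coefs_in (Y i) p -> coefs_in (Y j) q -> coefs_in (Y (i + j)) (p * q).
Proof.
move=> hp hq k; rewrite coefM; apply: subspace_sum (poly_le_subspace _) _ => l _.
by apply: poly_leM; [apply: hp|apply: hq].
Qed.

Lemma char_poly_coefs r s (G : 'M[R]_r) : (forall i j, Y s (G i j)) ->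
  coefs_in (Y (r * s)) (char_poly G).
Proof.
move=> hG k; rewrite /char_poly /determinant coef_sum.
apply: subspace_sum (poly_le_subspace _) _ => sg _.
have entry i j : coefs_in (Y s) (char_poly_mx G i j).
  move=> l; rewrite !mxE coefB coefMn coefX coefC.
  apply: subspaceB (poly_le_subspace _) _ _; last first.
    by case: eqP => _; [exact: hG|exact: subspace0 (poly_le_subspace _)].
  rewrite -scaler_nat; apply: subspaceZ (poly_le_subspace _) _.
  by case: eqP => _; [exact: poly_le1|exact: subspace0 (poly_le_subspace _)].
have : coefs_in (Y (r * s)) (\prod_i char_poly_mx G i (sg i)).
  rewrite -[r in (r * s)%N](card_ord r) -sum_nat_const.
  apply: (big_ind2 (fun p k => coefs_in (Y k) p)) => [l|p1 i1 p2 i2|//]; last exact: poly_le_coefM.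
  by rewrite coefC; case: eqP => _; [exact: poly_le1|exact: subspace0 (poly_le_subspace _)].
move=> /(_ k) h; rewrite -signr_odd; case: (odd _); rewrite ?expr0 ?mul1r// expr1 mulN1r coefN.
exact: subspaceN (poly_le_subspace _) _.
Qed.

Hypothesis dom : forall a b : R, a * b = 0 -> a = 0 \/ b = 0.

(** [E] is an eigenvector of [G] for [T], so [T] is a root of the characteristic polynomial. After
    division by a power of [T], the lowest nonzero coefficient is seen to be a multiple of [T]. *)
Lemma char_poly_multiple r s (G : 'M[R]_r) (E : 'I_r -> R) i0 T : (forall i j, Y s (G i j)) ->
  (forall i, T * E i = \sum_j G i j * E j) -> E i0 != 0 -> T != 0 ->
  exists p q, [/\ Y (r * s) p, p != 0 & p = q * T].
Proof.
move=> hG hE E0 T0; pose chi := char_poly G.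
have chi0 : chi.[T] = 0.
  have -> : chi.[T] = \det (T%:M - G).
    rewrite -[LHS]/(horner_eval T _) /chi /char_poly -det_map_mx; congr (\det _).
    by apply/matrixP => i j; rewrite !mxE /= /horner_eval hornerD hornerN hornerC hornerMn hornerX.
  pose C : 'cV[R]_r := \col_j E j.
  have NC : (T%:M - G) *m C = 0.
    apply/colP => i; rewrite !mxE; under eq_bigr do rewrite !mxE mulrBl.
    rewrite sumrB -hE (bigD1 i)//= eqxx mulr1n big1 ?addr0 ?subrr// => l li.
    by rewrite eq_sym (negbTE li) mul0r.
  have := congr1 (mulmx (\adj (T%:M - G))) NC; rewrite mulmxA mul_adj_mx mul_scalar_mx mulmx0.
  by move=> /colP/(_ i0); rewrite !mxE => /dom[//|/eqP]; rewrite (negbTE E0).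
have chin : chi != 0 by rewrite -size_poly_gt0 size_char_poly.
have [j cj jmin] : exists2 j, chi`_j != 0 & forall i, (i < j)%N -> chi`_i = 0.
  have ex : exists j, chi`_j != 0 by exists (size chi).-1; rewrite -[chi`_ _]/(lead_coef chi) lead_coef_eq0.
  case: (ex_minnP ex) => j cj jmin; exists j => // i ij; apply/eqP; apply: contraLR ij => /jmin.
  by rewrite leqNgt.
have split_chi : chi = 'X^j * ((chi`_j)%:P + 'X * drop_poly j.+1 chi).
  apply/polyP => i; rewrite coefXnM; case: ltnP => [/jmin//|ji].
  rewrite coefD coefC coefXM subn_eq0 coef_drop_poly; case: leqP => [ij|ij].
    by rewrite addr0; congr (chi`_ _); apply/eqP; rewrite eqn_leq ij ji.
  by rewrite add0r; congr (chi`_ _); lia.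
exists (chi`_j), (- (drop_poly j.+1 chi).[T]); split=> //; first exact: char_poly_coefs.
have : T ^+ j * (chi`_j + T * (drop_poly j.+1 chi).[T]) = 0.
  by apply: etrans chi0; rewrite [in RHS]split_chi [RHS]hornerM hornerXn hornerD hornerC hornerM hornerX.
move=> /dom[|].
  by move=> e; have : T ^+ j != 0; [|rewrite e eqxx]; elim: (j) => [|l IHl]; rewrite ?expr0 ?oner_neq0// exprS; apply/eqP => /dom[]/eqP; rewrite ?(negbTE T0) ?(negbTE IHl).
by move=> /eqP; rewrite addr_eq0 => /eqP->; rewrite mulNr mulrC.
Qed.

(* Adjoining a generator [u], algebraic of degree [N] over the ring of the [t l], replaces the
   family [E a] by [E a * u ^ k] for [k < N], and [q] by [q] times a leading coefficient. *)
Lemma spanning_family (xs : seq R) :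
  (forall a, exists p : {poly R}, [/\ p != 0, coefs_in (sub (in_alg R) [seq t i | i : 'I_n]) p & p.[a] = 0]) ->
  exists (I : finType) (E : I -> R) (q : R) (c : nat),
    [/\ exists i, E i = 1, q != 0, Y c q &
        forall x a, x \in xs -> exists g : I -> R, (forall b, Y c (g b)) /\
          q * (x * E a) = \sum_b g b * E b].
Proof.
move=> alg; elim: xs => [|u xs [I [E [q [c [[i0 Ei0] q0 Yq IH]]]]]].
  exists unit, (fun=> 1), 1, 0%N; split; [by exists tt|by rewrite oner_eq0|exact: (poly_le1 0)|by []].
have [p [p0 pc pu]] := alg u.
have [N sp] : exists N, size p = N.+2.
  case sp : (size p) => [|[|N]]; last by exists N.
    by move/eqP: sp; rewrite size_poly_eq0 (negbTE p0).
  have /size_poly1P[k k0 pk] : size p == 1%N by rewrite sp.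
  by move: pu; rewrite pk hornerC => /eqP; rewrite (negbTE k0).
have [c' hc'] : exists c', forall i : 'I_N.+2, Y c' p`_i.
  by apply: poly_le_max => i; apply: poly_le_exhaustive; exact: pc.
have aN : p`_N.+1 != 0 by have := lead_coef_eq0 p; rewrite /lead_coef sp => ->.
have Y0 s : Y s 0 by exact: subspace0 (poly_le_subspace s).
exists (I * 'I_N.+1)%type, (fun b : I * 'I_N.+1 => E b.1 * u ^+ b.2), (q * p`_N.+1), (c + c')%N; split.
- by exists (i0, ord0); rewrite Ei0 mul1r.
- by apply/eqP => /dom[]/eqP; rewrite ?(negbTE q0) ?(negbTE aN).
- by apply: poly_leM => //; apply: (hc' ord_max).
- move=> x [a k] /=; rewrite inE => /orP[/eqP->|xx]; last first.
    have [g [hg e]] := IH x a xx.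
    exists (fun b : I * 'I_N.+1 => if b.2 == k then g b.1 * p`_N.+1 else 0); split.
      by move=> [b l] /=; case: eqP => // _; apply: poly_leM => //; apply: (hc' ord_max).
    have -> : q * p`_N.+1 * (x * (E a * u ^+ k)) = q * (x * E a) * (p`_N.+1 * u ^+ k) by ring.
    rewrite e mulr_suml [RHS](_ : _ = \sum_b \sum_l (if l == k then g b * p`_N.+1 else 0) * (E b * u ^+ l)).
      apply: eq_bigr => b _; rewrite (bigD1 k)//= eqxx big1 ?addr0 => [|l /negbTE->]; last by rewrite mul0r.
      ring.
    by rewrite pair_bigA.
  have [kN|kN] := ltnP k N.
    have kS : (k.+1 < N.+1)%N by [].
    exists (fun b : I * 'I_N.+1 => if b == (a, Ordinal kS) then q * p`_N.+1 else 0); split.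
      by move=> b; case: eqP => // _; apply: poly_leM => //; apply: (hc' ord_max).
    rewrite (bigD1 (a, Ordinal kS))//= eqxx big1 ?addr0 => [|b /negbTE->]; last by rewrite mul0r.
    by rewrite exprS; ring.
  have ek : k = N :> nat by apply/eqP; rewrite eqn_leq kN -ltnS ltn_ord.
  exists (fun b : I * 'I_N.+1 => if b.1 == a then - (q * p`_b.2) else 0); split.
    move=> [b l] /=; case: eqP => // _; apply: subspaceN (poly_le_subspace _) _.
    by apply: poly_leM => //; apply: (hc' (widen_ord (leqnSn _) l)).
  have eq0 : p`_N.+1 * u ^+ N.+1 = - \sum_(l < N.+1) p`_l * u ^+ l.
    by apply/eqP; rewrite -addr_eq0 addrC; apply/eqP; apply: etrans pu; rewrite horner_coef sp [in RHS]big_ord_recr.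
  have -> : q * p`_N.+1 * (u * (E a * u ^+ k)) = q * E a * (p`_N.+1 * u ^+ N.+1).
    by rewrite ek exprS; ring.
  rewrite eq0 [RHS](_ : _ = \sum_b \sum_(l < N.+1) (if b == a then - (q * p`_l) else 0) * (E b * u ^+ l)); last by rewrite pair_bigA.
  rewrite (bigD1 a)//= [X in _ + X]big1 ?addr0 => [|b /negbTE->]; last by rewrite big1// => l _; rewrite mul0r.
  rewrite eqxx mulrN mulr_sumr -sumrN; apply: eq_bigr => l _; ring.
Qed.

End PolynomialFiltration.

(** * Reduction to a power of [h] on one chart *)

Section ChartReduction.
Variables (K : fieldType) (R : comAlgType K) (gr : nat -> set R).
Hypothesis grR : is_grading gr.
Hypothesis gr0 : gr 0%N = range (fun k : K => k%:A).
Variables (w m : nat) (x : 'I_m -> R) (dg : 'I_m -> nat).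
Hypothesis xg : graded_generators gr w x dg.
Hypothesis charK0 : [pchar K] =i pred0.
Hypothesis dom : forall a b : R, a * b = 0 -> a = 0 \/ b = 0.
Local Notation B := (bern gr w).
Local Notation box := (box_filtration B).
Local Notation gle := (gr_le grR).

Lemma domX (a : R) n : a != 0 -> a ^+ n != 0.
Proof.
move=> a0; elim: n => [|n IHn]; first by rewrite expr0 oner_neq0.
by rewrite exprS; apply/eqP => /dom[]/eqP; rewrite ?(negbTE a0) ?(negbTE IHn).
Qed.

Section OneChart.
Variables (n : nat) (t : 'I_n -> R) (delta : 'I_n -> R -> R) (h : R).
Hypothesis ch : chart (in_alg R) t delta h.
Hypothesis h0 : h != 0.
Local Notation Y := (poly_le t).

Lemma poly_le_gr D s v : (forall l, gle D (t l)) -> Y s v -> gle (D * s) v.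
Proof.
move=> tD; elim: s v => [|s IHs] v; first by move=> [k _ <-]; apply: (gr_le_scalar grR gr0).
move=> [c0 [c [hc0 hc ->]]]; rewrite mulnSr; apply: subspaceD (gr_le_subspace _ _) _ _.
  by apply: gr_le_mono (IHs _ hc0); rewrite leq_addr.
by apply: subspace_sum (gr_le_subspace _ _) _ => l _; apply: gr_leM => //; exact: IHs _ (hc l).
Qed.

Section Span.
Variables (I : finType) (E : I -> R) (q : R) (c : nat).
Hypothesis hq : Y c q.
Hypothesis hE : forall i a, exists g : I -> R, (forall b, Y c (g b)) /\ q * (x i * E a) = \sum_b g b * E b.

Let W s : set R := [set v | exists g : I -> R, (forall b, Y (c * s) (g b)) /\ v = \sum_b g b * E b].

Let W_subspace s : subspace (W s).
Proof.
have [Y0 Yl] := poly_le_subspace t (c * s); split.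
  by exists (fun=> 0); split=> //; rewrite big1// => b _; rewrite mul0r.
move=> k _ _ [g [hg ->]] [g' [hg' ->]]; exists (fun b => k *: g b + g' b).
split=> [b|]; first exact: Yl.
by rewrite scaler_sumr -big_split; apply: eq_bigr => b _; rewrite mulrDl scalerAl.
Qed.

Let W_mul s v i : W s v -> W s.+1 (q * (x i * v)).
Proof.
move=> [g [hg ->]]; rewrite mulr_sumr mulr_sumr; apply: subspace_sum (W_subspace _) _ => a _.
have [g' [hg' e]] := hE i a; exists (fun b => g a * g' b); split=> [b|].
  by rewrite mulnSr; apply: poly_leM.
have -> : q * (x i * (g a * E a)) = g a * (q * (x i * E a)) by ring.
by rewrite e mulr_sumr; apply: eq_bigr => b _; rewrite mulrA.
Qed.

Let W_q s v : W s v -> W s.+1 (q * v).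
Proof.
move=> [g [hg ->]]; exists (fun b => q * g b); split=> [b|].
  by rewrite mulnS; apply: poly_leM.
by rewrite mulr_sumr; apply: eq_bigr => b _; rewrite mulrA.
Qed.

Let W_E a : W 0 (E a).
Proof.
exists (fun b => (b == a)%:R); split=> [b|].
  by case: eqP => _; [exact: poly_le1|exact: subspace0 (poly_le_subspace t _)].
by rewrite (bigD1 a)//= eqxx mul1r big1 ?addr0// => b /negbTE->; rewrite mul0r.
Qed.

(** Multiplication by a generator costs one factor [q] and [c] in degree; as generators have
    positive degree, an element of degree at most [s] involves at most [s] of them per monomial. *)
Lemma span_gr_le s g a : gle s g -> exists G : I -> R, (forall b, Y (c * s) (G b)) /\
  q ^+ s * g * E a = \sum_b G b * E b.
Proof.
suff mon al : (\sum_i al i <= s)%N -> W s (q ^+ s * monom x al * E a).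
  move=> /(gr_le_monom gr0 xg)[k [co [u [hu ->]]]]; suff : W s (q ^+ s * (\sum_(i < k) co i *: u i) * E a) by [].
  rewrite mulr_sumr mulr_suml; apply: subspace_sum (W_subspace _) _ => i _.
  rewrite -scalerAr -scalerAl; apply: subspaceZ (W_subspace _) _.
  have [al /= le <-] := hu i; apply: mon; apply: leq_trans le.
  rewrite /wt; apply: leq_sum => j _; have /andP[d0 _] := ggen_deg xg j.
  by rewrite leq_pmull.
elim: s al => [|s IHs] al le.
  have -> : al = fun=> 0%N.
    apply/funext => i; apply/eqP; rewrite -leqn0; apply: leq_trans le.
    by rewrite (bigD1 i)//= leq_addr.
  by rewrite monom0 expr0 !mul1r; apply: W_E.
have [[i ai]|no] := pselect (exists i, (0 < al i)%N).
  have -> : al = fun j => ((j == i) + (al j - (j == i)))%N.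
    by apply/funext => j; rewrite subnKC//; case: eqP => // ->.
  rewrite monom_shift exprS.
  have -> : q * q ^+ s * (x i * monom x (fun j => al j - (j == i))%N) * E a =
    q * (x i * (q ^+ s * monom x (fun j => al j - (j == i))%N * E a)) by ring.
  apply: W_mul; apply: IHs; move: le; rewrite (bigD1 i)//= => le.
  rewrite (bigD1 i)//= eqxx subn1 -ltnS -addSn prednK//; apply: leq_trans le.
  by rewrite leq_add2l; apply: leq_sum => j _; apply: leq_subr.
rewrite exprS -!mulrA; apply: W_q; rewrite mulrA; apply: IHs; rewrite big1// => i _.
by apply/eqP; rewrite -leqn0 leqNgt; apply/negP => ai; apply: no; exists i.
Qed.

End Span.

(** Multiplication by [q ^+ s * g] acts on [E] by a matrix of polynomials of degree linear in [s].
    The cofactor is bounded only afterwards, through [gr_le_cofactor]: in a graded domain its degree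
    cannot exceed that of the product. *)
Lemma chart_multiple : exists c, forall s g, gle s g -> g != 0 ->
  exists p v, [/\ Y (c * s) p, p != 0, p = v * g & gle (c * s) v].
Proof.
have [I [E [q [c [[i0 Ei0] q0 Yq hE]]]]] := spanning_family dom [seq x i | i : 'I_m] (chart_alg ch).
have [D hD] : exists D, forall l, gle D (t l).
  have /choice[D hD] l := gr_le_ex grR (t l); exists (\max_l D l) => l.
  exact: gr_le_mono (leq_bigmax l) (hD l).
exists (D.+1 * (#|I| * c))%N => s g gs g0.
have /choice[G hG] a := span_gr_le Yq (fun i a => hE _ a (codom_f x i)) a gs.
have T0 : q ^+ s * g != 0.
  by apply/eqP => /dom[]/eqP; rewrite ?(negbTE g0) ?(negbTE (domX s q0)).
have [||||p [v [Yp p0 e]]] := @char_poly_multiple K R n t dom #|I| (c * s)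
    (\matrix_(i, j) G (enum_val i) (enum_val j)) (fun i => E (enum_val i)) (enum_rank i0) (q ^+ s * g).
- by move=> i j; rewrite mxE; have [h1 _] := hG (enum_val i); apply: h1.
- move=> i; have [_ ->] := hG (enum_val i); rewrite (reindex (fun j : 'I_#|I| => enum_val j)) /=; last first.
    exact: onW_bij (enum_val_bij I).
  by apply: eq_bigr => j _; rewrite mxE.
- by rewrite enum_rankK Ei0 oner_neq0.
- exact: T0.
have pD : gle (D.+1 * (#|I| * c) * s) p.
  by apply: gr_le_mono (poly_le_gr hD Yp); nia.
exists p, (v * q ^+ s); split=> //; [|by rewrite e mulrA|].
  by apply: poly_le_mono Yp; nia.
apply: (gr_le_cofactor dom g0); rewrite [g * _](_ : _ = p)//.
by rewrite e; ring.
Qed.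

(** The [u k] are formal partial derivatives and the relation is Euler's, [z] collecting lower
    terms. If all [u k] vanish, [v] itself has lower degree, which keeps the descent going. *)
Lemma poly_le_derivative s v : Y s.+1 v -> exists u z, [/\ forall k, Y s (u k),
  forall k, delta k v = h * u k, Y s z & s.+1%:R * v = \sum_k u k * t k + z].
Proof.
have der := chart_der ch; have dual := chart_dual ch.
have dsum k (c : 'I_n -> R) : delta k (\sum_l c l * t l) = h * c k + \sum_l delta k (c l) * t l.
  rewrite (derivation_sum _ _ _ (der k)); have [_ DM _] := der k.
  under eq_bigr do rewrite DM dual.
  rewrite big_split /= (bigD1 k)//= eqxx big1 ?addr0 => [|l /negbTE lk]; last by rewrite eq_sym lk mulr0.
  by rewrite [c k * h]mulrC; congr (_ + _); apply: eq_bigr => l _; rewrite mulrC.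
elim: s v => [|s IHs] v [c0 [c [hc0 hc ->]]].
  exists c, c0; split=> // [k|]; last by rewrite mul1r addrC.
  have [DD _ Dk] := der k; have [k0 _ <-] := hc0; rewrite DD Dk add0r dsum big1 ?addr0// => l _.
  by have [kl _ <-] := hc l; rewrite Dk mul0r.
have [u0 [z0 [hu0 du0 hz0 e0]]] := IHs _ hc0.
have /choice[u /choice[z hu]] l := IHs _ (hc l).
have [Y0 Yl] := poly_le_subspace t s.+1.
exists (fun k => c k + (u0 k + \sum_l u l k * t l)), (c0 + (z0 + \sum_l z l * t l)); split.
- move=> k; apply: (subspaceD (poly_le_subspace t s.+1) (hc k)).
  by exists (u0 k), (fun l => u l k); split=> // l; have [h1 _ _ _] := hu l; apply: h1.
- move=> k; have [DD _ _] := der k; rewrite DD du0 dsum !mulrDr addrCA; congr (_ + (_ + _)).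
  rewrite mulr_sumr; apply: eq_bigr => l _; have [_ -> _ _] := hu l; ring.
- apply: (subspaceD (poly_le_subspace t s.+1) hc0); exists z0, z; split=> // l.
  by have [_ _ h1 _] := hu l.
- rewrite -natr1 mulrDl mul1r mulrDr e0.
  have -> : s.+1%:R * (\sum_l c l * t l) = \sum_k (\sum_l u l k * t l) * t k + \sum_l z l * t l.
    under [X in _ = X + _]eq_bigr do rewrite mulr_suml.
    rewrite exchange_big /= -big_split mulr_sumr; apply: eq_bigr => l _ /=.
    have [_ _ _ e] := hu l; rewrite mulrA e mulrDl mulr_suml; congr (_ + _).
    by apply: eq_bigr => k _; ring.
  under [X in _ = X + _]eq_bigr do rewrite !mulrDl.
  rewrite !big_split /=; ring.
Qed.

Lemma chart_diffops : exists (d : 'I_n -> diffop R) c,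
  [/\ B c (dmul h), forall k, B c (d k), forall k, B c (dmul (delta k h)) &
      forall k r, d k * dmul r - dmul r * d k = dmul (delta k r)].
Proof.
have /choice[d hd] k : exists d : diffop R, forall r, d * dmul r - dmul r * d = dmul (delta k r).
  have [DD DM Dk] := chart_der ch k.
  have [a u v|//|d [_ hd]] := @derivation_diffop K R (delta k) _ _; last by exists d.
  rewrite DD; congr (_ + _); rewrite -[u in a *: u]mul1r scalerAl DM.
  have := Dk a; rewrite /= => ->; rewrite mulr0 addr0.
  by rewrite -scalerAl mul1r.
have [c1 h1] := bern_exhaustive grR gr0 xg (dmul h).
have /choice[c2 h2] k := bern_exhaustive grR gr0 xg (d k).
have /choice[c3 h3] k := bern_exhaustive grR gr0 xg (dmul (delta k h)).
exists d, (c1 + (\max_k c2 k + \max_k c3 k))%N; split=> // [|k|k].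
- by apply: bern_mono h1; lia.
- by apply: bern_mono (h2 k); have := leq_bigmax (F := c2) k; lia.
- by apply: bern_mono (h3 k); have := leq_bigmax (F := c3) k; lia.
Qed.

Let dmulZ k (r : R) : dmul (k *: r) = k *: dmul r :> diffop R.
Proof. by apply: diffop_ext => y; rewrite dappZ !dapp_dmul scalerAl. Qed.

Let dmulB (r r' : R) : dmul (r - r') = dmul r - dmul r' :> diffop R.
Proof. by apply: diffop_ext => y; rewrite dappB !dapp_dmul mulrBl. Qed.

Let b1 i : B i 1. Proof. exact: (@bern1 K R gr grR gr0 w). Qed.

(* The operator [h [d k, -] - i (delta k h)] turns [h ^ i p] into [h ^ (i + 2)] times the
   partial derivative of [p]. *)
Lemma chart_descent : exists c, forall s p i, Y s p -> p != 0 ->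
  exists e j, [/\ box (c * s) e, (j <= i + 2 * s)%N & act e (dmul (h ^+ i * p)) = dmul (h ^+ j)].
Proof.
have [d [c [Bh Bd Bdh hd]]] := chart_diffops.
exists (c + c)%N; elim=> [|s IHs] p i Yp p0.
  have [k _ kp] := Yp; have k0 : k != 0 by apply: contra p0 => /eqP k0; rewrite -kp /= k0 scale0r.
  exists (k^-1 *: 1), i; split; [exact: subspaceZ (box_subspace _ _) (bern_box1 grR gr0 w _)|lia|].
  by rewrite actZl act1 -kp /= -scalerAr mulr1 dmulZ scalerA mulVf// scale1r.
have [u [z [hu du hz e]]] := poly_le_derivative Yp.
have [[k uk]|no] := pselect (exists k, u k != 0); last first.
  have {}Yp : Y s p.
    have n0 := natr_neq0 charK0 (ltn0Sn s).
    have -> : p = s.+1%:R^-1 *: z.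
      apply: (scalerI n0); rewrite scalerA mulfV// scale1r.
      rewrite scaler_nat -mulr_natl e big1 ?add0r// => k _.
      have [->|uk] := eqVneq (u k) 0; first by rewrite mul0r.
      by case: no; exists k.
    exact: subspaceZ (poly_le_subspace _ _) hz.
  have [e' [j [he' hj ee']]] := IHs p i Yp p0; exists e', j; split=> //; last lia.
  by apply: bern_box_mono he'; nia.
have [e' [j [he' hj ee']]] := IHs (u k) (i + 2)%N (hu k) uk.
pose rho : enveloping (diffop R) :=
  otimes (dmul h) 1 * (otimes (d k) 1 - otimes 1 (d k)) - i%:R *: otimes (dmul (delta k h)) 1.
have hrho : box (c + c) rho.
  apply: subspaceB (box_subspace _ _) _ _.
    by apply: (bern_boxM grR); [|apply: subspaceB (box_subspace _ _) _ _]; apply: box_otimes.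
  apply: subspaceZ (box_subspace _ _) _; apply: bern_box_mono (leq_addr _ _) _.
  by apply: box_otimes.
exists (e' * rho), j; split; first by rewrite mulnSr; apply: (bern_boxM grR).
  by apply: leq_trans hj _; lia.
rewrite actM -ee'; congr (act e' _).
rewrite actBl actZl actM actBl !act_otimes !mulr1 mul1r hd -!dmulM.
rewrite -dmulZ -dmulB; congr dmul.
have [_ DM _] := chart_der ch k; rewrite DM du (derivationX _ _ (chart_der ch k)).
rewrite scaler_nat -mulr_natl; case: (i) => [|j']; first by rewrite !expr0 /=; ring.
by rewrite /= addn2 !exprS; ring.
Qed.

Lemma chart_reduction : exists c, forall s g, gle s g -> g != 0 ->
  exists e j, [/\ box (c * s) e, (j <= c * s)%N & act e (dmul g) = dmul (h ^+ j)].
Proof.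
have [c hc] := chart_multiple; have [c' hc'] := chart_descent.
exists (c' * c + c + 2 * c)%N => s g gs g0; have [p [v [Yp p0 pE hv]]] := hc s g gs g0.
have [e [j [he hj ee]]] := hc' _ p 0%N Yp p0.
exists (e * otimes (dmul v) 1), j; split; [|nia|].
  apply: (@bern_box_mono K R gr w (c' * (c * s) + c * s)%N); first by nia.
  by apply: (bern_boxM grR) => //; apply: box_otimes => //; exact: (@bern_dmul _ _ _ grR).
by rewrite actM act_otimes mulr1 -dmulM -pE -ee expr0 mul1r.
Qed.

End OneChart.
End ChartReduction.

(** * Gluing the charts *)

Section ChartCover.
Variables (K : fieldType) (R : comAlgType K) (gr : nat -> set R).
Hypothesis grR : is_grading gr.
Hypothesis gr0 : gr 0%N = range (fun k : K => k%:A).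
Variables (w m : nat) (x : 'I_m -> R) (dg : 'I_m -> nat).
Hypothesis xg : graded_generators gr w x dg.
Local Notation B := (bern gr w).
Local Notation box := (box_filtration B).
Local Notation gle := (gr_le grR).

(** Among more than [q * M] factors [h l], some [h l] occurs at least [M] times. The degrees of the
    coefficients are tracked, as they must stay linear in [M]. *)
Lemma cover_power q (b h : 'I_q -> R) D M : (forall l, gle D (b l)) -> (forall l, gle D (h l)) ->
  exists r, (forall l, gle (2 * D * (q * M).+1) (r l)) /\
    (\sum_l b l * h l) ^+ (q * M).+1 = \sum_l r l * h l ^+ M.
Proof.
move=> bD hD; set F := \sum_l b l * h l.
pose T s : set R := [set v | exists r, (forall l, gle s (r l)) /\ v = \sum_l r l * h l ^+ M].
have Tsub s : subspace (T s).
  have [g0 gl] := gr_le_subspace grR s; split.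
    by exists (fun=> 0); split=> //; rewrite big1// => l _; rewrite mul0r.
  move=> k _ _ [r [hr ->]] [r' [hr' ->]]; exists (fun l => k *: r l + r' l).
  split=> [l|]; first exact: gl.
  by rewrite scaler_sumr -big_split; apply: eq_bigr => l _; rewrite mulrDl scalerAl.
have Tmono s s' v : (s <= s')%N -> T s v -> T s' v.
  by move=> le [r [hr ->]]; exists r; split=> // l; apply: gr_le_mono le _.
have TM s s' a v : gle s a -> T s' v -> T (s + s') (a * v).
  move=> ga [r [hr ->]]; exists (fun l => a * r l); split=> [l|]; first exact: gr_leM.
  by rewrite mulr_sumr; apply: eq_bigr => l _; rewrite mulrA.
suff step n (e : 'I_q -> nat) : (q * M < n + \sum_l e l)%N ->
    T (D * (n + (n + \sum_l e l)))%N (F ^+ n * \prod_l h l ^+ e l).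
  have := step (q * M).+1 (fun=> 0%N); rewrite [\prod_l h l ^+ _]big1 ?mulr1// => hT.
  have /hT : (q * M < (q * M).+1 + \sum_(l < q) 0)%N by rewrite addSn ltnS leq_addr.
  by apply: Tmono; rewrite sum_nat_const muln0; nia.
elim: n e => [|n IHn] e lt.
  have [l le] : exists l, (M <= e l)%N.
    apply: contrapT => /forallNP no; move: lt; rewrite add0n ltnNge => /negP; apply.
    rewrite -[q in (q * M)%N]card_ord -sum_nat_const; apply: leq_sum => l _; apply: ltnW.
    by rewrite ltnNge; apply/negP/no.
  exists (fun j => if j == l then h l ^+ (e l - M) * \prod_(j | j != l) h j ^+ e j else 0).
  split=> [j|]; last first.
    rewrite expr0 mul1r (bigD1 l)//= [RHS](bigD1 l)//= eqxx [X in _ = _ + X]big1 => [|j /negbTE->]; last by rewrite mul0r.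
    by rewrite addr0 -{1}(subnK le) exprD; ring.
  case: eqP => _; last exact: subspace0 (gr_le_subspace _ _).
  have -> : (D * (0 + (0 + \sum_j e j)) = D * e l + D * \sum_(j | j != l) e j)%N.
    by rewrite !add0n (bigD1 l)//= mulnDr.
  apply: gr_leM.
    by apply: gr_le_mono (gr_leX gr0 (hD l)); rewrite mulnC leq_mul2l leq_subr orbT.
  rewrite big_distrr /=; apply: (big_ind2 (fun v s => gle s v)); first exact: (gr_le1 grR gr0).
    by move=> v s v' s'; apply: gr_leM.
  by move=> i _; rewrite mulnC; apply: (gr_leX gr0).
rewrite exprS {1}/F mulr_suml mulr_suml; apply: subspace_sum (Tsub _) _ => l _.
have -> : b l * h l * F ^+ n * \prod_j h j ^+ e j = b l * (F ^+ n * \prod_j h j ^+ ((j == l) + e j)).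
  rewrite (bigD1 l)//= [in RHS](bigD1 l)//= eqxx exprS [X in _ = _ * (_ * (_ * X))](_ : _ = \prod_(j | j != l) h j ^+ e j); first ring.
  by apply: eq_bigr => j /negbTE->.
have eS : (\sum_j ((j == l) + e j) = (\sum_j e j).+1)%N.
  rewrite big_split /= (_ : \sum_j (j == l) = 1)%N ?add1n//.
  by rewrite (bigD1 l)//= eqxx big1 ?addn0// => j /negbTE->.
have := IHn (fun j => (j == l) + e j)%N; rewrite eS addnS => /(_ lt)/(TM _ _ _ _ (bD l)).
by apply: Tmono; nia.
Qed.

Let b1 i : B i 1. Proof. exact: (@bern1 K R gr grR gr0 w). Qed.

Let box_dmul i r : gle i r -> box i (otimes (dmul r) 1).
Proof. by move=> h; apply: box_otimes => //; exact: (@bern_dmul _ _ _ grR). Qed.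

Definition reduces_to_power (h : R) := exists c, forall s g, gle s g -> g != 0 ->
  exists e j, [/\ box (c * s) e, (j <= c * s)%N & act e (dmul g) = dmul (h ^+ j)].

(** The powers reached on the charts are raised to a common exponent [M] linear in [s];
    [cover_power] combines them into a power of [f], again with linear exponent, which the last
    hypothesis turns into 1. *)
Lemma cover_reduction f a q (b h : 'I_q -> R) c0 : f ^+ a = \sum_l b l * h l ->
  (forall l, reduces_to_power (h l)) ->
  (forall N, exists e, box (c0 * N) e /\ act e (dmul (f ^+ N)) = 1) ->
  exists c, forall s g, gle s g -> g != 0 -> exists e, box (c * s) e /\ act e (dmul g) = 1.
Proof.
move=> fE /choice[cl hcl] hf; pose c := (\max_l cl l)%N.
have [D [bD hD]] : exists D, (forall l, gle D (b l)) /\ (forall l, gle D (h l)).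
  have /choice[D1 h1] l := gr_le_ex grR (b l); have /choice[D2 h2] l := gr_le_ex grR (h l).
  exists (\max_l D1 l + \max_l D2 l)%N; split=> l.
    by apply: gr_le_mono (h1 l); have := leq_bigmax (F := D1) l; lia.
  by apply: gr_le_mono (h2 l); have := leq_bigmax (F := D2) l; lia.
exists (c0 * (a * (q * c).+1) + (2 * D * (q * c).+1 + (D * c + c)))%N => s g.
(* Degree 0 is separate: the exponent [(q * M).+1] is bounded by a multiple of [s] only for positive
   [s], while for [s = 0] the element is a scalar. *)
case: s => [|s] gs g0.
  have [k gk] := gr_le0 gr0 gs; exists (k^-1 *: 1); rewrite muln0; split.
    exact: subspaceZ (box_subspace _ _) (bern_box1 grR gr0 w _).
  rewrite actZl act1; apply: diffop_ext => y; rewrite dappZ dapp_dmul gk -scalerAl mul1r scalerA.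
  by rewrite mulVf ?scale1r//; apply: contra g0 => /eqP k0; rewrite gk k0 scale0r.
set M := (c * s.+1)%N.
have [r [hr rE]] := cover_power M bD hD.
have /choice[e he] l : exists e, box (D * M + M) e /\ act e (dmul g) = dmul (h l ^+ M).
  have [e [j [he hj ee]]] := hcl l _ _ gs g0.
  have cM : (cl l * s.+1 <= M)%N by rewrite leq_mul2r; apply/orP; right; exact: (leq_bigmax (F := cl)).
  exists (otimes (dmul (h l ^+ (M - j))) 1 * e); split.
    apply: (bern_boxM grR); last by apply: bern_box_mono he.
    by apply: box_dmul; apply: gr_le_mono (gr_leX gr0 (hD l)); rewrite mulnC leq_mul2l leq_subr orbT.
  by rewrite actM ee act_otimes mulr1 -dmulM -exprD subnK//; lia.
have [e0 [he0 ee0]] := hf (a * (q * M).+1)%N.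
exists (e0 * \sum_l otimes (dmul (r l)) 1 * e l); split.
  apply: (@bern_box_mono K R gr w
    (c0 * (a * (q * M).+1) + (2 * D * (q * M).+1 + (D * M + M)))%N).
    have le : ((q * M).+1 <= (q * c).+1 * s.+1)%N by rewrite /M; nia.
    have H k : (k * (q * M).+1 <= k * (q * c).+1 * s.+1)%N by rewrite -mulnA leq_mul2l le orbT.
    rewrite !mulnDl !leq_add//; first by have := H (c0 * a)%N; rewrite -!(mulnA c0 a).
    by rewrite /M mulnA.
  apply: (bern_boxM grR) => //; apply: subspace_sum (box_subspace _ _) _ => l _; apply: (bern_boxM grR); first exact: box_dmul.
  by have [] := he l.
rewrite actM -[RHS]ee0; congr (act e0 _); rewrite act_suml exprM fE rE.
apply: diffop_ext => y; rewrite dapp_sum dapp_dmul mulr_suml; apply: eq_bigr => l _.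
by have [_ el] := he l; rewrite actM el act_otimes mulr1 dappM !dapp_dmul mulrA.
Qed.

End ChartCover.

(** * Proof of (1) and assembly *)

Section SingularLocusSandwich.
Variables (K : fieldType) (R : comAlgType K) (gr : nat -> set R).
Hypothesis charK0 : [pchar K] =i pred0.
Hypothesis grR : is_grading gr.
Hypothesis gr0 : gr 0%N = range (fun k : K => k%:A).
Variables (w m : nat) (x : 'I_m -> R) (dg : 'I_m -> nat).
Hypothesis xg : graded_generators gr w x dg.

Lemma sub_generators v : sub (in_alg R) [seq x i | i : 'I_m] v.
Proof.
have sS := sub_subring (in_alg R) [seq x i | i : 'I_m]; have [lk lD lM] := sS.
have : alg_gen (range x) v by rewrite (ggen_gen xg).
apply: alg_gen_le => [|_ [i _ <-]]; last by apply: mem_sub; apply: codom_f.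
split=> //; first exact: subring1 sS.
split=> [|k a b ha hb]; first exact: subring0 sS.
by apply: lD => //; rewrite -mulr_algl; apply: lM => //; apply: lk.
Qed.

Lemma sandwich_linearly_simple (f : R) (b : {poly K}) : nonzerodivisor f ->
  in_singular_locus f -> sandwich_equation f b -> (forall n : nat, ~~ root b n%:R) ->
  linearly_simple (bern gr w).
Proof.
move=> freg fsing fb nr.
have reg (Q : set R) : is_prime Q -> ~ Q f -> exists (L : comNzRingType) (phi : {rmorphism R -> L}),
    local_map Q phi /\ regular_local_ring L.
  move=> hQ Qf; have [P [PQ [phi hphi]]] := localization_map hQ.
  exists (localization P), phi; split=> //; apply: contrapT => /fsing/PQ.
  exact: Qf.
have [c0 hc0] := sandwich_powers grR gr0 xg fb nr.
have dom : forall u v : R, u * v = 0 -> u = 0 \/ v = 0.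
  apply: (graded_domain grR gr0 freg).
  - by move=> N; have [e [_ he]] := hc0 N; exists e.
  - exact: sub_noeth sub_generators.
  - move=> Q hQ Qf; have [L [phi [loc hreg]]] := reg Q hQ Qf.
    exact: (regular_prime_killed charK0 sub_generators hQ loc hreg).
(* The charts cover the locus where [f] is invertible: otherwise a prime avoiding [f] would contain
   every such [h], including the one of its own chart. *)
have [a [l [lred fE]]] : exists a (l : seq (R * R)),
    (forall p, p \in l -> reduces_to_power grR w p.2) /\ f ^+ a = \sum_(p <- l) p.1 * p.2.
  pose I : set R := [set v | exists l : seq (R * R),
    (forall p, p \in l -> reduces_to_power grR w p.2) /\ v = \sum_(p <- l) p.1 * p.2].
  apply: contrapT => no; have [||P [hP IP Pf]] := @prime_avoiding R I f.
  - split.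
    + by exists [::]; rewrite big_nil.
    + move=> _ _ [l [hl ->]] [l' [hl' ->]]; exists (l ++ l'); rewrite big_cat; split=> // p.
      by rewrite mem_cat => /orP[/hl|/hl'].
    + move=> u _ [l [hl ->]]; exists [seq (u * p.1, p.2) | p <- l]; split.
        by move=> _ /mapP[p /hl hp ->].
      by rewrite big_map mulr_sumr; apply: eq_bigr => p _; rewrite mulrA.
  - by move=> n [l hl]; apply: no; exists n, l.
  have [L [phi [loc hreg]]] := reg P hP Pf.
  have [d [y [p [Py cut pp pP pS]]]] := regular_parameters hP loc hreg.
  have [e [t [delta [h [ch Ph _]]]]] := regular_chart charK0 dom hP sub_generators Py cut pp pP pS.
  apply: (Ph); apply: IP; exists [:: (1, h)]; rewrite big_seq1 mul1r; split=> // _ /[!inE]/eqP-> /=.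
  apply: (chart_reduction grR gr0 xg charK0 dom ch); apply/eqP => h0.
  by apply: Ph; rewrite h0; have [[]] := hP.
have [|l' |c hc] := @cover_reduction K R gr grR gr0 w f a (size l) (fun i => (tnth (in_tuple l) i).1)
    (fun i => (tnth (in_tuple l) i).2) c0 _ _ hc0.
- by rewrite fE big_tnth.
- by apply: lred; apply: mem_tnth.
(* Tensors of level [w * t] act on both sides of [r], so the function reached by commutators has
   degree at most [(w + 1 + w) * t]. *)
apply/linearly_simpleP; exists (c * (w + 1 + w) + w)%N => t r Br r0.
have [e he [g [i gi] eg]] := @commutator_reduction K R gr grR gr0 w m x dg xg t 1 (fun=> r) (fun=> Br)
  (ex_intro _ ord0 r0).
have gs : gr_le grR (w * t + t + w * t) (g i).
  rewrite -[g i]mulr1 -dapp_dmul -(eg i); apply: (@bern_app1 K R gr grR gr0 w).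
  by apply: act_box => //; [exact: bern_subspace|move=> *; exact: bernM].
have [e' [he' ee']] := hc _ _ gs gi.
exists (e' * e); last by rewrite actM (eg i).
apply: (@bern_box_mono K R gr w (c * (w * t + t + w * t) + w * t)%N); first nia.
by apply: (bern_boxM grR).
Qed.

End SingularLocusSandwich.

Lemma bernstein_slope_bern (K : fieldType) (R : comAlgType K) (gr : nat -> set R) (w : int) :
  bernstein_slope gr w ->
  exists w', bernstein_slope gr w'.+1 /\ bernstein_filtration gr w = bern gr w'.
Proof.
move=> hw; have [w0|] := lerP w 0.
  have [h e] := bern_slope_le0 w0 hw; exists 0%N; split=> //.
  by rewrite e -bernE.
by case: w hw => [[|w]|w] hw // _; exists w; rewrite -bernE.
Qed.

Theorem theorem1p3 (K : fieldType) (charK0 : [pchar K] =i pred0)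
    (R : comAlgType K) (Rfg : finitely_generated_alg R)
    (gr : nat -> set R) (grR : is_grading gr)
    (gr0 : gr 0%N = range (fun k : K => k%:A)) :
  [/\
      (exists (f : R) (b : {poly K}),
         [/\ nonzerodivisor f, in_singular_locus f, sandwich_bs_poly f b
           & forall n : nat, ~~ root b n%:R]) ->
      forall w : int, bernstein_slope gr w ->
        linearly_simple (bernstein_filtration gr w),
      affine_semigroup_ring R ->
      forall w : int, bernstein_slope gr w ->
        linearly_simple (bernstein_filtration gr w) ->
      forall f : R, f != 0 ->
        exists b : {poly K}, sandwich_bs_poly f b /\ b != 0
    &
      forall w : int, bernstein_slope gr w ->
        linearly_simple (box_filtration (bernstein_filtration gr w)) ->
      forall f : R, f != 0 ->
        exists b : {poly K}, sandwich_bs_poly f b /\ b != 0].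
Proof.
split=> [[f [b [freg fsing [_ fb] nr]]]|[n [s [phi [phiI phi_im]]]]|] w /bernstein_slope_bern[w' [hw ->]].
- have [m [x [dg xg]]] := graded_generators_ex Rfg gr0 hw.
  apply: (sandwich_linearly_simple charK0 grR gr0 xg freg fsing _ nr).
  by apply/fb; exists 1; rewrite mul1r.
- have [m [x [dg xg]]] := graded_generators_ex Rfg gr0 hw.
  move=> simple f _; apply: (linearly_simple_box_sandwich charK0 grR gr0 xg).
  exact: (toric_box_linearly_simple phiI phi_im grR gr0 xg charK0).
- have [m [x [dg xg]]] := graded_generators_ex Rfg gr0 hw.
  by move=> simple f _; apply: (linearly_simple_box_sandwich charK0 grR gr0 xg).
Qed.
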